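(* Let $p,q\in[1,\infty]$, $s,t\in\mathbb R$ and $0\le\alpha_1\le\alpha_2\le1$. If $1/p\le\max(1/2,1/q)$ then $$M^{p,q}_{\alpha_1,s}(\mathbb R^d)\subseteq M^{p,q}_{\alpha_2,t}(\mathbb R^d)\ \text{(continuous inclusion)}\quad\Longrightarrow\quad t\le s+d(\alpha_2-\alpha_1)\theta_2(p,q).$$ If $1/p\ge\min(1/2,1/q)$ then $$M^{p,q}_{\alpha_2,t}(\mathbb R^d)\subseteq M^{p,q}_{\alpha_1,s}(\mathbb R^d)\ \text{(continuous inclusion)}\quad\Longrightarrow\quad t\ge s+d(\alpha_2-\alpha_1)\theta_1(p,q).$$
   Context: Indices: with $1/p+1/p'=1$ (and $1/\infty=0$), $$\theta_1(p,q)=\max\big(0,\,q^{-1}-\min(p^{-1},p'^{-1})\big),\qquad \theta_2(p,q)=\min\big(0,\,q^{-1}-\max(p^{-1},p'^{-1})\big).$$ Convention: inclusions of topological spaces are understood as embeddings, that is, the inclusion is continuous. Notation: $\langle\xi\rangle=(1+|\xi|^2)^{1/2}$; $\mu$ is Lebesgue measure; $B(c,r)$ is the closed ball of center $c$ and radius $r$; $\widehat f(\xi)=\mathscr Ff(\xi)=(2\pi)^{-d/2}\int_{\mathbb R^d}f(x)e^{-ix\cdot\xi}\,dx$, extended to $\mathscr S'(\mathbb R^d)$; $\psi(D)f=\mathscr F^{-1}(\psi\widehat f)$. $X\asymp Y$ means $C^{-1}X\le Y\le CX$ with a constant $C>0$ uniform over the indicated indices. Admissible covering: a countable family $\mathcal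 Q$ of subsets of $\mathbb R^d$ with $\bigcup_{Q\in\mathcal Q}Q=\mathbb R^d$ and, for some finite integer $n_0$, $|\{Q'\in\mathcal Q: Q\cap Q'\ne\emptyset\}|\le n_0$ for all $Q\in\mathcal Q$. For $Q\in\mathcal Q$ let $r_Q=\sup\{r\in\mathbb R: B(c,r)\subseteq Q\text{ for some }c\in\mathbb R^d\}$ and $R_Q=\inf\{R\in\mathbb R: Q\subseteq B(c,R)\text{ for some }c\in\mathbb R^d\}$. For $\alpha\in[0,1]$, an admissible covering $\mathcal Q$ (of measurable sets) is an $\alpha$-covering if $\mu(Q)\asymp\langle x\rangle^{\alpha d}$ for $x\in Q$, $Q\in\mathcal Q$ (uniformly), and there is $K\ge1$ with $R_Q/r_Q\le K$ for all $Q\in\mathcal Q$. A bounded admissible partition of unity corresponding to an $\alpha$-covering $\mathcal Q$ ($\mathcal Q$-BAPU) is a family $\{\psi_Q\}_{Q\in\mathcal Q}\subseteq C_c^\infty(\mathbb R^d)$ with $\operatorname{supp}\psi_Q\subseteq Q$, $\sum_{Q\in\mathcal Q}\psi_Q(\xi)=1$ for all $\xi\in\mathbb R^d$, and $\sup_{Q\in\mathcal Q}\|\mathscr F\psi_Q\|_{L^1}<\infty$. $\alpha$-modulation space: for $\alpha\in[0,1]$, $p,q\in[1,\infty]$, $s\in\mathbb R$, fix an $\alpha$-covering $\mathcal Q$, a $\mathcal Q$-BAPU $\{\psi_Q\}$ and points $\xi_Q\in Q$. Then $M_{\alpha,s}^{p,q}(\mathbb R^d)$ is the space of all $f\in\mathscr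 S'(\mathbb R^d)$ with $$\|f\|_{M_{\alpha,s}^{p,q}}=\Big(\sum_{Q\in\mathcal Q}\langle\xi_Q\rangle^{qs}\|\psi_Q(D)f\|_{L^p}^q\Big)^{1/q}<\infty,$$ with the $\ell^q$ norm replaced by the $\ell^\infty$ norm (supremum) if $q=\infty$. Different choices of $\mathcal Q$, $\{\psi_Q\}$, $\{\xi_Q\}$ give the same space with equivalent norms. For $\alpha=1$ one has the Besov space $B^{p,q}_s=M^{p,q}_{1,s}$. *)

(* Defs.v *)
From HB Require Import structures.
From mathcomp Require Import all_boot all_order all_algebra.
From mathcomp Require Import complex.
From mathcomp Require Import all_classical all_reals all_analysis.

Set Implicit Arguments.
Unset Strict Implicit.
Unset Printing Implicit Defensive.

Import Order.TTheory GRing.Theory Num.Theory.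
Import numFieldNormedType.Exports.

Local Open Scope classical_set_scope.
Local Open Scope ring_scope.
Local Open Scope complex_scope.

(* R^d is 'rV[R]_d.  Its library norm is the sup norm, which serves only as  *)
(* a source of topology; balls, weights, and so on use the Euclidean norm.   *)

Section euclidean.
Context {R : realType} {d : nat}.
Implicit Types (x y c : 'rV[R]_d) (r : R).

Definition dot x y : R := \sum_(i < d) x 0 i * y 0 i.
Definition enorm x : R := Num.sqrt (dot x x).
Definition jbracket x : R := Num.sqrt (1 + enorm x ^+ 2).
Definition cball c r : set 'rV[R]_d := [set x | enorm (x - c) <= r].

End euclidean.

Fact measure_rV_display : measure_display.
Proof. exact: default_measure_display. Qed.

Section measurable_rV.
Context (R : realType) (n : nat).

Let coors : 'I_n -> 'rV[R]_n -> R := fun i x => x 0 i.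

Let rV_set0 : g_sigma_preimage coors set0.
Proof. exact: sigma_algebra0. Qed.

Let rV_setC A : g_sigma_preimage coors A -> g_sigma_preimage coors (~` A).
Proof. exact: sigma_algebraC. Qed.

Let rV_bigcup (F : _^nat) : (forall i, g_sigma_preimage coors (F i)) ->
  g_sigma_preimage coors (\bigcup_i (F i)).
Proof. exact: sigma_algebra_bigcup. Qed.

HB.instance Definition _ := @isMeasurable.Build measure_rV_display
  'rV[R]_n (g_sigma_preimage coors) rV_set0 rV_setC rV_bigcup.

End measurable_rV.

Lemma measurable_coord (R : realType) n (i : 'I_n) :
  measurable_fun [set: 'rV[R]_n] (fun x => x 0 i).
Proof.
move=> _ Y mY; rewrite setTI; apply: sub_sigma_algebra => /=.
rewrite -bigcup_seq/=; exists i => /=; first by rewrite mem_index_enum.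
by exists Y => //; rewrite setTI.
Qed.

Lemma measurable_fun_rV (d' : measure_display) (T : measurableType d')
    (R : realType) n (f : T -> 'rV[R]_n) :
  (forall i, measurable_fun [set: T] (fun x => f x 0 i)) ->
  measurable_fun [set: T] f.
Proof.
move=> mf _ B mB; rewrite setTI; move: B mB.
have sa : sigma_algebra setT [set B | measurable (f @^-1` B)].
  split=> /=.
  - by rewrite preimage_set0.
  - by move=> B mB; rewrite setTD preimage_setC; exact: measurableC.
  - by move=> F mF; rewrite preimage_bigcup; exact: bigcup_measurable.
apply: smallest_sub => // B /=.
rewrite -bigcup_seq/= => -[i _ [Y mY <-]] /=.
rewrite setTI -comp_preimage -[X in measurable X]setTI.
exact: mf.
Qed.

Definition snoc_rV (R : realType) n (u : 'rV[R]_n * R) : 'rV[R]_n.+1 :=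
  \row_(i < n.+1) (if unlift ord_max i is Some j then u.1 0 j else u.2).

Lemma measurable_snoc_rV (R : realType) n :
  measurable_fun setT (@snoc_rV R n).
Proof.
apply: measurable_fun_rV => i; case: (unliftP ord_max i) => [j ->|->].
  rewrite (_ : (fun _ => _) = (fun x : 'rV[R]_n => x 0 j) \o fst).
    by apply: measurableT_comp => //; exact: measurable_coord.
  by apply/funext => u; rewrite mxE liftK.
rewrite (_ : (fun _ => _) = snd) //.
by apply/funext => u; rewrite mxE unlift_none.
Qed.

Section snoc_measure.
Context (R : realType) (n : nat) (m : {measure set 'rV[R]_n -> \bar R}).

Definition snoc_measure : set 'rV[R]_n.+1 -> \bar R :=
  pushforward (m \x lebesgue_measure)%E (@snoc_rV R n).

Let snoc_measure0 : snoc_measure set0 = 0%E.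
Proof. by rewrite /snoc_measure /pushforward preimage_set0 measure0. Qed.

Let snoc_measure_ge0 A : (0 <= snoc_measure A)%E.
Proof. by rewrite /snoc_measure /pushforward measure_ge0. Qed.

Let snoc_measure_sigma_additive : semi_sigma_additive snoc_measure.
Proof.
have h := @measurable_snoc_rV R n.
exact: measure_semi_sigma_additive.
Qed.

HB.instance Definition _ := isMeasure.Build _ _ _ snoc_measure
  snoc_measure0 snoc_measure_ge0 snoc_measure_sigma_additive.

End snoc_measure.

Fixpoint lebesgue_rV (R : realType) (n : nat) :
    {measure set 'rV[R]_n -> \bar R} :=
  match n with
  | 0 => \d_(0 : 'rV[R]_0)
  | n'.+1 => snoc_measure (lebesgue_rV R n')
  end.

Lemma lebesgue_rV_box (R : realType) n (A : 'I_n -> set R) :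
  (forall i, measurable (A i)) ->
  lebesgue_rV R n [set x | forall i, A i (x 0 i)] =
  (\prod_(i < n) lebesgue_measure (A i))%E.
Proof.
elim: n A => [|n IH] A mA.
  by rewrite big_ord0 /= diracE mem_set//= => -[].
have mbox : measurable
    [set x : 'rV[R]_n | forall i, A (widen_ord (leqnSn n) i) (x 0 i)].
  rewrite (_ : [set _ | _] = \big[setI/setT]_(i < n)
      ((fun x : 'rV[R]_n => x 0 i) @^-1` A (widen_ord (leqnSn n) i))).
    apply: bigsetI_measurable => i _.
    by rewrite -[X in measurable X]setTI; exact: measurable_coord.
  rewrite -bigcap_seq/=; apply/seteqP; split=> [x h i _|x h i]; first exact: h.
  by apply: (h i) => /=; rewrite mem_index_enum.
rewrite big_ord_recr/= -IH// -product_measure1E//; last exact: mA.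
have wE i : widen_ord (leqnSn n) i = lift ord_max i.
  by apply: val_inj; apply/esym; exact: lift_max.
rewrite /snoc_measure /pushforward; congr ((_ \x _)%E _).
apply/seteqP; split=> -[u t] /= h.
- split=> [i|]; last by have := h ord_max; rewrite mxE unlift_none.
  by have := h (lift ord_max i); rewrite mxE liftK/= wE.
- move=> i; rewrite mxE; case: unliftP => [j ->|->]; last by case: h.
  by case: h => h _; have := h j; rewrite wE.
Qed.

(* Lebesgue outer measure; its Caratheodory-measurable sets are exactly the  *)
(* Lebesgue-measurable ones.                                                 *)
Definition lebesgue_outer (R : realType) (d : nat) :
    set 'rV[R]_d -> \bar R := mu_ext (lebesgue_rV R d).

Lemma lebesgue_outerE (R : realType) d (A : set 'rV[R]_d) :
  measurable A -> lebesgue_outer A = lebesgue_rV R d A.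
Proof. by move=> mA; rewrite /lebesgue_outer measurable_mu_extE. Qed.

Section distributions.
Context {R : realType} {d : nat}.
Local Notation V := 'rV[R]_d.
Local Notation mu := (lebesgue_rV R d).
Implicit Types (f g phi psi : V -> R[i]) (T : (V -> R[i]) -> R[i]).

Definition cnorm (z : R[i]) : R := ComplexField.Normc.normc z.

Definition cexpi (t : R) : R[i] := cos t +i* sin t.

Definition cintegral f : R[i] :=
  (\int[mu]_x complex.Re (f x)) +i* (\int[mu]_x complex.Im (f x)).

(* [pderivs [:: i1; ..; ik] u] is the partial derivative d_i1 .. d_ik u.      *)
Fixpoint pderivs (l : seq 'I_d) (u : V -> R) : V -> R :=
  if l is i :: l' then fun x => 'D_('e_i) (pderivs l' u) x else u.

Definition smooth_real (u : V -> R) : Prop := forall l : seq 'I_d,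
  continuous (pderivs l u) /\
  forall (i : 'I_d) (x : V), derivable (pderivs l u) x 'e_i.

Definition smooth f : Prop :=
  smooth_real (fun x => complex.Re (f x)) /\
  smooth_real (fun x => complex.Im (f x)).

Definition cpderivs (l : seq 'I_d) f (x : V) : R[i] :=
  pderivs l (fun y => complex.Re (f y)) x +i*
  pderivs l (fun y => complex.Im (f y)) x.

Definition supp f : set V := closure [set x | f x != 0].

Definition Ccinfty : set (V -> R[i]) :=
  [set f | smooth f /\ compact (supp f)].

Definition schwartz_seminorm (N : nat) f : \bar R :=
  ereal_sup [set z | exists (l : seq 'I_d) (x : V), (size l <= N)%N /\
    z = (jbracket x ^+ N * cnorm (cpderivs l f x))%:E].

Definition schwartz : set (V -> R[i]) :=
  [set f | smooth f /\ forall N, (schwartz_seminorm N f < +oo)%E].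

(* A tempered distribution is represented by a functional on all functions   *)
(* V -> R[i] of which only the restriction to [schwartz] is meaningful:      *)
(* every notion below depends on that restriction alone.                     *)
Definition tempered T : Prop :=
  (forall (a : R[i]) phi psi, schwartz phi -> schwartz psi ->
     T (fun x => a * phi x + psi x) = a * T phi + T psi) /\
  exists (N : nat) (C : R), forall phi, schwartz phi ->
    ((cnorm (T phi))%:E <= C%:E * schwartz_seminorm N phi)%E.

Definition fourier f (xi : V) : R[i] :=
  ((2 * pi) `^ (- (d%:R / 2)))%:C *
  cintegral (fun x => f x * cexpi (- dot x xi)).

Definition inv_fourier f (xi : V) : R[i] :=
  ((2 * pi) `^ (- (d%:R / 2)))%:C *
  cintegral (fun x => f x * cexpi (dot x xi)).

Definition dist_fourier T : (V -> R[i]) -> R[i] := fun phi => T (fourier phi).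

Definition dist_inv_fourier T : (V -> R[i]) -> R[i] :=
  fun phi => T (inv_fourier phi).

Definition dist_mul psi T : (V -> R[i]) -> R[i] :=
  fun phi => T (fun x => psi x * phi x).

Definition fourier_multiplier psi T : (V -> R[i]) -> R[i] :=
  dist_inv_fourier (dist_mul psi (dist_fourier T)).

Definition Lpnorm (p : \bar R) g : \bar R :=
  Lnorm mu p (fun x => (cnorm (g x))%:E).

Definition represents g T : Prop :=
  [/\ measurable_fun setT (fun x => complex.Re (g x)),
      measurable_fun setT (fun x => complex.Im (g x)) &
      forall phi, schwartz phi -> T phi = cintegral (fun x => g x * phi x)].

(* The L^p norm of a distribution is that of the function (unique almost     *)
(* everywhere) representing it, and +oo if no function in L^p does.          *)
Definition dist_Lpnorm (p : \bar R) T : \bar R :=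
  ereal_inf [set Lpnorm p g | g in [set g | represents g T]].

End distributions.


Section alpha_modulation.
Context {R : realType} {d : nat}.
Local Notation V := 'rV[R]_d.
Implicit Types (QQ : set (set V)) (Q : set V).

Definition admissible_covering QQ : Prop :=
  [/\ countable QQ,
      \bigcup_(Q in QQ) Q = setT &
      exists n0 : nat, forall Q, QQ Q ->
        ([set Q' | QQ Q' /\ Q `&` Q' !=set0] #<= `I_n0)%card].

Definition inner_radius Q : \bar R :=
  ereal_sup [set r%:E | r in [set r : R | exists c, cball c r `<=` Q]].

Definition outer_radius Q : \bar R :=
  ereal_inf [set r%:E | r in [set r : R | exists c, Q `<=` cball c r]].

(* Division in \bar R: 1 / 0 = +oo.  The degenerate values 0 / 0 and         *)
(* +oo / +oo are ruled out by the bounds on the measure.                     *)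
Definition alpha_covering (alpha : R) QQ : Prop :=
  [/\ admissible_covering QQ,
      forall Q, QQ Q -> (@lebesgue_outer R d).-caratheodory Q,
      exists2 C : R, 0 < C & forall Q (x : V), QQ Q -> Q x ->
        ((C^-1 * jbracket x `^ (alpha * d%:R))%:E <= lebesgue_outer Q)%E /\
        (lebesgue_outer Q <= (C * jbracket x `^ (alpha * d%:R))%:E)%E &
      exists2 K : R, 1 <= K & forall Q, QQ Q ->
        (outer_radius Q / inner_radius Q <= K%:E)%E].

(* The sum over QQ is finitely supported at each point when QQ is admissible *)
(* and the supports are contained in the respective sets.                    *)
Definition BAPU QQ (psi : set V -> V -> R[i]) : Prop :=
  [/\ forall Q, QQ Q -> Ccinfty (psi Q),
      forall Q, QQ Q -> supp (psi Q) `<=` Q,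
      forall x, \sum_(Q \in QQ) psi Q x = 1 &
      (ereal_sup [set Lpnorm 1 (fourier (psi Q)) | Q in QQ] < +oo)%E].

Record modulation_data (alpha : R) := ModulationData {
  md_cover : set (set V) ;
  md_bapu : set V -> V -> R[i] ;
  md_point : set V -> V ;
  md_coverP : alpha_covering alpha md_cover ;
  md_bapuP : BAPU md_cover md_bapu ;
  md_pointP : forall Q, md_cover Q -> Q (md_point Q) }.

Section space.
Context (alpha : R) (D : modulation_data alpha) (p q : \bar R) (s : R).
Implicit Types f g : (V -> R[i]) -> R[i].

Definition modulation_norm f : \bar R :=
  if q is q%:E then
    ((\esum_(Q in md_cover D)
        (jbracket (md_point D Q) `^ (q * s))%:E *
        dist_Lpnorm p (fourier_multiplier (md_bapu D Q) f) `^ q) `^ q^-1)%E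
  else
    ereal_sup [set ((jbracket (md_point D Q) `^ s)%:E *
                    dist_Lpnorm p (fourier_multiplier (md_bapu D Q) f))%E
              | Q in md_cover D].

Definition modulation_space : set ((V -> R[i]) -> R[i]) :=
  [set f | tempered f /\ (modulation_norm f < +oo)%E].

End space.

(* Inclusion X `<=` Y of the spaces with (semi)norms NX and NY, continuous    *)
(* for the topologies these define.                                          *)
Definition continuous_inclusion
    (X : set ((V -> R[i]) -> R[i])) (NX : ((V -> R[i]) -> R[i]) -> \bar R)
    (Y : set ((V -> R[i]) -> R[i])) (NY : ((V -> R[i]) -> R[i]) -> \bar R) :
    Prop :=
  X `<=` Y /\
  forall f, X f -> forall e : R, 0 < e -> exists2 r : R, 0 < r &
    forall g, X g -> (NX (fun phi => g phi - f phi)%R < r%:E)%E ->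
                     (NY (fun phi => g phi - f phi)%R < e%:E)%E.

Definition modulation_embedding (alpha beta : R) (D : modulation_data alpha)
    (E : modulation_data beta) (p q : \bar R) (s t : R) : Prop :=
  continuous_inclusion
    (modulation_space D p q s) (modulation_norm D p q s)
    (modulation_space E p q t) (modulation_norm E p q t).

End alpha_modulation.


Section indices.
Context {R : realType}.
Implicit Types p q : \bar R.

(* The real number 1/p for p in [1, +oo], with 1/oo = 0. *)
Definition recip p : R := fine (p^-1)%E.

Definition theta1 p q : R :=
  Num.max 0 (recip q - Num.min (recip p) (recip (hoelder_conjugate p))).

Definition theta2 p q : R :=
  Num.min 0 (recip q - Num.max (recip p) (recip (hoelder_conjugate p))).

End indices.

Lemma recip_pinfty (R : realType) : recip (+oo : \bar R)%E = 0.
Proof. by rewrite /recip invey. Qed.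

Lemma recip_conjugate (R : realType) (p : \bar R) : (1 <= p)%E ->
  recip p + recip (hoelder_conjugate p) = 1.
Proof.
move=> p1; have q1 := hoelder_conj_ge1 p1.
have fin (r : \bar R) : (1 <= r)%E -> (r^-1)%E \is a fin_num.
  case: r => [r|_|//]; last by rewrite invey.
  by rewrite lee_fin => r1; rewrite inver gt_eqF// (lt_le_trans ltr01).
rewrite /recip -fineD ?fin// hoelder_conjugate_eq1//.
- by rewrite (lt_le_trans _ p1)// ltNyr.
- by rewrite gt_eqF// (lt_le_trans _ p1)// lte01.
Qed.

(* Main.v *)
Require Import Defs.
From HB Require Import structures.
From mathcomp Require Import all_boot all_order all_algebra.
From mathcomp Require Import complex ring lra finmap.
From mathcomp Require Import all_classical all_reals all_analysis.
From mathcomp Require Import measurable_realfun ess_sup_inf.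

Set Implicit Arguments.
Unset Strict Implicit.
Unset Printing Implicit Defensive.

Import Order.TTheory GRing.Theory Num.Theory.
Import numFieldNormedType.Exports.

Local Open Scope classical_set_scope.
Local Open Scope ring_scope.
Local Open Scope complex_scope.

(** Both norms are evaluated on an explicit family of functions. The test function
    of frequency [c] and scale [r] has for Fourier transform a product of
    trapezoids, constant on the cube [cube c r] and zero off [cube c (2 * r)]. An
    embedding is a bounded map, so the ratio of the two norms of a test function is
    bounded, uniformly in [c] and [r] ([embedding_compare]); letting [c] go to
    infinity turns this bound into an inequality between the exponents of
    [jbracket c] ([growth_exponent]).

    If [cube c (2 * r)] lies in one member of a covering, the norm of weight [s] is
    comparable to <c>^s r^(d/p'), where p' is the conjugate of p ([member_upper],
    [member_lower]). A tiny cube lies in a member of each covering, and comparing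
    the two norms gives the inequality between [s] and [t] without any loss
    ([embedding_weight]).

    Then take the cube inside a member of the coarser covering, with r of the
    order of <c>^alpha2. The finer covering cuts it into about
    n = <c>^(d (alpha2 - alpha1)) pieces of side rho = <c>^alpha1 ([count_cube]).
    By the Bernstein inequality each piece has L^p norm at most rho^(d/p'), so the
    finer norm is at most <c>^s rho^(d/p') n^(1/q) ([split_upper]). Against
    [member_lower] this yields t <= s + d (alpha2 - alpha1) (1/q - 1/p')
    ([embedding_fine_coarse]). In the other direction the finer norm has to be
    bounded from below. The pairings of the pieces with the test function add up to
    its square norm, of order r^d, for every partition of unity ([pair_sum]); each
    pairing is at most the supremum of the piece, that is rho^(d/p) times its L^p
    norm, and the Hoelder inequality over the n pieces concludes ([split_lower],
    [embedding_coarse_fine]).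

    The numbers 1/q - 1/p' and 0 are the two candidates in theta2 when 1/p <= 1/2,
    and in theta1 when 1/p >= 1/2. For the other values of p, the hypothesis
    compares 1/p with 1/q in such a way that the theta in question is 0, and the
    comparison of the weights is enough.

    The L^p norm of a frequency piece is defined through the functions that
    represent it. For a test function the piece is represented by a bounded
    function, explicit by the multiplication formula ([represents_mult]), and all
    functions of finite norm that represent it agree with that one almost
    everywhere ([represents_unique]). All the estimates then follow from the
    domination of the test functions by products of Cauchy kernels and from
    interpolation between L^1 and L^oo ([young], [hoelder_bounded]). *)

(** * Integration of complex-valued functions *)

Section cnorm.
Context {R : realType}.
Implicit Types z w : R[i].

Lemma cnormE z :
  cnorm z = Num.sqrt (complex.Re z ^+ 2 + complex.Im z ^+ 2).
Proof. by case: z. Qed.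

Lemma cnorm_ge0 z : 0 <= cnorm z.
Proof. by rewrite cnormE sqrtr_ge0. Qed.

Lemma cnorm0 : cnorm (0 : R[i]) = 0.
Proof. exact: ComplexField.Normc.normc0. Qed.

Lemma cnormM z w : cnorm (z * w) = cnorm z * cnorm w.
Proof. exact: ComplexField.Normc.normcM. Qed.

Lemma cnormD z w : cnorm (z + w) <= cnorm z + cnorm w.
Proof. exact: le_normcD. Qed.

Lemma cnorm_real (x : R) : cnorm x%:C = `|x|.
Proof. by rewrite cnormE /= expr0n addr0 sqrtr_sqr. Qed.

Lemma Re_le_cnorm z : `|complex.Re z| <= cnorm z.
Proof. by rewrite cnormE -sqrtr_sqr ler_wsqrtr// lerDl sqr_ge0. Qed.

Lemma Im_le_cnorm z : `|complex.Im z| <= cnorm z.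
Proof. by rewrite cnormE -sqrtr_sqr ler_wsqrtr// lerDr sqr_ge0. Qed.

Lemma cnorm_le_ReIm z : cnorm z <= `|complex.Re z| + `|complex.Im z|.
Proof.
rewrite cnormE -(@ler_pXn2r _ 2)// ?nnegrE ?sqrtr_ge0 ?addr_ge0//.
rewrite sqr_sqrtr ?addr_ge0 ?sqr_ge0// sqrrD !real_normK ?num_real//.
by rewrite -addrA [X in _ <= _ + X]addrC addrA lerDl mulrn_wge0 ?mulr_ge0.
Qed.

Lemma cReM z w : complex.Re (z * w) =
  complex.Re z * complex.Re w - complex.Im z * complex.Im w.
Proof. by case: z w => [a b] [c e]. Qed.

Lemma cImM z w : complex.Im (z * w) =
  complex.Re z * complex.Im w + complex.Im z * complex.Re w.
Proof. by case: z w => [a b] [c e]. Qed.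

Lemma cReD z w : complex.Re (z + w) = complex.Re z + complex.Re w.
Proof. by case: z w => [a b] [c e]. Qed.

Lemma cImD z w : complex.Im (z + w) = complex.Im z + complex.Im w.
Proof. by case: z w => [a b] [c e]. Qed.

Lemma complex_eq z w :
  complex.Re z = complex.Re w -> complex.Im z = complex.Im w -> z = w.
Proof. by case: z w => [a b] [c e] /= -> ->. Qed.

Lemma cexpiD (a b : R) : cexpi (a + b) = cexpi a * cexpi b.
Proof.
apply: complex_eq; rewrite ?cReM ?cImM /= ?cosD ?sinD//.
by rewrite addrC.
Qed.

Lemma cexpi0 : cexpi (0 : R) = 1.
Proof. by apply: complex_eq; rewrite /= ?cos0 ?sin0. Qed.

Lemma cnorm_cexpi (a : R) : cnorm (cexpi a) = 1.
Proof. by rewrite cnormE /= cos2Dsin2 sqrtr1. Qed.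

Lemma cnorm_prod (I : Type) (r : seq I) (P : pred I) (F : I -> R[i]) :
  cnorm (\prod_(i <- r | P i) F i) = \prod_(i <- r | P i) cnorm (F i).
Proof.
apply: (big_morph _ cnormM).
exact: ComplexField.Normc.normc1.
Qed.

Lemma cexpi_sum (I : Type) (r : seq I) (P : pred I) (F : I -> R) :
  cexpi (\sum_(i <- r | P i) F i) = \prod_(i <- r | P i) cexpi (F i).
Proof. exact: (big_morph _ cexpiD cexpi0). Qed.

End cnorm.

Section cint.
Context d {T : measurableType d} {R : realType}.
Variable mu : {measure set T -> \bar R}.
Implicit Types f g : T -> R[i].

Definition cmeasurable f :=
  measurable_fun setT (fun x => complex.Re (f x)) /\
  measurable_fun setT (fun x => complex.Im (f x)).

Lemma cmeasurable_cnorm f : cmeasurable f ->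
  measurable_fun setT (fun x => cnorm (f x)).
Proof.
move=> [mr mi]; rewrite (_ : (fun _ => _) = (fun x => (complex.Re (f x) ^+ 2 +
  complex.Im (f x) ^+ 2) `^ 2^-1)); last first.
  by apply/funext => x; rewrite cnormE powR12_sqrt// addr_ge0 ?sqr_ge0.
apply: (measurableT_comp (measurable_powR _)).
by apply: measurable_funD; apply: measurable_funX.
Qed.

Lemma cmeasurableM f g : cmeasurable f -> cmeasurable g ->
  cmeasurable (fun x => f x * g x).
Proof.
move=> [fr fi] [gr gi]; split.
  under eq_fun do rewrite cReM.
  by apply: measurable_funB; apply: measurable_funM.
under eq_fun do rewrite cImM.
by apply: measurable_funD; apply: measurable_funM.
Qed.

Lemma cmeasurableD f g : cmeasurable f -> cmeasurable g ->
  cmeasurable (fun x => f x + g x).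
Proof.
move=> [fr fi] [gr gi]; split.
  by under eq_fun do rewrite cReD; apply: measurable_funD.
by under eq_fun do rewrite cImD; apply: measurable_funD.
Qed.

Lemma cmeasurable_cst (z : R[i]) : cmeasurable (fun=> z).
Proof. by split. Qed.

Lemma cmeasurable_real (f : T -> R) : measurable_fun setT f ->
  cmeasurable (fun x => (f x)%:C).
Proof. by move=> mf; split. Qed.

Lemma cmeasurable_cexpi (f : T -> R) : measurable_fun setT f ->
  cmeasurable (fun x => cexpi (f x)).
Proof.
move=> mf; split.
- apply: (measurableT_comp (f := @cos R)) => //.
  apply: continuous_measurable_fun; exact: continuous_cos.
- apply: (measurableT_comp (f := @sin R)) => //.
  apply: continuous_measurable_fun; exact: continuous_sin.
Qed.

Lemma cmeasurable_prod (I : Type) (r : seq I) (P : pred I)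
    (F : I -> T -> R[i]) : (forall i, cmeasurable (F i)) ->
  cmeasurable (fun x => \prod_(i <- r | P i) F i x).
Proof.
move=> mF; elim: r => [|i r IH].
  rewrite (_ : (fun _ => _) = fun=> 1); first exact: cmeasurable_cst.
  by apply/funext => x; rewrite big_nil.
rewrite (_ : (fun _ => _) = (fun x => if P i then F i x *
  \prod_(j <- r | P j) F j x else \prod_(j <- r | P j) F j x)).
  by case: (P i) => //; apply: cmeasurableM.
by apply/funext => x; rewrite big_cons.
Qed.

Definition cintegrable f :=
  cmeasurable f /\ (\int[mu]_x (cnorm (f x))%:E < +oo)%E.

Lemma cintegrable_norm f : cintegrable f ->
  mu.-integrable setT (fun x => (cnorm (f x))%:E).
Proof.
move=> [mf foo]; apply/integrableP; split.
  exact/measurable_EFinP/cmeasurable_cnorm.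
by under eq_integral do rewrite gee0_abs ?lee_fin ?cnorm_ge0//.
Qed.

Lemma cintegrable_le (g : T -> R) f : cmeasurable f ->
  mu.-integrable setT (EFin \o g) ->
  (forall x, cnorm (f x) <= g x) -> cintegrable f.
Proof.
move=> mf ig fg; split => //.
have : mu.-integrable setT (fun x => (cnorm (f x))%:E).
  apply: le_integrable ig => //; first exact/measurable_EFinP/cmeasurable_cnorm.
  move=> x _ /=; rewrite lee_fin ger0_norm ?cnorm_ge0//.
  exact/(le_trans (fg x))/ler_norm.
move=> /integrableP[_]; under eq_integral do
  rewrite gee0_abs ?lee_fin ?cnorm_ge0//.
by [].
Qed.

Lemma cintegrable_Re f : cintegrable f ->
  mu.-integrable setT (EFin \o (fun x => complex.Re (f x))).
Proof.
move=> fi; apply: le_integrable (cintegrable_norm fi) => //.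
  by apply/measurable_EFinP; case: fi => -[].
by move=> x _ /=; rewrite lee_fin (ger0_norm (cnorm_ge0 _)) Re_le_cnorm.
Qed.

Lemma cintegrable_Im f : cintegrable f ->
  mu.-integrable setT (EFin \o (fun x => complex.Im (f x))).
Proof.
move=> fi; apply: le_integrable (cintegrable_norm fi) => //.
  by apply/measurable_EFinP; case: fi => -[].
by move=> x _ /=; rewrite lee_fin (ger0_norm (cnorm_ge0 _)) Im_le_cnorm.
Qed.

Lemma cintegrable_bounded (M : R) f g : cintegrable f -> cmeasurable g ->
  (forall x, cnorm (g x) <= M) -> cintegrable (fun x => f x * g x).
Proof.
move=> fi mg gM.
apply: (@cintegrable_le (fun x => cnorm (f x) * M)).
- by apply: cmeasurableM => //; case: fi.
- have := integrableZr measurableT M (cintegrable_norm fi).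
  by apply: eq_integrable.
- by move=> x; rewrite cnormM ler_wpM2l ?cnorm_ge0.
Qed.

Lemma cintegrableZ (z : R[i]) f : cintegrable f ->
  cintegrable (fun x => z * f x).
Proof.
move=> fi; have := @cintegrable_bounded (cnorm z) f (fun=> z) fi
  (cmeasurable_cst z) (fun=> lexx _).
by under eq_fun do rewrite mulrC.
Qed.

Lemma cintegrableD f g : cintegrable f -> cintegrable g ->
  cintegrable (fun x => f x + g x).
Proof.
move=> fi gi; apply: (@cintegrable_le (fun x => cnorm (f x) + cnorm (g x))).
- by apply: cmeasurableD; [case: fi|case: gi].
- have := integrableD measurableT (cintegrable_norm fi) (cintegrable_norm gi).
  by apply: eq_integrable.
- by move=> x; apply: cnormD.
Qed.

Definition cint f : R[i] :=
  (\int[mu]_x complex.Re (f x)) +i* (\int[mu]_x complex.Im (f x)).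

Lemma eq_cint f g : f =1 g -> cint f = cint g.
Proof. by move=> /funext ->. Qed.

Lemma cintD f g : cintegrable f -> cintegrable g ->
  cint (fun x => f x + g x) = cint f + cint g.
Proof.
move=> fi gi; apply: complex_eq; rewrite ?cReD ?cImD /cint/=.
- rewrite -RintegralD//; last 2 first.
  + exact: cintegrable_Re.
  + exact: cintegrable_Re.
  by apply: eq_Rintegral => x _; rewrite cReD.
- rewrite -RintegralD//; last 2 first.
  + exact: cintegrable_Im.
  + exact: cintegrable_Im.
  by apply: eq_Rintegral => x _; rewrite cImD.
Qed.

Lemma cintZ (z : R[i]) f : cintegrable f ->
  cint (fun x => z * f x) = z * cint f.
Proof.
move=> fi; have ir := cintegrable_Re fi; have ii := cintegrable_Im fi.
have irZ (a : R) : mu.-integrable setT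
    (EFin \o (fun x => a * complex.Re (f x))).
  by apply: eq_integrable (integrableZl measurableT a ir).
have iiZ (a : R) : mu.-integrable setT
    (EFin \o (fun x => a * complex.Im (f x))).
  by apply: eq_integrable (integrableZl measurableT a ii).
apply: complex_eq; rewrite ?cReM ?cImM /cint/=.
- by rewrite -!RintegralZl// -RintegralB//;
    apply: eq_Rintegral => x _; rewrite cReM.
- by rewrite -!RintegralZl// -RintegralD//;
    apply: eq_Rintegral => x _; rewrite cImM.
Qed.

Lemma cint0 : cint (fun=> 0) = 0.
Proof. by rewrite /cint/= !Rintegral_cst// !mul0r. Qed.

(** The constant 2 comes from bounding the real and imaginary parts
    separately. *)
Lemma le_cnorm_cint f : cintegrable f ->
  cnorm (cint f) <= 2 * \int[mu]_x cnorm (f x).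
Proof.
move=> fi; apply: (le_trans (cnorm_le_ReIm _)).
rewrite mulrDl mul1r /cint/= lerD//.
- apply: (le_trans (le_normr_Rintegral _ _)) => //; first exact: cintegrable_Re.
  apply: le_Rintegral => //; [|exact: cintegrable_norm|].
    by have := integrable_norm (cintegrable_Re fi).
  by move=> x _; apply: Re_le_cnorm.
- apply: (le_trans (le_normr_Rintegral _ _)) => //; first exact: cintegrable_Im.
  apply: le_Rintegral => //; [|exact: cintegrable_norm|].
    by have := integrable_norm (cintegrable_Im fi).
  by move=> x _; apply: Im_le_cnorm.
Qed.

Lemma le_cnorm_cintE f : cintegrable f ->
  ((cnorm (cint f))%:E <= 2%:E * \int[mu]_x (cnorm (f x))%:E)%E.
Proof.
move=> fi; apply: (@le_trans _ _ (2 * \int[mu]_x cnorm (f x))%:E).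
  by rewrite lee_fin; exact: le_cnorm_cint.
rewrite EFinM /Rintegral fineK//.
exact: integrable_fin_num (cintegrable_norm fi).
Qed.

Lemma cint_real (f : T -> R) : cint (fun x => (f x)%:C) = (\int[mu]_x f x)%:C.
Proof.
by apply: complex_eq => //=; rewrite Rintegral_cst// mul0r.
Qed.

End cint.

Section cfubini.
Context d1 d2 (T1 : measurableType d1) (T2 : measurableType d2) (R : realType).
Variable m1 : {sigma_finite_measure set T1 -> \bar R}.
Variable m2 : {sigma_finite_measure set T2 -> \bar R}.
Implicit Types F : T1 * T2 -> R[i].

Lemma cintegrable_prod (f : T1 -> R) (g : T2 -> R) F : cmeasurable F ->
  m1.-integrable setT (EFin \o f) -> m2.-integrable setT (EFin \o g) ->
  (forall x y, cnorm (F (x, y)) <= f x * g y) ->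
  cintegrable (m1 \x m2)%E F.
Proof.
move=> mF fi gi Ffg; split => //.
have mfn : measurable_fun setT (fun x => `|f x|%:E).
  apply/measurable_EFinP/measurableT_comp => //.
  exact/measurable_EFinP/(measurable_int _ fi).
have mgn : measurable_fun setT (fun x => `|g x|%:E).
  apply/measurable_EFinP/measurableT_comp => //.
  exact/measurable_EFinP/(measurable_int _ gi).
have mN : measurable_fun setT (fun z => (cnorm (F z))%:E).
  exact/measurable_EFinP/cmeasurable_cnorm.
rewrite fubini_tonelli1//=; last by move=> z; rewrite lee_fin cnorm_ge0.
rewrite /fubini_F /=.
have gE : (\int[m2]_y `|g y|%:E < +oo)%E by case/integrableP: gi.
have fE : (\int[m1]_y `|f y|%:E < +oo)%E by case/integrableP: fi.
have ge : (0 <= \int[m2]_y `|g y|%:E)%E.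
  by apply: integral_ge0 => y _; rewrite lee_fin.
apply: (@le_lt_trans _ _
    (\int[m1]_x (`|f x|%:E * \int[m2]_y `|g y|%:E))%E).
  apply: ge0_le_integral => //.
  - by move=> x _; apply: integral_ge0 => y _; rewrite lee_fin cnorm_ge0.
  - apply: (measurable_fun_fubini_tonelli_F (fun z => (cnorm (F z))%:E)) => //.
    by move=> z; rewrite lee_fin cnorm_ge0.
  - exact: emeasurable_funM.
  - move=> x _; rewrite -ge0_integralZl ?lee_fin//.
    apply: ge0_le_integral => //.
    + by move=> y _; rewrite lee_fin cnorm_ge0.
    + by apply: measurableT_comp mN (pair1_measurable x).
    + by apply: emeasurable_funM.
    + move=> y _; rewrite -EFinM lee_fin (le_trans (Ffg x y))//.
      by rewrite -normrM ler_norm.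
rewrite ge0_integralZr// lte_mul_pinfty//.
  by apply: integral_ge0 => y _; rewrite lee_fin.
by rewrite ge0_fin_numE//; apply: integral_ge0 => y _; rewrite lee_fin.
Qed.

Lemma cint_fubini F : cintegrable (m1 \x m2)%E F ->
  cint m1 (fun x => cint m2 (fun y => F (x, y))) =
  cint m2 (fun y => cint m1 (fun x => F (x, y))).
Proof.
move=> Fi.
have E (f : T1 * T2 -> R) : (m1 \x m2)%E.-integrable setT (EFin \o f) ->
    \int[m1]_x \int[m2]_y f (x, y) = \int[m2]_y \int[m1]_x f (x, y).
  move=> fi; rewrite /Rintegral; congr fine.
  transitivity (\int[m1]_x \int[m2]_y (f (x, y))%:E)%E.
    apply: ae_eq_integral => //.
    - apply/measurable_EFinP; apply: measurableT_comp => //.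
      exact: measurable_fubini_F fi.
    - exact: measurable_fubini_F fi.
    - have := ae_integrable1 fi; apply: filterS => x fx _.
      by rewrite fineK// (integrable_fin_num measurableT fx).
  rewrite (Fubini fi).
  apply: ae_eq_integral => //.
    - exact: measurable_fubini_G fi.
    - apply/measurable_EFinP; apply: measurableT_comp => //.
      exact: measurable_fubini_G fi.
    - have := ae_integrable2 fi; apply: filterS => x fx _.
      by rewrite fineK// (integrable_fin_num measurableT fx).
apply: complex_eq => /=.
  exact: E (cintegrable_Re Fi).
exact: E (cintegrable_Im Fi).
Qed.

Lemma cmeasurable_cint F : cintegrable (m1 \x m2)%E F ->
  cmeasurable (fun x => cint m2 (fun y => F (x, y))).
Proof.
move=> Fi; split; rewrite /cint/= /Rintegral.
  apply: measurableT_comp => //.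
  exact: measurable_fubini_F (cintegrable_Re Fi).
apply: measurableT_comp => //.
exact: measurable_fubini_F (cintegrable_Im Fi).
Qed.

End cfubini.

(** * Lebesgue measure on row vectors *)

Section leb.
Context {R : realType}.

(** The measure [lebesgue_rV] under a name to which the sigma-finite structure
    needed by Fubini can be attached. *)
Definition leb (n : nat) : set 'rV[R]_n -> \bar R := lebesgue_rV R n.
Arguments leb : clear implicits.

HB.instance Definition _ n := Measure.copy (leb n) (lebesgue_rV R n).

Lemma measurable_box n (A : 'I_n -> set R) : (forall i, measurable (A i)) ->
  measurable [set x : 'rV[R]_n | forall i, A i (x 0 i)].
Proof.
move=> mA.
rewrite (_ : [set _ | _] = \big[setI/setT]_(i < n)
    ((fun x : 'rV[R]_n => x 0 i) @^-1` A i)).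
  apply: bigsetI_measurable => i _.
  by rewrite -[X in measurable X]setTI; exact: measurable_coord.
rewrite -bigcap_seq/=; apply/seteqP; split=> [x h i _|x h i]; first exact: h.
by apply: (h i) => /=; rewrite mem_index_enum.
Qed.

Lemma leb_cube n (c : 'rV[R]_n) (r : R) : 0 <= r ->
  leb n [set x : 'rV[R]_n | forall i, `|x 0 i - c 0 i| <= r] =
  ((2 * r) ^+ n)%:E.
Proof.
move=> r0.
have -> : [set x : 'rV[R]_n | forall i, `|x 0 i - c 0 i| <= r] =
    [set x | forall i, `[c 0 i - r, c 0 i + r]%classic (x 0 i)].
  by apply/seteqP; split => x h i; have := h i;
    rewrite /= in_itv/= ler_distl.
rewrite [LHS](lebesgue_rV_box (A := fun i => `[c 0 i - r, c 0 i + r]%classic))//.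
rewrite (eq_bigr (fun=> (2 * r)%:E)); last first.
  move=> i _; rewrite /= lebesgue_measure_itv/= lte_fin.
  case: ltP => h; first by rewrite -EFinD; congr EFin; ring.
  congr EFin; lra.
by rewrite prodEFin prodr_const card_ord.
Qed.

Let leb_sigma_finite n : sigma_finite setT (leb n).
Proof.
exists (fun m => [set x : 'rV[R]_n | forall i, `|x 0 i - (0 : 'rV[R]_n) 0 i| <= m%:R]).
  apply/seteqP; split => // x _.
  exists (Num.bound (\sum_i `|x 0 i|)) => //= i; rewrite mxE subr0.
  rewrite (le_trans _ (ltW (archi_boundP _))) ?sumr_ge0//.
  by rewrite (bigD1 i)//= lerDl sumr_ge0.
move=> m; split; last by rewrite leb_cube// ltry.
rewrite (_ : [set _ | _] =
    [set x : 'rV[R]_n | forall i, `[- m%:R, m%:R]%classic (x 0 i)]).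
  by apply: (measurable_box (A := fun=> `[- m%:R, m%:R]%classic)).
by apply/seteqP; split => x h i; have := h i;
  rewrite /= in_itv/= mxE subr0 ler_norml.
Qed.

HB.instance Definition _ n := @Measure_isSigmaFinite.Build _ _ _ (leb n)
  (leb_sigma_finite n).

Lemma cintegralE n (f : 'rV[R]_n -> R[i]) : cintegral f = cint (leb n) f.
Proof. by []. Qed.

Lemma LpnormE n p (f : 'rV[R]_n -> R[i]) :
  Lpnorm p f = Lnorm (leb n) p (fun x => (cnorm (f x))%:E).
Proof. by rewrite /Lpnorm unlock. Qed.

Lemma ge0_integral_snoc n (f : 'rV[R]_n.+1 -> \bar R) :
  measurable_fun setT f -> (forall x, 0 <= f x)%E ->
  (\int[leb n.+1]_x f x =
   \int[leb n]_u \int[lebesgue_measure]_t f (snoc_rV (u, t)))%E.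
Proof.
move=> mf f0.
have mS := @measurable_snoc_rV R n.
transitivity (\int[pushforward (leb n \x lebesgue_measure)%E (@snoc_rV R n)]_x
  f x)%E; first by [].
rewrite ge0_integral_pushforward// preimage_setT.
apply: (fubini_tonelli1 (m1 := leb n) (m2 := lebesgue_measure)
  (f \o @snoc_rV R n)); first exact: measurableT_comp.
by move=> z; exact: f0.
Qed.


Lemma ge0_integral_tensor n (g : 'I_n -> R -> R) :
  (forall i, measurable_fun setT (g i)) -> (forall i x, 0 <= g i x) ->
  (\int[leb n]_x (\prod_(i < n) g i (x 0 i))%:E =
   \prod_(i < n) \int[lebesgue_measure]_t (g i t)%:E)%E.
Proof.
move=> mg g0; elim: n g mg g0 => [|n IH] g mg g0.
  rewrite big_ord0; under eq_integral do rewrite big_ord0.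
  rewrite integral_cst// mul1e; transitivity (\d_(0 : 'rV[R]_0) (@setT 'rV[R]_0) : \bar R).
    by [].
  by rewrite diracT.
have mprod m (h : 'I_m -> R -> R) : (forall i, measurable_fun setT (h i)) ->
    measurable_fun setT (fun x : 'rV[R]_m => (\prod_(i < m) h i (x 0 i))%:E).
  move=> mh; apply/measurable_EFinP; apply: measurable_prod => i _.
  by apply: measurableT_comp => //; exact: measurable_coord.
rewrite ge0_integral_snoc//; last 2 first.
- exact: mprod.
- by move=> x; rewrite lee_fin prodr_ge0.
rewrite (eq_integral (fun u : 'rV[R]_n => (\prod_(i < n) g (lift ord_max i) (u 0 i))%:E *
    \int[lebesgue_measure]_t (g ord_max t)%:E)%E); last first.
  move=> u _; rewrite -ge0_integralZl//; last 3 first.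
  - by apply/measurable_EFinP; exact: mg.
  - by move=> t _; rewrite lee_fin.
  - by rewrite lee_fin prodr_ge0.
  apply: eq_integral => t _; rewrite -EFinM (bigD1_ord ord_max)//= mulrC.
  rewrite mxE unlift_none; congr (_ * _)%:E.
  by apply: eq_bigr => i _; rewrite mxE liftK.
rewrite ge0_integralZr//; last 3 first.
- by apply: (mprod n (fun i => g (lift ord_max i))).
- by move=> x _; rewrite lee_fin prodr_ge0.
- by apply: integral_ge0 => t _; rewrite lee_fin.
rewrite [RHS](bigD1_ord ord_max)//= muleC; congr (_ * _)%E.
exact: (IH (fun i => g (lift ord_max i))).
Qed.

Lemma measurable_tensor n (g : 'I_n -> R -> R) :
  (forall i, measurable_fun setT (g i)) ->
  measurable_fun setT (fun x : 'rV[R]_n => \prod_(i < n) g i (x 0 i)).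
Proof.
move=> mg; apply: measurable_prod => i _.
by apply: measurableT_comp => //; exact: measurable_coord.
Qed.

Lemma cmeasurable_tensor n (g : 'I_n -> R -> R[i]) :
  (forall i, cmeasurable (g i)) ->
  cmeasurable (fun x : 'rV[R]_n => \prod_(i < n) g i (x 0 i)).
Proof.
move=> mg; apply: cmeasurable_prod => i; have [gr gi] := mg i; split.
  apply: (measurableT_comp (f := fun t => complex.Re (g i t))) => //.
  exact: measurable_coord.
apply: (measurableT_comp (f := fun t => complex.Im (g i t))) => //.
exact: measurable_coord.
Qed.

Lemma integrable_tensor n (g : 'I_n -> R -> R) :
  (forall i, lebesgue_measure.-integrable setT (EFin \o g i)) ->
  (leb n).-integrable setT (fun x : 'rV[R]_n => (\prod_(i < n) g i (x 0 i))%:E).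
Proof.
move=> gi; have mg i : measurable_fun setT (g i).
  by apply/measurable_EFinP; exact: (measurable_int _ (gi i)).
apply/integrableP; split.
  by apply/measurable_EFinP; exact: measurable_tensor.
under eq_integral do rewrite abse_EFin normr_prod.
rewrite (ge0_integral_tensor (g := fun i t => `|g i t|))//; last first.
  by move=> i; apply: measurableT_comp => //; exact: mg.
have F i : (\int[lebesgue_measure]_t `|g i t|%:E)%E \is a fin_num.
  rewrite ge0_fin_numE; first by have /integrableP[_] := gi i.
  by apply: integral_ge0 => t _; rewrite lee_fin.
under eq_bigr do rewrite -(fineK (F _)).
by rewrite prodEFin ltry.
Qed.

Lemma cint_snoc n (f : 'rV[R]_n.+1 -> R[i]) : cintegrable (leb n.+1) f ->
  cint (leb n.+1) f =
  cint (leb n) (fun u => cint lebesgue_measure (fun t => f (snoc_rV (u, t)))).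
Proof.
move=> fi.
have E (h : 'rV[R]_n.+1 -> R) : (leb n.+1).-integrable setT (EFin \o h) ->
    \int[leb n.+1]_x h x =
    \int[leb n]_u \int[lebesgue_measure]_t h (snoc_rV (u, t)).
  move=> hi; rewrite /Rintegral; congr fine.
  have mS := @measurable_snoc_rV R n.
  have hi' : (leb n \x lebesgue_measure)%E.-integrable setT
      ((EFin \o h) \o @snoc_rV R n).
    have mh := measurable_int _ hi; apply/integrableP; split.
      exact: measurableT_comp mh mS.
    have /integrableP[_] := hi; apply: le_lt_trans.
    have -> : (\int[leb n.+1]_x `|(EFin \o h) x| =
        \int[pushforward (leb n \x lebesgue_measure) (@snoc_rV R n)]_x
          `|(EFin \o h) x|)%E by [].
    rewrite ge0_integral_pushforward ?preimage_setT//.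
    exact: measurableT_comp.
  transitivity (\int[pushforward (leb n \x lebesgue_measure)%E (@snoc_rV R n)]_x
    (EFin \o h) x)%E; first by [].
  rewrite integral_pushforward ?preimage_setT//; last first.
    exact: measurable_int hi.
  rewrite -(integral12_prod_meas1 hi').
  apply: ae_eq_integral => //.
  - exact: measurable_fubini_F hi'.
  - apply/measurable_EFinP; apply: measurableT_comp => //.
    exact: measurable_fubini_F hi'.
  - have := ae_integrable1 hi'; apply: filterS => x fx _.
    by rewrite fineK// (integrable_fin_num measurableT fx).
apply: complex_eq => /=.
  exact: E (cintegrable_Re fi).
exact: E (cintegrable_Im fi).
Qed.

Lemma cintegrable_tensor n (g : 'I_n -> R -> R[i]) :
  (forall i, cintegrable lebesgue_measure (g i)) ->
  cintegrable (leb n) (fun x : 'rV[R]_n => \prod_(i < n) g i (x 0 i)).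
Proof.
move=> gi; apply: (@cintegrable_le _ _ _ _
  (fun x : 'rV[R]_n => \prod_(i < n) cnorm (g i (x 0 i)))).
- by apply: cmeasurable_tensor => i; case: (gi i).
- by apply: (integrable_tensor (g := fun i t => cnorm (g i t))) => i;
    exact: cintegrable_norm.
- by move=> x; rewrite cnorm_prod.
Qed.

Lemma cint_tensor n (g : 'I_n -> R -> R[i]) :
  (forall i, cintegrable lebesgue_measure (g i)) ->
  cint (leb n) (fun x : 'rV[R]_n => \prod_(i < n) g i (x 0 i)) =
  \prod_(i < n) cint lebesgue_measure (g i).
Proof.
elim: n g => [|n IH] g gi.
  rewrite big_ord0; transitivity (cint (leb 0) (fun=> 1)).
    by apply: eq_cint => x; rewrite big_ord0.
  have E : leb 0 setT = 1%E.
    by transitivity (\d_(0 : 'rV[R]_0) (@setT 'rV[R]_0) : \bar R); rewrite // diracT.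
  apply: complex_eq; rewrite /= Rintegral_cst ?mul0r ?mul1r//.
  by rewrite -[RHS]/(fine 1%:E); congr fine; exact: E.
rewrite cint_snoc; last exact: cintegrable_tensor.
rewrite (bigD1_ord ord_max)//= -(IH (fun i => g (lift ord_max i)))//.
rewrite -cintZ; last exact: (cintegrable_tensor (g := fun i => g (lift ord_max i))).
apply: eq_cint => u; rewrite mulrC -cintZ//.
apply: eq_cint => t; rewrite (bigD1_ord ord_max)//= mulrC mxE unlift_none.
by congr (_ * _); apply: eq_bigr => i _; rewrite mxE liftK.
Qed.

(** Rounding the coordinates down to a grid replaces a continuous function by
    one that is constant on the cells of a countable measurable partition. *)
Lemma continuous_measurable_rV n (f : 'rV[R]_n -> R) :
  continuous f -> measurable_fun setT f.
Proof.
move=> cf.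
pose rnd m (x : 'rV[R]_n) : 'rV[int]_n := \row_i Num.floor (m.+1%:R * x 0 i).
pose pt m (z : 'rV[int]_n) : 'rV[R]_n := \row_i ((z 0 i)%:~R / m.+1%:R).
have mcell m z : measurable [set x | rnd m x = z].
  rewrite (_ : [set _ | _] = [set x : 'rV[R]_n | forall i,
      (fun i => [set t | Num.floor (m.+1%:R * t) = z 0 i]) i (x 0 i)]).
    apply: (measurable_box
      (A := fun i => [set t | Num.floor (m.+1%:R * t) = z 0 i])) => i.
    rewrite (_ : [set _ | _] =
       `[(z 0 i)%:~R / m.+1%:R, ((z 0 i) + 1)%:~R / m.+1%:R[%classic)//.
    apply/seteqP; split => t /=;
        rewrite in_itv/= ler_pdivrMr// ltr_pdivlMr// [t * _]mulrC.
      by move=> <-; rewrite floor_le floorD1_gt.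
    exact: floor_def.
  apply/seteqP; split => x /=; first by move=> <- i; rewrite /rnd mxE.
  by move=> h; apply/rowP => i; rewrite mxE h.
have mfm m : measurable_fun setT (fun x => f (pt m (rnd m x))).
  move=> _ B mB; rewrite setTI.
  rewrite (_ : _ @^-1` _ =
      \bigcup_(z in [set z | B (f (pt m z))]) [set x | rnd m x = z]).
    rewrite bigcup_mkcond; apply: countable_bigcupT_measurable => // z.
    by case: ifP.
  apply/seteqP; split => x /=; first by move=> h; exists (rnd m x).
  by move=> [z /= Bz ->].
apply: (measurable_fun_cvg mfm) => x _.
have H : (fun m => pt m (rnd m x)) @ \oo --> x.
  apply/cvg_ballP => e e0; near=> m.
  split=> // i j; rewrite !mxE ord1.
  have m0 : 0 < m.+1%:R :> R by [].
  have me : m.+1%:R^-1 < e.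
    by near: m; exact: (near_infty_natSinv_lt (PosNum e0)).
  have /andP[h1 h2] := floor_itv (m.+1%:R * x 0 j).
  rewrite /ball/= ger0_norm; last first.
    by rewrite subr_ge0 ler_pdivrMr// [x 0 j * _]mulrC.
  apply: le_lt_trans me; rewrite lerBlDr -[X in _ <= X + _]mul1r -mulrDl.
  by rewrite ler_pdivlMr// [x 0 j * _]mulrC (le_trans (ltW h2))// intrD addrC.
exact: cvg_comp H (cf x).
Unshelve. all: by end_near.
Qed.
End leb.
Arguments leb : clear implicits.

(** * A kernel on the line with trapezoidal Fourier transform *)

Section affine.
Context {R : realType}.
Local Notation lam := (@lebesgue_measure R).

Section aff.
Variables (r b : R).
Hypothesis r0 : 0 < r.

Let aff (x : R) : R := r * x + b.

Let measurable_aff : measurable_fun setT (aff : measurableTypeR R -> measurableTypeR R).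
Proof.
by apply: measurable_funD => //; apply: measurable_funM.
Qed.

Let affE (A : set R) : measurable A ->
  lam A = (r%:E * pushforward lam (aff : measurableTypeR R -> measurableTypeR R) A)%E.
Proof.
move=> mA; have := @lebesgue_measure_unique R
  (mscale (NngNum (ltW r0)) (pushforward lam (aff : measurableTypeR R -> measurableTypeR R))).
apply => //.
move=> _ [[u v]] _ <-.
pose J := `](u - b) / r, (v - b) / r]%classic.
transitivity (r%:E * lam J)%E; last first.
  congr (_ * lam _)%E; apply/seteqP; split => x; rewrite /J /= !in_itv/= /aff;
    rewrite ltr_pdivrMr// ler_pdivlMr//;
    by rewrite ltrBlDr lerBrDr [x * r]mulrC.
rewrite /J !lebesgue_measure_itv/= !lte_fin ltr_pM2r ?invr_gt0// ltrD2r.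
case: ifP => _; last by rewrite mule0.
rewrite -EFinD -EFinM; congr EFin; field; exact: lt0r_neq0.
Qed.

Lemma ge0_integral_affine (G : R -> \bar R) : measurable_fun setT G ->
  (forall x, 0 <= G x)%E ->
  (\int[lam]_x G (r * x + b)%R = r^-1%:E * \int[lam]_x G x)%E.
Proof.
move=> mG G0.
transitivity (\int[pushforward lam (aff : measurableTypeR R -> measurableTypeR R)]_x G x)%E.
  by rewrite ge0_integral_pushforward ?preimage_setT.
rewrite [in RHS](eq_measure_integral (mscale (NngNum (ltW r0)) (pushforward lam (aff : measurableTypeR R -> measurableTypeR R)))); last first.
  by move=> A mA _; exact: affE.
rewrite ge0_integral_mscale//= muleA -EFinM mulVf ?mul1e//.
exact: lt0r_neq0.
Qed.

Lemma integrable_affine (G : R -> R) : lam.-integrable setT (EFin \o G) ->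
  lam.-integrable setT (EFin \o (fun x => G (r * x + b))).
Proof.
move=> /integrableP[mG Goo]; apply/integrableP; split.
  exact: measurableT_comp mG measurable_aff.
rewrite (ge0_integral_affine (G := fun x => `|(G x)%:E|%E))//; last first.
  exact: measurableT_comp.
by rewrite lte_mul_pinfty// lee_fin invr_ge0 ltW.
Qed.

Lemma Rintegral_affine (G : R -> R) : lam.-integrable setT (EFin \o G) ->
  \int[lam]_x G (r * x + b) = r^-1 * \int[lam]_x G x.
Proof.
move=> iG; have mG := measurable_int _ iG; rewrite /Rintegral.
rewrite -[X in X * _]/(fine r^-1%:E) -fineM//; last first.
  exact: integrable_fin_num iG.
congr fine; rewrite integralE [in RHS]integralE.
transitivity (\int[lam]_x (EFin \o G)^\+ (r * x + b)%R -
  \int[lam]_x (EFin \o G)^\- (r * x + b)%R)%E.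
  congr (_ - _)%E; apply: eq_integral => x _.
    by rewrite !funeposE.
  by rewrite !funenegE.
rewrite !ge0_integral_affine//; last 2 first.
  exact: measurable_funeneg.
  exact: measurable_funepos.
rewrite [in RHS]muleBr//; exact: (integrable_add_def measurableT iG).
Qed.

End aff.

Lemma cintegrable_affine (r b : R) (G : R -> R[i]) : 0 < r ->
  cintegrable lam G -> cintegrable lam (fun x => G (r * x + b)).
Proof.
move=> r0 iG; have [[mr mi] _] := iG.
have maff : measurable_fun setT (fun x : R => r * x + b).
  by apply: measurable_funD => //; apply: measurable_funM.
apply: (@cintegrable_le _ _ _ lam (fun x : R => cnorm (G (r * x + b)))) => //.
  split; first exact: measurableT_comp mr maff.
  exact: measurableT_comp mi maff.
exact: (integrable_affine b r0 (cintegrable_norm iG)).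
Qed.

Lemma cint_affine (r b : R) (G : R -> R[i]) : 0 < r ->
  cintegrable lam G ->
  cint lam (fun x => G (r * x + b)) = (r^-1)%:C * cint lam G.
Proof.
move=> r0 iG; apply: complex_eq.
  rewrite cReM /= mul0r subr0.
  exact: (Rintegral_affine b r0 (cintegrable_Re iG)).
rewrite cImM /= mul0r addr0.
exact: (Rintegral_affine b r0 (cintegrable_Im iG)).
Qed.

Lemma Rintegral_odd (G : R -> R) : lam.-integrable setT (EFin \o G) ->
  (forall x, G (- x) = - G x) -> \int[lam]_x G x = 0.
Proof.
move=> iG oG; have mG := measurable_int _ iG.
have : \int[lam]_x G (- x) = \int[lam]_x G x.
  rewrite /Rintegral; congr fine.
  transitivity (\int[pushforward lam (-%R : measurableTypeR R -> measurableTypeR R)]_x (EFin \o G) x)%E.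
    rewrite integral_pushforward ?preimage_setT//.
    have -> : (EFin \o G) \o -%R = (fun x => - (EFin \o G) x)%E.
      by apply/funext => x /=; rewrite oG EFinN.
    exact: integrableN.
  by apply: eq_measure_integral => A mA _; exact: lebesgue_measureN.
under eq_Rintegral do rewrite oG -mulN1r.
rewrite RintegralZl// mulN1r => h.
by apply/eqP; rewrite -[_ == _](@mulrn_eq0 _ _ 2) mulr2n -[X in X + _]h addNr.
Qed.

Lemma integrable_oneDsqrV : lam.-integrable setT (EFin \o (fun x : R => (1 + x ^+ 2)^-1)).
Proof.
have c : continuous (fun x : R => (1 + x ^+ 2)^-1).
  exact: continuous_oneDsqrV.
have m : measurable_fun setT (EFin \o (fun x : R => (1 + x ^+ 2)^-1)).
  by apply/measurable_EFinP; exact: continuous_measurable_fun.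
apply/integrableP; split => //.
under eq_integral do rewrite gee0_abs ?lee_fin ?invr_ge0 ?addr_ge0 ?sqr_ge0//.
rewrite ge0_symfun_integralT//=.
- rewrite (_ : [set x | _] = `[0, +oo[%classic); last first.
    by apply/seteqP; split => x/=; rewrite in_itv/= andbT.
  by rewrite (integral0y_oneDsqr R) -EFinM ltry.
- by move=> x; rewrite invr_ge0 addr_ge0 ?sqr_ge0.
- by move=> x/=; rewrite sqrrN.
Qed.

End affine.

Section kernel.
Context {R : realType}.
Local Notation lam := (@lebesgue_measure R).

(** The Fejer-type weights; the transform of a product with a cosine reduces
    to their integrals. *)
Definition wgt (a x : R) : R := (1 - cos (a * x)) / x ^+ 2.

Lemma one_minus_cos_le (x : R) : 1 - cos x <= x ^+ 2.
Proof.
have key (y : R) : 0 <= y -> 1 - cos y <= y ^+ 2.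
  move=> y0.
  have [c1 c1i E1] : exists2 c, c \in `[0, y]%R & (- cos) y - (- cos) 0 = sin c * (y - 0).
    apply: (@MVT_segment R (- cos)%R sin 0 y) => //.
      move=> z _; rewrite -[sin z]opprK; apply: is_deriveN.
    apply: continuous_subspaceT => z; apply: continuousN; exact: continuous_cos.
  have /andP[c0 cy] : 0 <= c1 <= y by rewrite in_itv in c1i.
  have [c2 c2i E2] : exists2 c, c \in `[0, c1]%R & sin c1 - sin 0 = cos c * (c1 - 0).
    apply: (@MVT_segment R sin cos 0 c1) => //.
    apply: continuous_subspaceT => z; exact: continuous_sin.
  have -> : 1 - cos y = sin c1 * y.
    have E1' : - cos y - - cos 0 = sin c1 * (y - 0) by exact: E1.
    by rewrite subr0 in E1'; rewrite -E1' cos0 opprK addrC.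
  rewrite expr2 ler_wpM2r//.
  rewrite sin0 !subr0 in E2; rewrite E2.
  by rewrite (le_trans _ cy)// ler_piMl// cos_le1.
by rewrite -cos_norm -(real_normK (num_real x)); exact: key.
Qed.

Lemma wgt_ge0 (a x : R) : 0 <= wgt a x.
Proof. by rewrite divr_ge0 ?sqr_ge0// subr_ge0 cos_le1. Qed.

(** Near 0 the numerator is at most [x ^+ 2], far from 0 it is at most 2. *)
Lemma wgt1_le (x : R) : wgt 1 x <= 4 * (1 + x ^+ 2)^-1.
Proof.
rewrite /wgt mul1r; have p0 : 0 < 1 + x ^+ 2 by rewrite ltr_wpDr ?sqr_ge0.
have [->|x0] := eqVneq x 0.
  by rewrite cos0 subrr mul0r mulr_ge0// invr_ge0 ltW.
have x2 : 0 < x ^+ 2 by rewrite exprn_even_gt0.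
rewrite ler_pdivlMr// mulrAC ler_pdivrMr//.
have h1 := one_minus_cos_le x; have h2 := cos_geN1 x; have h3 := cos_le1 x.
nra.
Qed.

Lemma measurable_wgt a : measurable_fun setT (wgt a).
Proof.
apply: measurable_funM.
  apply: measurable_funB => //.
  apply: (measurableT_comp (f := @cos R)); last exact: measurable_funM.
  apply: continuous_measurable_fun; exact: continuous_cos.
under eq_fun do rewrite -powR_inv1 ?sqr_ge0//.
apply: (measurableT_comp (measurable_powR _)); exact: measurable_funX.
Qed.

Definition wmass : R := \int[lam]_x wgt 1 x.

Lemma integrable_wgt1 : lam.-integrable setT (EFin \o wgt 1).
Proof.
have i := integrableZl measurableT 4 (@integrable_oneDsqrV R).
apply: (le_integrable measurableT _ _ i).
  by apply/measurable_EFinP; exact: measurable_wgt.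
move=> x _ /=; rewrite lee_fin ger0_norm ?wgt_ge0//.
by rewrite (le_trans (wgt1_le x))// ler_norm.
Qed.

Lemma wgt_scale (a x : R) : 0 < a -> wgt a x = a ^+ 2 * wgt 1 (a * x + 0).
Proof.
move=> a0; rewrite /wgt mul1r addr0 exprMn.
have [->|x0] := eqVneq x 0; first by rewrite !mulr0 cos0 subrr !mul0r mulr0.
field; rewrite x0; exact: lt0r_neq0.
Qed.

Lemma wgtN a : wgt (- a) = wgt a.
Proof. by apply/funext => x; rewrite /wgt mulNr cosN. Qed.

Lemma wgt0 : wgt 0 = cst 0.
Proof. by apply/funext => x; rewrite /wgt mul0r cos0 subrr mul0r. Qed.

Lemma integrable_wgt a : lam.-integrable setT (EFin \o wgt a).
Proof.
wlog a0 : a / 0 < a.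
  move=> H; have [a0|a0|->] := ltgtP a 0; last first.
  - by rewrite wgt0; exact: integrable0.
  - exact: H.
  - by rewrite -[a]opprK wgtN; apply: H; rewrite oppr_gt0.
have := integrableZl measurableT (a ^+ 2) (integrable_affine 0 a0 integrable_wgt1).
by apply: eq_integrable => // x _; rewrite /= -EFinM -wgt_scale.
Qed.

(** By scaling, the integral is homogeneous in the frequency, so that its
    value at one frequency, whatever it is, determines the transform. *)
Lemma Rintegral_wgt a : \int[lam]_x wgt a x = `|a| * wmass.
Proof.
have H b : 0 < b -> \int[lam]_x wgt b x = `|b| * wmass.
  move=> b0; under eq_Rintegral do rewrite (wgt_scale _ b0).
  rewrite RintegralZl//; last exact: (integrable_affine 0 b0 integrable_wgt1).
  rewrite (Rintegral_affine 0 b0 integrable_wgt1) -/wmass gtr0_norm//.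
  by rewrite mulrA; congr (_ * _); field; exact: lt0r_neq0.
have [a0|a0|->] := ltgtP a 0; last first.
- by rewrite wgt0 normr0 mul0r Rintegral_cst// mul0r.
- exact: H.
- by rewrite -[a]opprK wgtN H ?oppr_gt0// !normrN.
Qed.

Lemma wmass_gt0 : 0 < wmass.
Proof.
have c1 : cos 1 < 1 :> R.
  rewrite -[X in _ < X]cos0 ltr_cos ?in_itv//=.
  - by rewrite lexx pi_ge0.
  - by rewrite ler01 (le_trans _ (pi_ge2 R))// ler1n.
(* on [1, 2] the cosine is at most cos 1, and x ^+ 2 at most 4 *)
pose e := (1 - cos 1) / 4 : R; have e0 : 0 < e by rewrite divr_gt0// subr_gt0.
have h : (e%:E <= \int[lam]_x (wgt 1 x)%:E)%E.
  apply: (@le_trans _ _ (\int[lam]_(x in `[1%R, 2%R]) (wgt 1 x)%:E)%E); last first.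
    apply: ge0_subset_integral => //.
      by apply/measurable_EFinP; exact: measurable_wgt.
    by move=> x _; rewrite lee_fin wgt_ge0.
  apply: (@le_trans _ _ (\int[lam]_(x in `[1%R, 2%R]) (cst e%:E x))%E).
    rewrite integral_cst//= lebesgue_measure_itv/= lte_fin ltr1n -EFinD.
    by rewrite -EFinM lee_fin; lra.
  apply: ge0_le_integral => //.
  - by move=> x _; rewrite lee_fin ltW.
  - apply: measurable_funTS; apply/measurable_EFinP; exact: measurable_wgt.
  - move=> x /=; rewrite in_itv/= => /andP[x1 x2].
    rewrite lee_fin /wgt mul1r.
    have x0 : 0 < x by lra.
    have cx : cos x <= cos 1.
      have [->//|xn1] := eqVneq x 1.
      rewrite ltW// ltr_cos ?in_itv//=.
      + by rewrite lt_neqAle eq_sym xn1.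
      + by rewrite ler01 (le_trans _ (pi_ge2 R))// ler1n.
      + by rewrite (ltW x0) (le_trans x2)// pi_ge2.
    rewrite ler_pdivlMr ?exprn_gt0// /e.
    have x4 : x ^+ 2 <= 4 by nra.
    have : (1 - cos 1) / 4 * x ^+ 2 <= (1 - cos 1) / 4 * 4.
      by rewrite ler_wpM2l// ltW.
    lra.
rewrite (lt_le_trans e0)// -lee_fin /wmass /Rintegral fineK//.
exact: integrable_fin_num integrable_wgt1.
Qed.

(** A de la Vallee-Poussin kernel: the difference of two Fejer kernels, whose
    triangular transforms combine into a trapezoid. *)
Definition kern (x : R) : R := wgt 2 x - wgt 1 x.

Definition trap (xi : R) : R :=
  (`|2 + xi| + `|2 - xi| - `|1 + xi| - `|1 - xi|) / 2.

Lemma kernN x : kern (- x) = kern x.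
Proof. by rewrite /kern /wgt !mulrN !cosN sqrrN. Qed.

Lemma integrable_kern : lam.-integrable setT (EFin \o kern).
Proof.
have := integrableB measurableT (integrable_wgt 2) (integrable_wgt 1).
exact: eq_integrable.
Qed.

Lemma measurable_kern : measurable_fun setT kern.
Proof. by apply: measurable_funB; exact: measurable_wgt. Qed.

Lemma kern_le x : `|kern x| <= 20 / (1 + x ^+ 2).
Proof.
(* 20 = 2 ^ 2 * 4 + 4, the bound 4 being that of [wgt1_le] *)
rewrite /kern (le_trans (ler_normB _ _))// !ger0_norm ?wgt_ge0//.
have h1 := wgt1_le x; have h2 := wgt1_le (2 * x + 0).
rewrite (wgt_scale x (ltr0n R 2)).
have p0 : 0 < 1 + x ^+ 2 by rewrite ltr_wpDr ?sqr_ge0.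
have h3 : (1 + (2 * x + 0) ^+ 2)^-1 <= (1 + x ^+ 2)^-1.
  rewrite lef_pV2 ?posrE ?ltr_wpDr ?sqr_ge0// lerD2l addr0.
  have := sqr_ge0 x; nra.
set a := (_)^-1 in h2 h3; set b := (_)^-1 in h1 h3 *.
lra.
Qed.

(** The imaginary part is odd; in the real part, products of cosines become
    sums, and only the integrals of [wgt] at the frequencies [2 +- xi] and
    [1 +- xi] remain. *)
Lemma cint_kern (xi : R) :
  cintegrable lam (fun x => (kern x)%:C * cexpi (- (xi * x))) /\
  cint lam (fun x => (kern x)%:C * cexpi (- (xi * x))) = (wmass * trap xi)%:C.
Proof.
have mxi : measurable_fun setT (fun x : R => - (xi * x)).
  by apply: measurableT_comp => //; exact: measurable_funM.
have ki : cintegrable lam (fun x => (kern x)%:C * cexpi (- (xi * x))).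
  apply: (@cintegrable_bounded _ _ _ lam 1 (fun x => (kern x)%:C)).
  - apply: (@cintegrable_le _ _ _ lam (fun x => `|kern x|)).
    + by apply: cmeasurable_real; exact: measurable_kern.
    + by have := integrable_norm integrable_kern.
    + by move=> x; rewrite cnorm_real.
  - exact: cmeasurable_cexpi.
  - by move=> x; rewrite cnorm_cexpi.
split => //; apply: complex_eq => /=; last first.
  apply: Rintegral_odd; first exact: cintegrable_Im ki.
  by move=> x; rewrite kernN !mul0r !addr0 mulrN opprK sinN mulrN opprK.
transitivity (\int[lam]_x (2^-1 * (wgt (2 + xi) x + wgt (2 - xi) x) -
    2^-1 * (wgt (1 + xi) x + wgt (1 - xi) x))).
  apply: eq_Rintegral => x _; rewrite mul0r subr0 cosN /kern /wgt.
  rewrite (mulrDl 2 xi) (mulrDl 2 (- xi)) (mulrDl 1 xi) (mulrDl 1 (- xi)).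
  rewrite mul1r !cosD !mulNr !cosN !sinN.
  lra.
have iD a b : lam.-integrable setT (EFin \o (fun x => 2^-1 * (wgt a x + wgt b x))).
  have := integrableZl measurableT (2^-1)
    (integrableD measurableT (integrable_wgt a) (integrable_wgt b)).
  exact: eq_integrable.
have sD a b : \int[lam]_x (2^-1 * (wgt a x + wgt b x)) =
    2^-1 * (`|a| * wmass + `|b| * wmass).
  rewrite RintegralZl//; last first.
    have := integrableD measurableT (integrable_wgt a) (integrable_wgt b).
    exact: eq_integrable.
  rewrite RintegralD//; [by rewrite !Rintegral_wgt|exact: integrable_wgt|
    exact: integrable_wgt].
by rewrite RintegralB// !sD /trap; field.
Qed.

Lemma trap_ge0 xi : 0 <= trap xi.
Proof.
rewrite /trap divr_ge0//.
have [] := leP 0 (2 + xi) => h1; have [] := leP 0 (2 - xi) => h2;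
have [] := leP 0 (1 + xi) => h3; have [] := leP 0 (1 - xi) => h4;
rewrite ?(ger0_norm h1) ?(ger0_norm h2) ?(ger0_norm h3) ?(ger0_norm h4)
  ?(ltr0_norm h1) ?(ltr0_norm h2) ?(ltr0_norm h3) ?(ltr0_norm h4); lra.
Qed.

Lemma trap_le1 xi : trap xi <= 1.
Proof.
rewrite /trap ler_pdivrMr// mul1r.
have [] := leP 0 (2 + xi) => h1; have [] := leP 0 (2 - xi) => h2;
have [] := leP 0 (1 + xi) => h3; have [] := leP 0 (1 - xi) => h4;
rewrite ?(ger0_norm h1) ?(ger0_norm h2) ?(ger0_norm h3) ?(ger0_norm h4)
  ?(ltr0_norm h1) ?(ltr0_norm h2) ?(ltr0_norm h3) ?(ltr0_norm h4); lra.
Qed.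

Lemma trap1 xi : `|xi| <= 1 -> trap xi = 1.
Proof.
rewrite ler_norml => /andP[h1 h2].
by rewrite /trap !ger0_norm; [field|lra..].
Qed.

Lemma trap0 xi : 2 <= `|xi| -> trap xi = 0.
Proof.
rewrite /trap; have [h|h] := leP 0 xi.
  rewrite ger0_norm// => h2.
  rewrite (ger0_norm (_ : 0 <= 2 + xi)); last lra.
  rewrite (ger0_norm (_ : 0 <= 1 + xi)); last lra.
  rewrite (ler0_norm (_ : 2 - xi <= 0)); last lra.
  by rewrite (ler0_norm (_ : 1 - xi <= 0)); [field|lra].
rewrite ltr0_norm// => h2.
rewrite (ler0_norm (_ : 2 + xi <= 0)); last lra.
rewrite (ler0_norm (_ : 1 + xi <= 0)); last lra.
rewrite (ger0_norm (_ : 0 <= 2 - xi)); last lra.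
by rewrite (ger0_norm (_ : 0 <= 1 - xi)); [field|lra].
Qed.

End kernel.

(** * The Fourier transform and the test functions *)

Section ft.
Context {R : realType} {d : nat}.
Local Notation V := 'rV[R]_d.
Local Notation mu := (leb R d).
Local Notation lam := (@lebesgue_measure R).
Implicit Types f g : V -> R[i].

(** The transform with kernel [cexpi (s * dot x xi)]; the signs -1 and 1 give
    the direct and the inverse transform, up to the normalising constant. *)
Definition ft (s : R) f (xi : V) : R[i] :=
  cint mu (fun x => f x * cexpi (s * dot x xi)).

Definition fconst : R := (2 * pi) `^ (- (d%:R / 2)).

Lemma fconst_gt0 : 0 < fconst.
Proof. by rewrite powR_gt0// mulr_gt0// pi_gt0. Qed.

Lemma fourierE f xi : fourier f xi = fconst%:C * ft (-1) f xi.
Proof.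
by rewrite /fourier cintegralE; congr (_ * _); apply: eq_cint => x;
  rewrite mulN1r.
Qed.

Lemma inv_fourierE f xi : inv_fourier f xi = fconst%:C * ft 1 f xi.
Proof.
by rewrite /inv_fourier cintegralE; congr (_ * _); apply: eq_cint => x;
  rewrite mul1r.
Qed.

Lemma dotC (x y : V) : dot x y = dot y x.
Proof. by apply: eq_bigr => i _; rewrite mulrC. Qed.

Lemma measurable_dot : measurable_fun setT (fun z : V * V => dot z.1 z.2).
Proof.
apply: measurable_sum => i; apply: measurable_funM.
  apply: (measurableT_comp (f := fun x : V => x 0 i)) => //.
  exact: measurable_coord.
apply: (measurableT_comp (f := fun x : V => x 0 i)) => //.
exact: measurable_coord.
Qed.

Lemma cmeasurable_phase (s : R) :
  cmeasurable (fun z : V * V => cexpi (s * dot z.1 z.2)).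
Proof.
by apply: cmeasurable_cexpi; apply: measurable_funM => //; exact: measurable_dot.
Qed.

Lemma measurable_dotl (xi : V) : measurable_fun setT (fun x : V => dot x xi).
Proof.
apply: measurable_sum => i; apply: measurable_funM => //.
exact: measurable_coord.
Qed.

Lemma cintegrable_phase (s : R) (xi : V) f : cintegrable mu f ->
  cintegrable mu (fun x => f x * cexpi (s * dot x xi)).
Proof.
move=> fi; apply: (@cintegrable_bounded _ _ _ mu 1) => //.
  by apply: cmeasurable_cexpi; apply: measurable_funM => //; exact: measurable_dotl.
by move=> x; rewrite cnorm_cexpi.
Qed.

Lemma ft_bound s f xi : cintegrable mu f ->
  cnorm (ft s f xi) <= 2 * \int[mu]_x cnorm (f x).
Proof.
move=> fi; apply: (le_trans (le_cnorm_cint (cintegrable_phase s xi fi))).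
by under eq_Rintegral do rewrite cnormM cnorm_cexpi mulr1.
Qed.

Lemma cmeasurable_fst f : cmeasurable f -> cmeasurable (fun z : V * V => f z.1).
Proof.
move=> [mr mi]; split.
  by apply: (measurableT_comp (f := fun x => complex.Re (f x))).
by apply: (measurableT_comp (f := fun x => complex.Im (f x))).
Qed.

Lemma cmeasurable_snd f : cmeasurable f -> cmeasurable (fun z : V * V => f z.2).
Proof.
move=> [mr mi]; split.
  by apply: (measurableT_comp (f := fun x => complex.Re (f x))).
by apply: (measurableT_comp (f := fun x => complex.Im (f x))).
Qed.

Lemma cintegrable_kernel s f g : cintegrable mu f -> cintegrable mu g ->
  cintegrable (mu \x mu)%E
    (fun z : V * V => f z.1 * g z.2 * cexpi (s * dot z.1 z.2)).
Proof.
move=> fi gi.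
apply: (@cintegrable_prod _ _ _ _ _ mu mu
  (fun x => cnorm (f x)) (fun x => cnorm (g x))).
- apply: cmeasurableM; last exact: cmeasurable_phase.
  by apply: cmeasurableM; [apply: cmeasurable_fst; case: fi|
    apply: cmeasurable_snd; case: gi].
- exact: cintegrable_norm.
- exact: cintegrable_norm.
- by move=> x y /=; rewrite !cnormM cnorm_cexpi mulr1.
Qed.

Lemma cmeasurable_ft s f : cintegrable mu f -> cmeasurable (ft s f).
Proof.
move=> fi.
(* Fubini asks for an integrable integrand: multiply by a positive weight *)
pose w (x : V) : R := \prod_(i < d) (1 + x 0 i ^+ 2)^-1.
have w0 x : 0 < w x.
  by apply: prodr_gt0 => i _; rewrite invr_gt0 ltr_wpDr ?sqr_ge0.
have wi : mu.-integrable setT (EFin \o w).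
  apply: (integrable_tensor (g := fun i t => (1 + t ^+ 2)^-1)) => i.
  exact: integrable_oneDsqrV.
have mw : measurable_fun setT w.
  by apply/measurable_EFinP; exact: measurable_int wi.
have wci : cintegrable mu (fun x => (w x)%:C).
  apply: (@cintegrable_le _ _ _ mu w) => //.
  by move=> x; rewrite cnorm_real gtr0_norm.
have /cmeasurable_cint := @cintegrable_kernel s _ _ wci fi.
have E : (fun x => cint mu (fun y => (w x)%:C * f y * cexpi (s * dot x y))) =
    (fun x => (w x)%:C * ft s f x).
  apply/funext => x; rewrite /ft -cintZ; last first.
    exact: cintegrable_phase.
  by apply: eq_cint => y; rewrite mulrA [dot x y]dotC.
rewrite /= E => H.
have -> : ft s f = (fun x => ((w x)^-1)%:C * ((w x)%:C * ft s f x)).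
  apply/funext => x; rewrite mulrA -rmorphM/= mulVf ?mul1r//.
  exact: lt0r_neq0.
apply: cmeasurableM => //; apply: cmeasurable_real.
rewrite (_ : (fun _ => _) = (fun x => w x `^ (-1))); last first.
  by apply/funext => x; rewrite powR_inv1// ltW.
exact: (measurableT_comp (measurable_powR _) mw).
Qed.

(** The multiplication formula: it carries Fourier multipliers from a
    distribution to the function that represents it. *)
Lemma cint_ft s f g : cintegrable mu f -> cintegrable mu g ->
  cint mu (fun x => f x * ft s g x) = cint mu (fun x => ft s f x * g x).
Proof.
move=> fi gi; have := cint_fubini (@cintegrable_kernel s _ _ fi gi).
rewrite /= => E; transitivity (cint mu (fun x => cint mu (fun y =>
    f x * g y * cexpi (s * dot x y)))).
  apply: eq_cint => x; rewrite /ft -cintZ; last exact: cintegrable_phase.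
  by apply: eq_cint => y; rewrite mulrA [dot x y]dotC.
rewrite E; apply: eq_cint => y; rewrite mulrC /ft -cintZ; last first.
  exact: cintegrable_phase.
by apply: eq_cint => x; rewrite mulrA [g y * _]mulrC.
Qed.

(** ** Test functions *)

(** A product of Cauchy kernels, which dominates the test functions: its height
    is [r ^+ d], and its integral does not depend on [r]. *)
Definition maj (r : R) (x : V) : R := \prod_(i < d) (r / (1 + (r * x 0 i) ^+ 2)).

Definition cmass : R := \int[lam]_t (1 + t ^+ 2)^-1.

(** The kernel at scale [r], modulated to the frequency [c], and translated:
    as a function of [y] it is the value at [y + x] of one function. *)
Definition tf (c : V) (r : R) (x y : V) : R[i] :=
  \prod_(i < d) ((r * kern (r * (y 0 i + x 0 i)))%:C *
    cexpi (c 0 i * (y 0 i + x 0 i))).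

Lemma maj_ge0 r x : 0 <= r -> 0 <= maj r x.
Proof.
by move=> r0; apply: prodr_ge0 => i _; rewrite divr_ge0// addr_ge0 ?sqr_ge0.
Qed.

Lemma maj_le r x : 0 <= r -> maj r x <= r ^+ d.
Proof.
move=> r0; rewrite -[X in r ^+ X]card_ord -prodr_const; apply: ler_prod => i _.
rewrite divr_ge0 ?addr_ge0 ?sqr_ge0//=.
rewrite ler_pdivrMr ?ltr_wpDr ?sqr_ge0// ler_peMr// lerDl sqr_ge0.
by [].
Qed.

Lemma majN r x y : maj r (x - y) = maj r (y - x).
Proof.
by apply: eq_bigr => i _; rewrite !mxE -[in RHS]opprB mulrN sqrrN.
Qed.

Lemma maj_intE r (x : V) : 0 < r ->
  mu.-integrable setT (EFin \o (fun y => maj r (y + x))) /\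
  (\int[mu]_y (maj r (y + x))%:E = (cmass ^+ d)%:E)%E.
Proof.
move=> r0.
pose g (i : 'I_d) (t : R) := r * (1 + (r * t + r * x 0 i) ^+ 2)^-1.
have gE y : maj r (y + x) = \prod_(i < d) g i (y 0 i).
  by apply: eq_bigr => i _; rewrite /g mxE mulrDr.
have gi i : lam.-integrable setT (EFin \o g i).
  have := integrableZl measurableT r
    (integrable_affine (r * x 0 i) r0 (@integrable_oneDsqrV R)).
  exact: eq_integrable.
have mg i : measurable_fun setT (g i).
  by apply/measurable_EFinP; exact: measurable_int (gi i).
split.
  have := integrable_tensor gi; apply: eq_integrable => // y _ /=.
  by rewrite gE.
under eq_integral do rewrite gE.
rewrite (ge0_integral_tensor mg); last first.
  by move=> i t; rewrite mulr_ge0 ?(ltW r0)// invr_ge0 addr_ge0 ?sqr_ge0.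
rewrite (eq_bigr (fun=> cmass%:E)); last first.
  move=> i _; rewrite -[LHS]fineK; last exact: integrable_fin_num (gi i).
  congr EFin; rewrite -[LHS]/(\int[lam]_t g i t) /g RintegralZl//; last first.
    exact: (integrable_affine (r * x 0 i) r0 (@integrable_oneDsqrV R)).
  rewrite (Rintegral_affine (r * x 0 i) r0 (@integrable_oneDsqrV R)).
  by rewrite mulrA divff ?mul1r//; exact: lt0r_neq0.
by rewrite prodEFin prodr_const card_ord.
Qed.

Lemma cmass_ge0 : 0 <= cmass.
Proof. by apply: Rintegral_ge0 => t _; rewrite invr_ge0 addr_ge0 ?sqr_ge0. Qed.

Lemma measurable_maj r : measurable_fun setT (maj r).
Proof.
apply: (measurable_tensor (g := fun _ t => r / (1 + (r * t) ^+ 2))) => i; apply: measurable_funM => //.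
rewrite (_ : (fun _ => _) = (fun t : R => (1 + (r * t) ^+ 2) `^ (-1))); last first.
  by apply/funext => t; rewrite powR_inv1// addr_ge0 ?sqr_ge0.
apply: (measurableT_comp (measurable_powR _)).
by apply: measurable_funD => //; apply: measurable_funX; apply: measurable_funM.
Qed.

Lemma cnorm_tf c r x y : 0 <= r -> cnorm (tf c r x y) <= 20 ^+ d * maj r (y + x).
Proof.
move=> r0.
have -> : 20 ^+ d * maj r (y + x) =
    \prod_(i < d) (20 * (r / (1 + (r * (y + x) 0 i) ^+ 2))).
  by rewrite big_split/= prodr_const card_ord.
rewrite /tf cnorm_prod; apply: ler_prod => i _; rewrite cnorm_ge0 andTb cnormM cnorm_cexpi mulr1 cnorm_real.
rewrite normrM (ger0_norm r0) mulrCA ler_wpM2l// mxE.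
exact: kern_le.
Qed.

Lemma cmeasurable_tf c r x : cmeasurable (tf c r x).
Proof.
apply: (cmeasurable_tensor (g := fun i t => (r * kern (r * (t + x 0 i)))%:C *
    cexpi (c 0 i * (t + x 0 i)))) => i.
apply: cmeasurableM.
  apply: cmeasurable_real; apply: measurable_funM => //.
  apply: (measurableT_comp measurable_kern).
  by apply: measurable_funM => //; apply: measurable_funD.
by apply: cmeasurable_cexpi; apply: measurable_funM => //; apply: measurable_funD.
Qed.

Lemma cintegrable_tf c r x : 0 < r -> cintegrable mu (tf c r x).
Proof.
move=> r0; apply: (@cintegrable_le _ _ _ mu (fun y => 20 ^+ d * maj r (y + x))).
- exact: cmeasurable_tf.
- have [i _] := maj_intE x r0; have := integrableZl measurableT (20 ^+ d) i.
  exact: eq_integrable.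
- by move=> y; apply: cnorm_tf; exact: ltW.
Qed.

Definition tfh (c : V) (r : R) (xi : V) : R :=
  \prod_(i < d) (wmass * trap ((xi 0 i - c 0 i) / r)).

Lemma ft_tf c r x xi : 0 < r ->
  ft (-1) (tf c r x) xi = cexpi (dot x xi) * (tfh c r xi)%:C.
Proof.
move=> r0; pose g (i : 'I_d) (t : R) : R[i] :=
  (r * kern (r * (t + x 0 i)))%:C * cexpi (c 0 i * (t + x 0 i)) *
  cexpi (- (xi 0 i * t)).
pose G (i : 'I_d) (t : R) : R[i] :=
  (kern t)%:C * cexpi (- ((xi 0 i - c 0 i) / r * t)).
have gE i t : g i t = cexpi (x 0 i * xi 0 i) * (r%:C * G i (r * t + r * x 0 i)).
  rewrite /g /G -mulrDr rmorphM/= -!mulrA -cexpiD.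
  rewrite [RHS]mulrCA; congr (_ * _); rewrite [RHS]mulrCA; congr (_ * _).
  rewrite -cexpiD; congr cexpi.
  field; exact: lt0r_neq0.
have gEf i : g i =
    (fun t => cexpi (x 0 i * xi 0 i) * (r%:C * G i (r * t + r * x 0 i))).
  by apply/funext => t.
have iG i : cintegrable lam (G i) by exact: (cint_kern _).1.
have iGa i : cintegrable lam (fun t => G i (r * t + r * x 0 i)).
  exact: cintegrable_affine.
have gi i : cintegrable lam (g i).
  rewrite gEf; exact: (cintegrableZ _ (cintegrableZ _ (iGa i))).
transitivity (cint mu (fun y : V => \prod_(i < d) g i (y 0 i))).
  apply: eq_cint => y; rewrite /tf /g [RHS]big_split/=; congr (_ * _).
  rewrite -cexpi_sum; congr cexpi.
  by rewrite mulN1r -sumrN; apply: eq_bigr => i _; rewrite mulrC.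
rewrite cint_tensor// /tfh /dot cexpi_sum rmorph_prod -big_split/=.
apply: eq_bigr => i _; rewrite gEf cintZ; last exact: cintegrableZ.
rewrite cintZ// cint_affine// (cint_kern _).2; congr (_ * _).
by rewrite mulrA -rmorphM/= divff ?mul1r//; exact: lt0r_neq0.
Qed.

Lemma dotNr (x y : V) : dot x (- y) = - dot x y.
Proof. by rewrite /dot -sumrN; apply: eq_bigr => i _; rewrite mxE mulrN. Qed.

Lemma dotNl (x y : V) : dot (- x) y = - dot x y.
Proof. by rewrite dotC dotNr dotC. Qed.

Lemma trapN (t : R) : trap (- t) = trap t.
Proof. by rewrite /trap !opprK; congr (_ / _); ring. Qed.

(** The inverse transform is the direct one at the opposite frequency, and the
    trapezoid is even. *)
Lemma ft1_tfN c r x xi : 0 < r ->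
  ft 1 (tf (- c) r (- x)) xi = cexpi (dot x xi) * (tfh c r xi)%:C.
Proof.
move=> r0; transitivity (ft (-1) (tf (- c) r (- x)) (- xi)).
  by apply: eq_cint => y; rewrite mulN1r dotNr opprK mul1r.
rewrite ft_tf// dotNl dotNr opprK; congr (_ * _%:C).
apply: eq_bigr => i _; rewrite !mxE -[in RHS]trapN; congr (_ * trap _).
by rewrite -mulNr opprB opprK addrC.
Qed.

Lemma tfh_ge0 c r xi : 0 <= tfh c r xi.
Proof.
by apply: prodr_ge0 => i _; rewrite mulr_ge0 ?trap_ge0// ltW// wmass_gt0.
Qed.

Lemma tfh_le c r xi : tfh c r xi <= wmass ^+ d.
Proof.
rewrite -[X in _ ^+ X]card_ord -prodr_const; apply: ler_prod => i _.
rewrite mulr_ge0 ?trap_ge0// ?(ltW wmass_gt0)//=.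
by rewrite ler_piMr ?(ltW wmass_gt0)// trap_le1.
Qed.

Lemma tfh1 (c : V) r (xi : V) : 0 < r -> (forall i, `|xi 0 i - c 0 i| <= r) ->
  tfh c r xi = wmass ^+ d.
Proof.
move=> r0 h; rewrite -[X in _ ^+ X]card_ord -prodr_const.
apply: eq_bigr => i _; rewrite trap1 ?mulr1//.
by rewrite normrM normfV (gtr0_norm r0) ler_pdivrMr// mul1r.
Qed.

Lemma tfh0 (c : V) r (xi : V) : 0 < r -> (exists i, 2 * r <= `|xi 0 i - c 0 i|) ->
  tfh c r xi = 0.
Proof.
move=> r0 [i h]; rewrite /tfh (bigD1 i)//= trap0 ?mulr0 ?mul0r//.
by rewrite normrM normfV (gtr0_norm r0) ler_pdivlMr.
Qed.

Lemma measurable_tfh c r : measurable_fun setT (tfh c r).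
Proof.
apply: (measurable_tensor (g := fun i t => wmass * trap ((t - c 0 i) / r))) => i.
apply: measurable_funM => //; apply: measurable_funM => //.
have m a b : measurable_fun setT (fun t : R => `|a + b * ((t - c 0 i) / r)|).
  apply: measurableT_comp => //; apply: measurable_funD => //.
  by do 2 apply: measurable_funM => //; apply: measurable_funB.
apply: measurable_funB.
  apply: measurable_funB.
    apply: measurable_funD.
      by under eq_fun do rewrite -[X in _ + X]mul1r; exact: m.
    by under eq_fun do rewrite -[X in _ + X]mulN1r; exact: m.
  by under eq_fun do rewrite -[X in _ + X]mul1r; exact: m.
by under eq_fun do rewrite -[X in _ + X]mulN1r; exact: m.
Qed.

End ft.

(** * Interpolated Young and Hoelder inequalities *)

Section young_hoelder.
Context dT {T : measurableType dT} {R : realType}.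
Variable mu : {sigma_finite_measure set T -> \bar R}.
Implicit Types (g h : T -> R[i]) (p : \bar R).

Lemma recip_fin (r : R) : r != 0 -> recip r%:E = r^-1.
Proof. by move=> r0; rewrite /recip inver (negbTE r0). Qed.

Lemma recip_itv p : (1 <= p)%E -> 0 <= recip p <= 1.
Proof.
case: p => [r| |//]; last by rewrite recip_pinfty lexx ler01.
rewrite lee_fin => r1; have r0 : 0 < r by apply: lt_le_trans r1.
by rewrite recip_fin ?lt0r_neq0// invr_ge0 (ltW r0)/= invf_le1.
Qed.

(** An operator whose kernel is bounded in L^oo and in L^1, uniformly in one
    variable, maps L^1 to L^oo and to L^1, hence to everything between. *)
Lemma young (N : T * T -> R) (A B : R) g h p : 0 < A -> 0 < B ->
  measurable_fun setT N -> (forall z, 0 <= N z <= B) ->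
  (forall y, \int[mu]_x (N (x, y))%:E <= A%:E)%E ->
  cintegrable mu g -> cmeasurable h ->
  (forall x, (cnorm (h x))%:E <= \int[mu]_y (cnorm (g y) * N (x, y))%:E)%E ->
  (1 <= p)%E ->
  (Lnorm mu p (fun x => (cnorm (h x))%:E) <=
   ((\int[mu]_y cnorm (g y)) * (B `^ (1 - recip p) * A `^ recip p))%:E)%E.
Proof.
move=> A0 B0 mN NB NA gi mh hg p1.
set G := \int[mu]_y cnorm (g y).
have mg : measurable_fun setT (fun y => (cnorm (g y))%:E).
  by apply/measurable_EFinP/cmeasurable_cnorm; case: gi.
have mch : measurable_fun setT (fun x => (cnorm (h x))%:E).
  exact/measurable_EFinP/cmeasurable_cnorm.
have GE : (\int[mu]_y (cnorm (g y))%:E = G%:E)%E.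
  by rewrite /G /Rintegral fineK//; exact: integrable_fin_num (cintegrable_norm gi).
have G0 : 0 <= G by apply: Rintegral_ge0 => y _; exact: cnorm_ge0.
have mNx x : measurable_fun setT (fun y => N (x, y)).
  exact: measurableT_comp mN (pair1_measurable x).
have mNy y : measurable_fun setT (fun x => N (x, y)).
  exact: measurableT_comp mN (pair2_measurable y).
have mgN : measurable_fun setT (fun z : T * T => (cnorm (g z.2) * N z)%:E).
  apply/measurable_EFinP; apply: measurable_funM => //.
  apply: (measurableT_comp (f := fun y => cnorm (g y))) => //.
  by apply: cmeasurable_cnorm; case: gi.
have hB x : cnorm (h x) <= G * B.
  rewrite -lee_fin (le_trans (hg x))// EFinM -GE -ge0_integralZr ?lee_fin ?(ltW B0)//.
    apply: ge0_le_integral => //.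
    + by move=> y _; rewrite lee_fin mulr_ge0 ?cnorm_ge0//; case/andP: (NB (x, y)).
    + exact: (measurableT_comp mgN (pair1_measurable x)).
    + by apply: emeasurable_funM.
    + move=> y _; rewrite -EFinM lee_fin ler_wpM2l ?cnorm_ge0//.
      by case/andP: (NB (x, y)).
  - by move=> y _; rewrite lee_fin cnorm_ge0.
have hA : (\int[mu]_x (cnorm (h x))%:E <= (G * A)%:E)%E.
  apply: (@le_trans _ _
      (\int[mu]_x \int[mu]_y (cnorm (g y) * N (x, y))%:E)%E).
    apply: ge0_le_integral => //.
    - by move=> x _; rewrite lee_fin cnorm_ge0.
    - apply: (measurable_fun_fubini_tonelli_F
        (fun z : T * T => (cnorm (g z.2) * N z)%:E)) => //.
      by move=> z; rewrite lee_fin mulr_ge0 ?cnorm_ge0//; case/andP: (NB z).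
  rewrite (fubini_tonelli (m1 := mu) (m2 := mu)
    (fun z : T * T => (cnorm (g z.2) * N z)%:E))//; last first.
    by move=> z; rewrite lee_fin mulr_ge0 ?cnorm_ge0//; case/andP: (NB z).
  rewrite EFinM -GE -ge0_integralZr ?lee_fin ?(ltW A0)//; last first.
    by move=> y _; rewrite lee_fin cnorm_ge0.
  apply: ge0_le_integral => //=.
  - move=> y _; apply: integral_ge0 => x _.
    by rewrite lee_fin mulr_ge0 ?cnorm_ge0//; case/andP: (NB (x, y)).
  - apply: (measurable_fun_fubini_tonelli_G
        (fun z : T * T => (cnorm (g z.2) * N z)%:E)) => //.
    by move=> z; rewrite lee_fin mulr_ge0 ?cnorm_ge0//; case/andP: (NB z).
  - by apply: emeasurable_funM.
  - move=> y _; under eq_integral do rewrite EFinM.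
    rewrite ge0_integralZl ?lee_fin ?cnorm_ge0//.
    + by rewrite lee_wpmul2l ?lee_fin ?cnorm_ge0.
    + exact/measurable_EFinP.
    + by move=> x _; rewrite lee_fin; case/andP: (NB (x, y)).
case: p p1 => [r| |//]; last first.
  move=> _; rewrite recip_pinfty subr0 powRr1 ?(ltW B0)// powRr0 mulr1 unlock.
  case: ifPn => _; last by rewrite lee_fin mulr_ge0// ltW.
  apply/ess_supP/nearW => x /=.
  by rewrite lee_fin ger0_norm ?cnorm_ge0.
rewrite lee_fin => r1; have r0 : 0 < r by apply: lt_le_trans r1.
rewrite recip_fin ?lt0r_neq0// unlock.
have H : (\int[mu]_x (`|(cnorm (h x))%:E| `^ r) <=
    ((G * B) `^ (r - 1) * (G * A))%:E)%E.
  rewrite EFinM; apply: (@le_trans _ _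
      (((G * B) `^ (r - 1))%:E * \int[mu]_x (cnorm (h x))%:E)%E); last first.
    by rewrite lee_wpmul2l ?lee_fin ?powR_ge0.
  rewrite -ge0_integralZl ?lee_fin ?powR_ge0//; last first.
    by move=> x _; rewrite lee_fin cnorm_ge0.
  apply: ge0_le_integral => //.
  - by move=> x _; exact: poweR_ge0.
  - apply: (@measurableT_comp _ _ _ _ _ _ (fun x => x `^ r)%E) => //.
      exact: (measurableT_comp (measurable_poweR _)).
    exact: measurableT_comp.
  - exact: emeasurable_funM.
  - move=> x _; rewrite abse_EFin ger0_norm ?cnorm_ge0// poweR_EFin -EFinM lee_fin.
    rewrite -mulr_powRB1 ?cnorm_ge0// mulrC ler_wpM2r ?cnorm_ge0//.
    by rewrite ge0_ler_powR ?subr_ge0// nnegrE ?cnorm_ge0// mulr_ge0// ltW.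
apply: (@le_trans _ _ (((G * B) `^ (r - 1) * (G * A))%:E `^ r^-1)%E).
  apply: gt0_ler_poweR => //; rewrite ?invr_ge0 ?(ltW r0)// in_itv/= leey andbT.
    by apply: integral_ge0 => x _; rewrite lee_fin powR_ge0.
  by rewrite lee_fin mulr_ge0 ?powR_ge0// mulr_ge0// ltW.
rewrite poweR_EFin lee_fin.
have [G00|Gn0] := eqVneq G 0.
  by rewrite G00 !mul0r mulr0 powR0// invr_neq0// lt0r_neq0.
have Gp : 0 < G by rewrite lt_neqAle eq_sym Gn0.
rewrite powRM ?powR_ge0 ?mulr_ge0 ?(ltW A0)// -powRrM mulrBl mul1r.
rewrite divff ?lt0r_neq0// !powRM ?(ltW A0) ?(ltW B0)//.
rewrite mulrACA -powRD; last by rewrite Gn0 implybT.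
by rewrite subrK powRr1// mulrA.
Qed.

(** The dual estimate: a bounded integrable weight is in every L^p. *)
Lemma hoelder_bounded (N : T -> R) (A B : R) h p : 0 < A -> 0 < B ->
  measurable_fun setT N -> (forall x, 0 <= N x <= B) ->
  (\int[mu]_x (N x)%:E <= A%:E)%E ->
  cmeasurable h -> (1 <= p)%E ->
  (\int[mu]_x (cnorm (h x) * N x)%:E <=
   Lnorm mu p (fun x => (cnorm (h x))%:E) *
   (B `^ recip p * A `^ (1 - recip p))%:E)%E.
Proof.
move=> A0 B0 mN NB NA mh p1.
have mch : measurable_fun setT (fun x => (cnorm (h x))%:E).
  exact/measurable_EFinP/cmeasurable_cnorm.
have N0 x : 0 <= N x by case/andP: (NB x).
case: p p1 => [r| |//]; last first.
  move=> _; rewrite recip_pinfty subr0 powRr0 powRr1 ?(ltW A0)// mul1r unlock.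
  case: ifPn => [mu0|]; last first.
    rewrite -leNgt => mu0.
    have m0 : mu setT = 0%E by apply/eqP; rewrite eq_le mu0 measure_ge0.
    rewrite mul0e null_set_integral//.
    by apply/measurable_EFinP; apply: measurable_funM => //; exact: cmeasurable_cnorm.
  set s := ess_sup _ _.
  have s0 : (0 <= s)%E.
    by apply: ess_sup_gee => //; apply: nearW => x /=.
  apply: (@le_trans _ _ (\int[mu]_x (s * (N x)%:E))%E).
    apply: ae_ge0_le_integral => //.
    - by move=> x _; rewrite lee_fin mulr_ge0 ?cnorm_ge0.
    - by apply/measurable_EFinP; apply: measurable_funM => //; exact: cmeasurable_cnorm.
    - by move=> x _; rewrite mule_ge0// lee_fin.
    - by apply: emeasurable_funM => //; exact/measurable_EFinP.
    - have := ess_sup_ge mu (abse \o (fun x => (cnorm (h x))%:E)).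
      apply: filterS => x /= hx _; rewrite EFinM lee_wpmul2r ?lee_fin//.
      by apply: le_trans hx; rewrite lee_fin ler_norm.
  rewrite ge0_integralZl//; last 2 first.
  - exact/measurable_EFinP.
  - by move=> x _; rewrite lee_fin.
  by rewrite lee_wpmul2l.
rewrite lee_fin le_eqVlt => /predU1P[<-|r1].
  rewrite recip_fin ?oner_eq0// invr1 subrr powRr0 mulr1 powRr1 ?(ltW B0)//.
  rewrite Lnorm1 -ge0_integralZr ?lee_fin ?(ltW B0)//; last exact: measurableT_comp.
  apply: ge0_le_integral => //.
  - by move=> x _; rewrite lee_fin mulr_ge0 ?cnorm_ge0.
  - by apply/measurable_EFinP; apply: measurable_funM => //; exact: cmeasurable_cnorm.
  - by apply: emeasurable_funM => //; exact: measurableT_comp.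
  - move=> x _; rewrite abse_EFin ger0_norm ?cnorm_ge0// -EFinM lee_fin.
    by rewrite ler_wpM2l ?cnorm_ge0//; case/andP: (NB x).
have r0 : 0 < r by apply: lt_trans r1.
pose q := r / (r - 1); have rm0 : 0 < r - 1 by rewrite subr_gt0.
have q0 : 0 < q by rewrite divr_gt0.
have q1 : q - 1 = (r - 1)^-1 by rewrite /q; field; exact: lt0r_neq0.
have rq : r^-1 + q^-1 = 1 by rewrite /q; field; rewrite !lt0r_neq0.
have := @hoelder _ _ _ mu (fun x => cnorm (h x)) N r q (cmeasurable_cnorm mh)
  mN r0 q0 rq.
rewrite Lnorm1 => H.
apply: (@le_trans _ _ (\int[mu]_x `|(EFin \o ((fun x => cnorm (h x)) \* N)%R) x|)%E).
  apply: ge0_le_integral => //.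
  - by move=> x _; rewrite lee_fin mulr_ge0 ?cnorm_ge0.
  - by apply/measurable_EFinP; apply: measurable_funM => //; exact: cmeasurable_cnorm.
  - apply: measurableT_comp => //; apply/measurable_EFinP.
    by apply: measurable_funM => //; exact: cmeasurable_cnorm.
  - by move=> x _ /=; rewrite lee_fin ler_norm.
apply: (le_trans H); rewrite lee_wpmul2l ?Lnorm_ge0//.
rewrite recip_fin ?lt0r_neq0// unlock.
have K : (\int[mu]_x (`|(EFin \o N) x| `^ q) <= (B `^ (q - 1) * A)%:E)%E.
  rewrite EFinM; apply: (@le_trans _ _
      ((B `^ (q - 1))%:E * \int[mu]_x (N x)%:E)%E); last first.
    by rewrite lee_wpmul2l ?lee_fin ?powR_ge0.
  rewrite -ge0_integralZl ?lee_fin ?powR_ge0//; last 2 first.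
  - exact/measurable_EFinP.
  - by move=> x _; rewrite lee_fin.
  apply: ge0_le_integral => //.
  - by move=> x _; exact: poweR_ge0.
  - apply: (@measurableT_comp _ _ _ _ _ _ (fun x => x `^ q)%E) => //.
      exact: (measurableT_comp (measurable_poweR _)).
    by apply: measurableT_comp => //; exact/measurable_EFinP.
  - by apply: emeasurable_funM => //; exact/measurable_EFinP.
  - move=> x _; rewrite /= ger0_norm// -EFinM lee_fin.
    rewrite -mulr_powRB1// mulrC ler_wpM2r//.
    rewrite ge0_ler_powR ?nnegrE ?(ltW B0)//.
      by rewrite q1 invr_ge0 ltW.
    by case/andP: (NB x).
apply: (@le_trans _ _ ((B `^ (q - 1) * A)%:E `^ q^-1)%E).
  apply: gt0_ler_poweR => //; rewrite ?invr_ge0 ?(ltW q0)// in_itv/= leey andbT.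
    by apply: integral_ge0 => x _; rewrite lee_fin powR_ge0.
  by rewrite lee_fin mulr_ge0 ?powR_ge0// ltW.
rewrite poweR_EFin lee_fin powRM ?powR_ge0 ?(ltW A0)// -powRrM.
rewrite (_ : (q - 1) / q = r^-1); last first.
  by rewrite q1 /q; field; rewrite !lt0r_neq0.
by rewrite (_ : q^-1 = 1 - r^-1)// -rq addrAC subrr add0r.
Qed.

End young_hoelder.

(** * Functions determined by their pairing with Schwartz functions *)

Section logistic.
Context {R : realType}.

Definition logistic (t : R) : R := (1 + expR (- t))^-1.

Lemma logistic_gt0 t : 0 < logistic t.
Proof. by rewrite invr_gt0 ltr_wpDr// expR_ge0. Qed.

Lemma logistic_le1 t : logistic t <= 1.
Proof. by rewrite invf_le1 ?lerDl ?expR_ge0// ltr_wpDr// expR_ge0. Qed.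

Lemma logisticN t : 1 - logistic t = logistic (- t).
Proof.
rewrite /logistic opprK expRN; have := expR_gt0 t => e0.
by field; rewrite !lt0r_neq0// ltr_wpDr// ltW.
Qed.

Lemma is_derive_logistic (t : R) :
  is_derive t (1 : R) logistic (logistic t * (1 - logistic t)).
Proof.
have n0 : 1 + expR (- t) != 0 :> R by rewrite lt0r_neq0// ltr_wpDr// expR_ge0.
have h1 : is_derive t (1 : R) (fun s : R => 1 + expR (- s)) (- expR (- t)).
  have h2 : is_derive t (1 : R) (expR \o -%R) (expR (- t) * (-1)).
    by apply: is_derive1_comp.
  have := is_deriveD (is_derive_cst (1 : R) t (1 : R)) h2.
  by rewrite add0r mulrN1.
have := @is_deriveV R (fun s : R => 1 + expR (- s)) t _ 1 n0 h1; rewrite /logistic => h.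
apply: (is_derive_eq h).
by rewrite /GRing.scale/=; field.
Qed.

(** The logistic density decays exponentially, in both directions. *)
Definition ldens (t : R) : R := logistic t * (1 - logistic t).

Lemma ldens_gt0 t : 0 < ldens t.
Proof. by rewrite /ldens logisticN mulr_gt0 ?logistic_gt0. Qed.

Lemma ldens_le t : ldens t <= expR (- `|t|).
Proof.
have key s : 0 <= s -> ldens s <= expR (- s).
  move=> s0; rewrite /ldens (le_trans (_ : _ <= 1 - logistic s))//.
    by rewrite ler_piMl ?logistic_le1// logisticN ltW// logistic_gt0.
  rewrite logisticN /logistic opprK -lef_pV2 ?posrE ?invr_gt0 ?expR_gt0//.
  by rewrite invrK expRN invrK lerDr.
have [t0|t0] := leP 0 t; first by rewrite ger0_norm ?key.
rewrite ltr0_norm//; have := key (- t); rewrite /ldens -!logisticN.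
rewrite subKr mulrC; apply.
by rewrite oppr_ge0 ltW.
Qed.

End logistic.

Section logistic_algebra.
Context {R : realType} {d : nat}.
Local Notation V := 'rV[R]_d.

Lemma is_derive_coord (g : R -> R) (i j : 'I_d) (x : V) dg :
  is_derive (x 0 i) (1 : R) g dg ->
  is_derive x ('e_j : V) (fun y : V => g (y 0 i)) (if i == j then dg else 0).
Proof.
move=> hg; case: eqVneq => [<-|ij].
  have E : (fun h : R => h^-1 *: (((fun y : V => g (y 0 i)) \o shift x) (h *: ('e_i : V)) - g (x 0 i))) =
      (fun h : R => h^-1 *: ((g \o shift (x 0 i)) (h *: (1 : R)) - g (x 0 i))).
    by apply/funext => h /=; rewrite !mxE !eqxx [h%:A]mulr1 mulr1.
  case: hg => cg vg; split; first by rewrite /derivable E; exact: cg.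
  by rewrite /derive E; exact: vg.
have E : (fun h : R => h^-1 *: (((fun y : V => g (y 0 i)) \o shift x) (h *: ('e_j : V)) - g (x 0 i))) = cst 0.
  apply/funext => h /=; rewrite !mxE (negbTE ij) andbF/= mulr0 add0r subrr.
  by rewrite scaler0.
split; first by rewrite /derivable E; exact: is_cvg_cst.
by rewrite /derive E; apply: cvg_lim => //; exact: cvg_cst.
Qed.

(** The algebra generated by the logistic functions of affine functions of the
    coordinates: it is stable under differentiation, and bounded. *)
Inductive logi : (V -> R) -> Prop :=
| logi_cst (a : R) : logi (cst a)
| logi_gen (i : 'I_d) (a b : R) : logi (fun x : V => logistic (a * x 0 i + b))
| logiD f g : logi f -> logi g -> logi (f + g)
| logiM f g : logi f -> logi g -> logi (f * g).

Lemma logi_bounded f : logi f -> exists2 M, 0 <= M & forall x, `|f x| <= M.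
Proof.
elim=> [a|i a b|{}f g _ [M M0 fM] _ [N N0 gN]|{}f g _ [M M0 fM] _ [N N0 gN]].
- by exists `|a|.
- exists 1 => // x; rewrite ger0_norm ?logistic_le1// ltW//; exact: logistic_gt0.
- exists (M + N) => [|x]; first exact: addr_ge0.
  by rewrite (le_trans (ler_normD _ _))// lerD.
- exists (M * N) => [|x]; first exact: mulr_ge0.
  by rewrite normrM ler_pM.
Qed.

Lemma logi_derive f (j : 'I_d) : logi f ->
  exists2 df, logi df & forall x, is_derive x ('e_j : V) f (df x).
Proof.
elim=> [a|i a b|{}f g lf [df ldf hf] lg [dg ldg hg]
               |{}f g lf [df ldf hf] lg [dg ldg hg]].
- exists (cst 0) => [|x]; [exact: logi_cst|exact: is_derive_cst].
- pose s (x : V) := logistic (a * x 0 i + b).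
  exists (cst (if i == j then a else 0) * (s * (cst 1 + cst (-1) * s))).
    apply: logiM; first exact: logi_cst.
    apply: logiM; first exact: logi_gen.
    apply: logiD; first exact: logi_cst.
    apply: logiM; [exact: logi_cst|exact: logi_gen].
  move=> x; set t := x 0 i.
  have h : is_derive t (1 : R) (fun u => logistic (a * u + b))
      (logistic (a * t + b) * (1 - logistic (a * t + b)) * a).
    apply: (@is_derive1_comp _ logistic (fun u => a * u + b)).
      exact: is_derive_logistic.
    have h1 := is_deriveM (is_derive_cst a t 1) (is_derive_id t (1 : R)).
    have h2 := is_deriveD h1 (is_derive_cst b t 1).
    by apply: (is_derive_eq h2); rewrite /GRing.scale/= mulr0 addr0 mulr1 addr0.
  apply: (is_derive_eq (is_derive_coord j h)).
  rewrite /= /s -/t !fctE; case: ifP => _; last by rewrite mul0r.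
  by rewrite mulrC mulN1r.
- exists (df + dg) => [|x]; [exact: logiD|exact: is_deriveD].
- exists (f * dg + g * df) => [|x]; last exact: is_deriveM.
  by apply: logiD; apply: logiM.
Qed.

Lemma continuous_coordinate (i : 'I_d) : continuous (fun x : V => x 0 i).
Proof. exact: coord_continuous. Qed.

Lemma logi_continuous f : logi f -> continuous f.
Proof.
elim=> [a|i a b|{}f g _ cf _ cg|{}f g _ cf _ cg] x.
- exact: cst_continuous.
- apply: (@continuous_comp _ _ _ (fun x : V => a * x 0 i + b) logistic).
    apply: continuousD; last exact: cst_continuous.
    apply: continuousM; [exact: cst_continuous|exact: continuous_coordinate].
  apply: differentiable_continuous; apply/derivable1_diffP.
  exact: (@ex_derive _ _ _ _ _ _ _ (is_derive_logistic _)).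
- by apply: continuousD; [exact: cf|exact: cg].
- by apply: continuousM; [exact: cf|exact: cg].
Qed.

Definition lweight (x : V) : R := \prod_(i < d) ldens (x 0 i).

Lemma lweight_gt0 x : 0 < lweight x.
Proof. by apply: prodr_gt0 => i _; exact: ldens_gt0. Qed.

Lemma logi_prod (s : seq 'I_d) (f : 'I_d -> V -> R) : (forall i, logi (f i)) ->
  logi (fun x => \prod_(i <- s) f i x).
Proof.
move=> lf; elim: s => [|i s IH].
  rewrite (_ : (fun _ => _) = cst 1); first exact: logi_cst.
  by apply/funext => x; rewrite big_nil.
rewrite (_ : (fun _ => _) = f i * (fun x => \prod_(i <- s) f i x)).
  exact: logiM.
by apply/funext => x; rewrite big_cons.
Qed.

Lemma logi_coord (i : 'I_d) : logi (fun x : V => logistic (x 0 i)).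
Proof.
have := logi_gen i 1 0; congr logi.
by apply/funext => x; rewrite mul1r addr0.
Qed.

Lemma logi_lweight : logi lweight.
Proof.
apply: (@logi_prod (index_enum _) (fun i x => ldens (x 0 i))) => i.
rewrite (_ : (fun _ => _) = (fun x : V => logistic (x 0 i)) *
    (cst 1 + cst (-1) * (fun x : V => logistic (x 0 i)))).
  apply: logiM; first exact: logi_coord.
  apply: logiD; first exact: logi_cst.
  by apply: logiM; [exact: logi_cst|exact: logi_coord].
by apply/funext => x; rewrite /ldens !fctE /= mulN1r.
Qed.

Lemma lweight_derive (j : 'I_d) :
  exists2 q, logi q & forall x, is_derive x ('e_j : V) lweight (q x * lweight x).
Proof.
rewrite /lweight; elim: (index_enum _) => [|i s [q lq hq]].
  exists (cst 0) => [|x]; first exact: logi_cst.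
  rewrite (_ : (fun _ => _) = cst 1); last first.
    by apply/funext => y; rewrite big_nil.
  by rewrite mul0r; exact: is_derive_cst.
pose l (x : V) := logistic (x 0 i).
exists (q + cst (if i == j then 1 else 0) * (cst 1 + cst (-2) * l)) => [|x].
  apply: logiD => //; apply: logiM; first exact: logi_cst.
  apply: logiD; first exact: logi_cst.
  by apply: logiM; [exact: logi_cst|exact: logi_coord].
rewrite (_ : (fun _ => _) = (fun y : V => ldens (y 0 i)) *
    (fun y : V => \prod_(i <- s) ldens (y 0 i))); last first.
  by apply/funext => y; rewrite big_cons.
have h : is_derive (x 0 i) (1 : R) ldens (ldens (x 0 i) * (1 - 2 * l x)).
  have h1 := is_derive_logistic (x 0 i).
  have h2 := is_deriveB (is_derive_cst (1 : R) (x 0 i) (1 : R)) h1.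
  apply: (is_derive_eq (is_deriveM h1 h2)).
  by rewrite /GRing.scale/= /ldens /l !fctE /=; ring.
apply: (is_derive_eq (is_deriveM (is_derive_coord j h) (hq x))).
rewrite /GRing.scale/= big_cons !fctE /=.
by case: ifP => _; ring.
Qed.

Lemma logi_pderivs f (l : seq 'I_d) : logi f ->
  exists2 g, logi g & pderivs l (fun x => f x * lweight x) = g * lweight.
Proof.
move=> lf; elim: l => [|j l [g lg E]]; first by exists f.
have [q lq hq] := lweight_derive j; have [dg ldg hg] := logi_derive j lg.
exists (dg + g * q); first by apply: logiD => //; apply: logiM.
apply/funext => x /=; rewrite E.
have := is_deriveM (hg x) (hq x) => h; rewrite (@derive_val _ _ _ _ _ _ _ h).
by rewrite /GRing.scale/= !fctE; ring.
Qed.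

Lemma smooth_logi f : logi f -> smooth_real (fun x => f x * lweight x).
Proof.
move=> lf l; have [g lg ->] := logi_pderivs l lf; split.
  by apply: logi_continuous; apply: logiM => //; exact: logi_lweight.
move=> i x; have [h lh hh] := logi_derive i (logiM lg logi_lweight).
exact: (@ex_derive _ _ _ _ _ _ _ (hh x)).
Qed.

Lemma jbracket_sqr (x : V) : jbracket x ^+ 2 = 1 + \sum_(i < d) x 0 i ^+ 2.
Proof.
have e0 : 0 <= dot x x by apply: sumr_ge0 => i _; rewrite -expr2 sqr_ge0.
rewrite /jbracket sqr_sqrtr ?addr_ge0 ?sqr_ge0// /enorm sqr_sqrtr//.
Qed.

Lemma jbracket_ge0 (x : V) : 0 <= jbracket x.
Proof. exact: sqrtr_ge0. Qed.

Lemma jbracket_ge1 (x : V) : 1 <= jbracket x.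
Proof.
rewrite -(@ler_pXn2r _ 2)// ?nnegrE ?jbracket_ge0// jbracket_sqr expr1n lerDl.
by apply: sumr_ge0 => i _; exact: sqr_ge0.
Qed.

Lemma jbracket_le_sum (x : V) : jbracket x <= 1 + \sum_(i < d) `|x 0 i|.
Proof.
have s0 : 0 <= \sum_(i < d) `|x 0 i| by exact: sumr_ge0.
rewrite -(@ler_pXn2r _ 2)// ?nnegrE ?jbracket_ge0 ?addr_ge0// jbracket_sqr.
have : \sum_(i < d) x 0 i ^+ 2 <= (\sum_(i < d) `|x 0 i|) ^+ 2.
  rewrite [leRHS]expr2 mulr_suml ler_sum// => i _.
  rewrite -real_normK ?num_real// expr2 ler_wpM2l//.
  by rewrite (bigD1 i)//= lerDl sumr_ge0.
by rewrite sqrrD mul1r expr1n => h; nra.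
Qed.

Lemma lweight_le (x : V) : lweight x <= expR (- \sum_(i < d) `|x 0 i|).
Proof.
rewrite -sumrN expR_sum; apply: ler_prod => i _.
by rewrite (ltW (ldens_gt0 _)) ldens_le.
Qed.

Lemma lweight_decay (N : nat) : exists2 C : R, 0 <= C &
  forall x : V, jbracket x ^+ N * lweight x <= C.
Proof.
exists (N.+1`!%:R * expR 1) => [|x]; first by rewrite mulr_ge0 ?expR_ge0.
set S := \sum_(i < d) `|x 0 i|; have s0 : 0 <= S by exact: sumr_ge0.
have h1 : jbracket x ^+ N <= (1 + S) ^+ N.+1.
  apply: (@le_trans _ _ (jbracket x ^+ N.+1)).
    by rewrite exprS ler_peMl ?exprn_ge0 ?jbracket_ge0// jbracket_ge1.
  by rewrite lerXn2r// ?nnegrE ?jbracket_ge0 ?addr_ge0// jbracket_le_sum.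
have h2 : (1 + S) ^+ N.+1 <= N.+1`!%:R * expR (1 + S).
  have := @expR_ge1Dxn _ (1 + S) N (addr_ge0 ler01 s0).
  rewrite -ler_pdivrMl ?ltr0n ?fact_gt0// mulrC; apply: le_trans.
  by rewrite lerDr.
apply: (@le_trans _ _ ((N.+1`!%:R * expR (1 + S)) * expR (- S))).
  rewrite ler_pM ?exprn_ge0 ?jbracket_ge0 ?(ltW (lweight_gt0 _))//.
    exact: le_trans h2.
  exact: lweight_le.
by rewrite -mulrA -expRD addrK.
Qed.

(** These are the Schwartz functions that will separate distributions: a fixed
    rapidly decreasing weight times an algebra. *)
Lemma schwartz_logi f : logi f -> schwartz (fun x => (f x * lweight x)%:C).
Proof.
move=> lf; have z : (fun x : V => complex.Im (f x * lweight x)%:C) =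
    (fun x => cst 0 x * lweight x) by apply/funext => x /=; rewrite mul0r.
split.
  by split; [exact: smooth_logi|rewrite z; apply: smooth_logi; exact: logi_cst].
move=> N; have [C C0 hC] := lweight_decay N.
have H (l : seq 'I_d) : exists M : R, 0 <= M /\ forall x, jbracket x ^+ N *
    cnorm (cpderivs l (fun x => (f x * lweight x)%:C) x) <= M.
  have [g1 lg1 E1] := logi_pderivs l lf.
  have [g2 lg2 E2] := logi_pderivs l (logi_cst 0).
  have [M1 M10 h1] := logi_bounded lg1; have [M2 M20 h2] := logi_bounded lg2.
  exists ((M1 + M2) * C); split=> [|x]; first by rewrite mulr_ge0// addr_ge0.
  apply: (@le_trans _ _ (jbracket x ^+ N * ((M1 + M2) * lweight x))).
    rewrite ler_wpM2l ?exprn_ge0 ?jbracket_ge0//.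
    apply: (le_trans (cnorm_le_ReIm _)); rewrite /cpderivs z /= E1 E2 !fctE.
    rewrite !normrM (gtr0_norm (lweight_gt0 _)) -mulrDl.
    by rewrite ler_wpM2r ?(ltW (lweight_gt0 _))// lerD.
  by rewrite mulrCA ler_wpM2l// addr_ge0.
have [M hM] := choice H.
pose B := \sum_(n < N.+1) \sum_(t : n.-tuple 'I_d) M t.
apply: (@le_lt_trans _ _ B%:E); last exact: ltry.
apply: ge_ereal_sup => _ [l [x [lN ->]]].
rewrite lee_fin (le_trans ((hM l).2 x))// /B.
rewrite (bigD1 (Ordinal (lN : (size l < N.+1)%N)))//=.
rewrite (bigD1 (in_tuple l))//= -addrA lerDl addr_ge0//.
  by apply: sumr_ge0 => t _; case: (hM t).
by apply: sumr_ge0 => n _; apply: sumr_ge0 => t _; case: (hM t).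
Qed.

End logistic_algebra.

Lemma prod_itv01_le1 (R : realDomainType) (I : Type) (s : seq I) (P : pred I)
    (f : I -> R) : (forall i, P i -> 0 <= f i <= 1) ->
  \prod_(i <- s | P i) f i <= 1.
Proof. by move=> h; rewrite -[leRHS](@big1_eq _ _ *%R _ s P); apply: ler_prod. Qed.

Section uniqueness.
Context {R : realType} {d : nat}.
Local Notation V := 'rV[R]_d.
Local Notation mu := (leb R d).

Definition orthant (b : V) : set V := [set x | forall i, x 0 i < b 0 i].

Lemma measurable_orthant b : measurable (orthant b).
Proof.
rewrite (_ : orthant b =
    [set x | forall i, `]-oo, b 0 i[%classic (x 0 i)]); last first.
  by apply/seteqP; split => x h i; have := h i; rewrite /= in_itv.
by apply: (measurable_box (A := fun i => `]-oo, b 0 i[%classic)).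
Qed.

Definition orthants : set (set V) := [set orthant b | b in setT].

Lemma orthants_setI : setI_closed orthants.
Proof.
move=> _ _ [a _ <-] [b _ <-].
exists (\row_i Num.min (a 0 i) (b 0 i)) => //; apply/seteqP; split => x /=.
  by move=> h; split => i; have := h i; rewrite mxE lt_min => /andP[].
by move=> [ha hb] i; rewrite mxE lt_min ha hb.
Qed.

Lemma measurable_orthants (A : set V) : measurable A -> <<s orthants >> A.
Proof.
move=> mA; pose S := g_sigma_algebraType orthants.
have h : measurable_fun [set: S] (id : S -> V).
  apply: measurable_fun_rV => i.
  apply: (measurability (RGenInftyO.G (R := R))) => [|_ [_ [b ->]] <-].
    exact: RGenInftyO.measurableE.
  rewrite setTI.
  rewrite (_ : _ @^-1` _ = \bigcup_m
      (orthant (\row_j (if j == i then b else m%:R)) : set S)); last first.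
    apply/seteqP; split => x /=; rewrite in_itv/=.
      move=> xb; exists (Num.bound (\sum_j `|x 0 j|)) => //= j; rewrite mxE.
      case: eqP => [->//|_]; apply: le_lt_trans (archi_boundP _).
        by rewrite (le_trans (ler_norm _))// (bigD1 j)//= lerDl sumr_ge0.
      exact: sumr_ge0.
    by move=> [m _ /= hm]; have := hm i; rewrite mxE eqxx.
  by apply: bigcup_measurable => m _; apply: sub_sigma_algebra; exists
    (\row_j (if j == i then b else m%:R)).
by have := h measurableT A mA; rewrite setTI.
Qed.

Lemma logistic_le_inv (n : nat) (t : R) : t <= - n%:R ->
  logistic t <= n.+1%:R^-1.
Proof.
move=> tn; rewrite /logistic lef_pV2 ?posrE ?ltr0n ?ltr_wpDr ?expR_ge0//.
rewrite -natr1 addrC lerD2l (le_trans _ (expR_ge1Dx _))//.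
by rewrite lerNr in tn; rewrite (le_trans tn)// lerDr.
Qed.

(** Logistic steps approximate the indicators of the orthants, which generate
    the measurable sets and are stable under intersection. *)
Lemma logi_unique (w : V -> R) : mu.-integrable setT (EFin \o w) ->
  (forall v, logi v -> \int[mu]_x (w x * v x) = 0) ->
  ae_eq mu setT (EFin \o w) (cst 0%E).
Proof.
move=> wi h.
have wA (A : set V) : measurable A -> mu.-integrable A (EFin \o w).
  by move=> mA; apply: integrableS wi.
have H0 b : (\int[mu]_(x in orthant b) (w x)%:E = 0)%E.
  (* with slope n ^ 2 and shift n, the step is at most 1 / (n + 1) from b on,
     and tends to 1 before b *)
  pose st (n : nat) (i : 'I_d) (x : V) :=
    logistic (- n%:R ^+ 2 * x 0 i + (n%:R ^+ 2 * b 0 i - n%:R)).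
  pose v n x := \prod_(i <- index_enum 'I_d) st n i x.
  have lv n : logi (v n) by apply: logi_prod => i; exact: logi_gen.
  have v1 n x : 0 <= v n x <= 1.
    rewrite /v; apply/andP; split.
      by apply: prodr_ge0 => i _; exact/ltW/logistic_gt0.
    by apply: prod_itv01_le1 => i _; rewrite ltW ?logistic_gt0//= logistic_le1.
  have mv n : measurable_fun setT (v n).
    by apply: continuous_measurable_rV; exact: logi_continuous.
  have mw : measurable_fun setT w by apply/measurable_EFinP; exact: measurable_int wi.
  have cv x : v ^~ x @ \oo --> (\1_(orthant b) x : R).
    have hm := @cvg_harmonic R.
    have [xb|/existsNP[i /negP]] := pselect (orthant b x); last first.
      rewrite -leNgt => bx; rewrite indicE memNset; last first.
        by move=> /(_ i); rewrite ltNge bx.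
      apply: (@squeeze_cvgr _ _ _ _ (cst 0) harmonic) => //; last exact: cvg_cst.
      apply: nearW => n; case/andP: (v1 n x) => -> _ /=.
      rewrite /v (bigD1_seq i) ?mem_index_enum ?index_enum_uniq//=.
      apply: (@le_trans _ _ (st n i x)).
        rewrite ler_piMr ?(ltW (logistic_gt0 _))//; apply: prod_itv01_le1 => j _.
        by rewrite (ltW (logistic_gt0 _))/= logistic_le1.
      apply: logistic_le_inv; rewrite addrA lerBlDr addNr mulNr addrC -mulrBr.
      by rewrite mulr_ge0_le0 ?sqr_ge0// subr_le0.
    rewrite indicE mem_set//.
    have cs i : (fun n => st n i x) @ \oo --> (1 : R).
      pose e := b 0 i - x 0 i; have e0 : 0 < e by rewrite subr_gt0.
      apply: (@squeeze_cvgr _ _ _ _ (fun n => 1 - harmonic n) (cst 1)).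
      - near=> n; rewrite logistic_le1 andbT lerBlDr -lerBlDl logisticN.
        apply: logistic_le_inv; rewrite lerN2.
        have ne : 2 <= n%:R * e.
          rewrite -ler_pdivrMr//; near: n; exact: nbhs_infty_ger.
        rewrite addrA mulNr addrC addrA.
        have -> : - n%:R + - (n%:R ^+ 2 * x 0 i) + n%:R ^+ 2 * b 0 i =
            n%:R * (n%:R * e) - n%:R by rewrite /e; ring.
        have n0 : 0 <= n%:R :> R by [].
        nra.
      - by rewrite -[X in _ --> X]subr0; apply: cvgB => //; exact: cvg_cst.
      - exact: cvg_cst.
    rewrite /v -[true%:R]/(1 : R); elim: (index_enum _) => [|i s IH].
      by under eq_fun do rewrite big_nil; exact: cvg_cst.
    under eq_fun do rewrite big_cons.
    by have := cvgM (cs i) IH; rewrite mulr1; apply; exact: eventually_filter.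
  have D := @dominated_convergence _ _ _ mu setT measurableT
    (fun n x => (w x * v n x)%:E) (fun x => (w x * \1_(orthant b) x)%:E)
    (fun x => `|w x|%:E).
  have [] := D.
  - by move=> n; apply/measurable_EFinP; exact: measurable_funM.
  - apply/measurable_EFinP; apply: measurable_funM => //.
    by apply: measurable_indic; exact: measurable_orthant.
  - apply: aeW => x _; apply: cvg_EFin; first exact: nearW.
    by apply: cvgMl_tmp; exact: cv.
  - by have := integrable_norm wi.
  - apply: aeW => x n _; rewrite abse_EFin lee_fin normrM.
    rewrite ler_piMr// ger0_norm; by case/andP: (v1 n x).
  move=> _ _.
  rewrite (_ : [sequence _]_n = cst 0%E); last first.
    apply/funext => n /=; rewrite -[LHS]fineK; last first.
      apply: integrable_fin_num => //.
      apply: (integrableMl measurableT wi (mv n)).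
      exists 1; split => // M M1 x _; apply: le_trans (ltW M1).
      by rewrite ger0_norm; case/andP: (v1 n x).
    by congr EFin; exact: (h _ (lv n)).
  move=> /(cvg_lim (@ereal_hausdorff R)); rewrite lim_cst// => E0.
  rewrite [RHS]E0 [LHS]integral_mkcond; apply: eq_integral => x _.
  rewrite patchE indicE; case: ifP => _; first by rewrite mulr1.
  by rewrite mulr0.
have HA (A : set V) : measurable A -> (\int[mu]_(x in A) (w x)%:E = 0)%E.
  move=> mA; have := measurable_orthants mA.
  pose H : set (set V) := [set A | measurable A /\ (\int[mu]_(x in A) (w x)%:E = 0)%E].
  suff : <<s orthants >> `<=` H by move=> /[apply] -[].
  apply: (lambda_system_subset orthants_setI) => //; last first.
    by move=> _ [b _ <-]; split; [exact: measurable_orthant|exact: H0].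
  apply/dynkin_lambda_system; split.
  - split => //; rewrite -[LHS]fineK; last exact: integrable_fin_num wi.
    congr EFin; rewrite -[RHS](h _ (logi_cst 1)).
    by apply: eq_Rintegral => x _; rewrite mulr1.
  - move=> B [mB B0]; split; first exact: measurableC.
    have : (\int[mu]_(x in B `|` ~` B) (w x)%:E = 0)%E.
      rewrite setUCr -[LHS]fineK; last exact: integrable_fin_num wi.
      congr EFin; rewrite -[RHS](h _ (logi_cst 1)).
      by apply: eq_Rintegral => x _; rewrite mulr1.
    rewrite integral_setU//; last 3 first.
    + exact: measurableC.
    + by rewrite setUCr; exact: measurable_int wi.
    + by rewrite disj_set2E setICr.
    by rewrite B0 add0e.
  - move=> F tF HF; split; first by apply: bigcup_measurable => n _; case: (HF n).
    rewrite integral_bigcup//; last 2 first.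
    + by move=> n; case: (HF n).
    + by apply: wA; apply: bigcup_measurable => n _; case: (HF n).
    by apply: eseries0 => n _ _; case: (HF n).
have := @integral_ae_eq _ _ _ mu setT measurableT (cst 0%E) (EFin \o w) wi.
apply; first by [].
by move=> E _ mE; rewrite HA// integral0.
Unshelve. all: by end_near. Qed.

Definition pweight (x : V) : R := \prod_(i < d) (1 + x 0 i ^+ 2)^-1.

Lemma pweight_gt0 x : 0 < pweight x.
Proof. by apply: prodr_gt0 => i _; rewrite invr_gt0 ltr_wpDr ?sqr_ge0. Qed.

Lemma integrable_pweight : mu.-integrable setT (EFin \o pweight).
Proof.
apply: (integrable_tensor (g := fun i t => (1 + t ^+ 2)^-1)) => i.
exact: integrable_oneDsqrV.
Qed.

Lemma pweightV_le (x : V) : (pweight x)^-1 <= jbracket x ^+ (2 * d).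
Proof.
rewrite /pweight prodfV invrK exprM jbracket_sqr.
rewrite -[X in _ ^+ X]card_ord -prodr_const; apply: ler_prod => i _.
rewrite addr_ge0 ?sqr_ge0//= lerD2l (bigD1 i)//= lerDl.
by apply: sumr_ge0 => j _; exact: sqr_ge0.
Qed.

Lemma le_pweight (C a : R) x : jbracket x ^+ (2 * d) * a <= C -> 0 <= a ->
  a <= C * pweight x.
Proof.
move=> h a0; rewrite -ler_pdivrMr ?pweight_gt0//; apply: le_trans h.
by rewrite mulrC ler_wpM2r// pweightV_le.
Qed.

Lemma cintegrable_pweight (C : R) (f : V -> R[i]) : cmeasurable f ->
  (forall x, cnorm (f x) <= C * pweight x) -> cintegrable mu f.
Proof.
move=> mf h; apply: (@cintegrable_le _ _ _ mu (fun x => C * pweight x)) => //.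
have := integrableZl measurableT C integrable_pweight.
exact: eq_integrable.
Qed.

Lemma lweight_mass : exists2 A : R, 0 < A &
  mu.-integrable setT (EFin \o (@lweight R d)) /\
  (\int[mu]_x (lweight x)%:E <= A%:E)%E.
Proof.
have [C C0 h] := @lweight_decay R d (2 * d).
have ml : measurable_fun setT (@lweight R d).
  by apply: continuous_measurable_rV; apply: logi_continuous; exact: logi_lweight.
have li : mu.-integrable setT (EFin \o (@lweight R d)).
  apply: (le_integrable measurableT _ _
    (integrableZl measurableT C integrable_pweight)).
    exact/measurable_EFinP.
  move=> x _ /=; rewrite lee_fin !ger0_norm ?(ltW (lweight_gt0 _))//.
    by apply: le_pweight; rewrite ?h// ltW// lweight_gt0.
  by rewrite mulr_ge0// ltW// pweight_gt0.
exists (\int[mu]_x lweight x + 1).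
  by rewrite ltr_wpDl// Rintegral_ge0// => x _; rewrite ltW// lweight_gt0.
split => //; rewrite EFinD -[X in (X + _)%E]/(fine _)%:E fineK ?leeDl//.
exact: integrable_fin_num li.
Qed.

Lemma smooth_cmeasurable (f : V -> R[i]) : smooth f -> cmeasurable f.
Proof.
move=> [sr si]; split; apply: continuous_measurable_rV.
  by have [] := sr [::].
by have [] := si [::].
Qed.

Lemma schwartz_bound (f : V -> R[i]) (N : nat) : schwartz f ->
  exists2 C : R, (C%:E = schwartz_seminorm N f)%E &
  forall x, jbracket x ^+ N * cnorm (f x) <= C.
Proof.
move=> [_ /(_ N) foo].
have H x : ((jbracket x ^+ N * cnorm (f x))%:E <= schwartz_seminorm N f)%E.
  apply: ereal_sup_ubound => /=; exists [::], x; split => //.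
  by congr EFin; congr (_ * _); rewrite cnormE.
have f0 : schwartz_seminorm N f \is a fin_num.
  rewrite ge0_fin_numE//; apply: le_trans (H 0).
  by rewrite lee_fin mulr_ge0 ?exprn_ge0 ?jbracket_ge0 ?cnorm_ge0.
exists (fine (schwartz_seminorm N f)); first by rewrite fineK.
by move=> x; rewrite -lee_fin fineK.
Qed.

Lemma schwartz_cintegrable (f : V -> R[i]) : schwartz f -> cintegrable mu f.
Proof.
move=> sf; have [C _ h] := schwartz_bound (2 * d) sf.
apply: (@cintegrable_pweight C); first by apply: smooth_cmeasurable; case: sf.
by move=> x; apply: le_pweight => //; exact: cnorm_ge0.
Qed.

Lemma Ccinfty_cintegrable (f : V -> R[i]) : Ccinfty f -> cintegrable mu f.
Proof.
move=> [sf kf]; have mf := smooth_cmeasurable sf.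
pose u x := (`|complex.Re (f x)| + `|complex.Im (f x)|) * (pweight x)^-1.
have cre : continuous (fun x => complex.Re (f x)) by case: sf => /(_ [::]) [].
have cim : continuous (fun x => complex.Im (f x)) by case: sf => _ /(_ [::]) [].
have cn (g : V -> R) : continuous g -> continuous (fun x => `|g x|).
  by move=> cg x; apply: (continuous_comp (cg x)); exact: norm_continuous.
have cpw : continuous (fun y : V => (pweight y)^-1).
  have pE : (fun y : V => (pweight y)^-1) = (fun y => \prod_(i < d) (1 + y 0 i ^+ 2)).
    by apply/funext => y; rewrite /pweight prodfV invrK.
  rewrite pE; elim: (index_enum _) => [|i s IH].
    by under eq_fun do rewrite big_nil; move=> x; exact: cst_continuous.
  have ci : continuous (fun y : V => 1 + y 0 i ^+ 2).
    move=> x; have h : {for x, continuous (fun y : V => y 0 i ^+ 2)}.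
      apply: (@continuous_comp _ _ _ (fun y : V => y 0 i) (fun t : R => t ^+ 2)).
        exact: continuous_coordinate.
      exact: exprn_continuous.
    exact: (continuousD (@cst_continuous _ _ (1 : R) x) h).
  under eq_fun do rewrite big_cons.
  by move=> x; exact: (continuousM (ci x) (IH x)).
have cu : continuous u.
  move=> x; exact: (continuousM (continuousD (cn _ cre x) (cn _ cim x)) (cpw x)).
have [M [_ hM]] := compact_bounded (continuous_compact (continuous_subspaceT cu) kf).
apply: (@cintegrable_pweight (`|M| + 1)) => // x.
have M1 : 0 <= `|M| + 1 by rewrite addr_ge0.
have [fx0|fx0] := eqVneq (f x) 0.
  by rewrite fx0 cnorm0 mulr_ge0// ltW// pweight_gt0.
apply: (le_trans (cnorm_le_ReIm _)); rewrite -ler_pdivrMr ?pweight_gt0//.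
have Mlt : M < `|M| + 1 by rewrite (le_lt_trans (ler_norm _))// ltrDl.
apply: (le_trans (ler_norm _)); apply: (hM _ Mlt (u x)).
by exists x => //; exact: subset_closure.
Qed.

Lemma ae_eq_Lnorm p (f g : V -> R) : measurable_fun setT f ->
  measurable_fun setT g -> ae_eq mu setT f g -> (1 <= p)%E ->
  Lnorm mu p (EFin \o f) = Lnorm mu p (EFin \o g).
Proof.
move=> mf mg fg; case: p => [r| |//] _; rewrite unlock.
  congr (_ `^ _)%E; apply: ae_eq_integral => //.
  - apply: (@measurableT_comp _ _ _ _ _ _ (fun x => x `^ r)%E) => //.
      exact: (measurableT_comp (measurable_poweR _)).
    by apply: measurableT_comp => //; exact/measurable_EFinP.
  - apply: (@measurableT_comp _ _ _ _ _ _ (fun x => x `^ r)%E) => //.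
      exact: (measurableT_comp (measurable_poweR _)).
    by apply: measurableT_comp => //; exact/measurable_EFinP.
  - by apply: filterS fg => x h _ /=; rewrite h.
case: ifP => // _; apply: eq_ess_sup; apply: filterS fg => x h /=.
by rewrite h.
Qed.

(** Multiplied by the weight [lweight], both functions are integrable and have
    the same pairings with the algebra [logi]; so they are equal almost
    everywhere. *)
Lemma represents_unique p g h (T : (V -> R[i]) -> R[i]) (M : R) : (1 <= p)%E ->
  represents g T -> represents h T -> (Lpnorm p g < +oo)%E ->
  (forall x, cnorm (h x) <= M) -> Lpnorm p g = Lpnorm p h.
Proof.
move=> p1 [gr gi gT] [hr hi hT] goo hM.
have [A A0 [li lA]] := lweight_mass.
have ml : measurable_fun setT (@lweight R d).
  by apply/measurable_EFinP; exact: measurable_int li.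
have l1 (x : V) : 0 <= lweight x <= 1.
  rewrite (ltW (lweight_gt0 _))/=; apply: prod_itv01_le1 => i _.
  rewrite (ltW (ldens_gt0 _))/= (le_trans (ldens_le _))//.
have cgl : cintegrable mu (fun x => g x * (lweight x)%:C).
  split; first by apply: cmeasurableM; [split|exact: cmeasurable_real].
  under eq_integral => x _ do rewrite cnormM cnorm_real
    (ger0_norm (ltW (lweight_gt0 _))).
  apply: (le_lt_trans (hoelder_bounded A0 ltr01 ml l1 lA _ p1)); first by split.
  have gL : (Lnorm mu p (fun x => (cnorm (g x))%:E) < +oo)%E.
    by rewrite -LpnormE.
  by rewrite lte_mul_pinfty ?ltry ?Lnorm_ge0// ge0_fin_numE ?Lnorm_ge0.
have chl : cintegrable mu (fun x => h x * (lweight x)%:C).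
  under eq_fun do rewrite mulrC.
  apply: (@cintegrable_bounded _ _ _ mu M) => //.
  apply: (@cintegrable_le _ _ _ mu lweight) => //.
  by move=> x; rewrite cnorm_real gtr0_norm// lweight_gt0.
have key v : logi v ->
    cint mu (fun x => g x * (lweight x)%:C * (v x)%:C) =
    cint mu (fun x => h x * (lweight x)%:C * (v x)%:C).
  move=> lv; have sv := schwartz_logi lv.
  transitivity (T (fun x => (v x * lweight x)%:C)).
    rewrite gT// cintegralE; apply: eq_cint => x.
    by rewrite rmorphM/= -mulrA [(v x)%:C * _]mulrC.
  rewrite hT// cintegralE; apply: eq_cint => x.
  by rewrite rmorphM/= -mulrA [(v x)%:C * _]mulrC.
have fin (F : (V -> R[i]) -> V -> R)
    (FI : forall f, cintegrable mu f -> mu.-integrable setT (EFin \o F f))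
    (FM : forall f (v : V -> R) x, F (fun x => f x * (v x)%:C) x = F f x * v x) :
    (forall v, logi v ->
      \int[mu]_x F (fun x => g x * (lweight x)%:C * (v x)%:C) x =
      \int[mu]_x F (fun x => h x * (lweight x)%:C * (v x)%:C) x) ->
    {ae mu, forall x, F g x = F h x}.
  move=> E.
  have iG := FI _ cgl; have iH := FI _ chl.
  have := @logi_unique (fun x => F (fun x => g x * (lweight x)%:C) x -
    F (fun x => h x * (lweight x)%:C) x).
  have i1 : mu.-integrable setT (EFin \o (fun x =>
      F (fun x => g x * (lweight x)%:C) x - F (fun x => h x * (lweight x)%:C) x)).
    have := integrableB measurableT iG iH; exact: eq_integrable.
  move=> /(_ i1) [|N [mN N0 hN]].
    move=> v lv; have [B B0 vB] := logi_bounded lv.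
    have mv : measurable_fun setT v.
      by apply: continuous_measurable_rV; exact: logi_continuous.
    have bnd : [bounded v x | x in (setT : set V)].
      exists B; split; first exact: num_real.
      by move=> C BC x _; apply: (le_trans (vB x)); exact: ltW.
    have j1 := integrableMl measurableT iG mv bnd.
    have j2 := integrableMl measurableT iH mv bnd.
    under eq_Rintegral do rewrite mulrBl.
    rewrite RintegralB//; apply/eqP; rewrite subr_eq0; apply/eqP.
    have := E v lv; under eq_Rintegral do rewrite FM.
    by under [in RHS]eq_Rintegral do rewrite FM.
  exists N; split => // x xN; apply: hN => /= /(_ I); apply: contra_not xN.
  move=> [] /eqP; rewrite !FM -mulrBl mulf_eq0 [lweight x == 0]gt_eqF ?lweight_gt0//.
  by rewrite orbF subr_eq0 => /eqP.
have Ere : {ae mu, forall x, complex.Re (g x) = complex.Re (h x)}.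
  apply: (fin (fun f x => complex.Re (f x))).
  - by move=> f; exact: cintegrable_Re.
  - by move=> f v x; rewrite cReM /= mulr0 subr0.
  - by move=> v lv; have := congr1 (@complex.Re R) (key v lv).
have Eim : {ae mu, forall x, complex.Im (g x) = complex.Im (h x)}.
  apply: (fin (fun f x => complex.Im (f x))).
  - by move=> f; exact: cintegrable_Im.
  - by move=> f v x; rewrite cImM /= mulr0 add0r.
  - by move=> v lv; have := congr1 (@complex.Im R) (key v lv).
rewrite !LpnormE; apply: (ae_eq_Lnorm (f := fun x => cnorm (g x))
  (g := fun x => cnorm (h x))) => //.
- exact: cmeasurable_cnorm.
- exact: cmeasurable_cnorm.
- by apply: filterS2 Ere Eim => x er ei _; congr cnorm; apply: complex_eq.
Qed.

(** ** Distributions given by integrable functions *)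

Definition Tf (f : V -> R[i]) : (V -> R[i]) -> R[i] :=
  fun phi => cintegral (fun x => f x * phi x).

Lemma cintegrable_mul_schwartz f phi : cintegrable mu f -> schwartz phi ->
  cintegrable mu (fun x => f x * phi x).
Proof.
move=> fi sp; have [C _ h] := schwartz_bound 0 sp.
apply: (@cintegrable_bounded _ _ _ mu C) => //.
  by apply: smooth_cmeasurable; case: sp.
by move=> x; have := h x; rewrite expr0 mul1r.
Qed.

Lemma tempered_Tf f : cintegrable mu f -> tempered (Tf f).
Proof.
move=> fi; split.
  move=> a phi psi sphi spsi; rewrite /Tf !cintegralE -cintZ; last first.
    exact: cintegrable_mul_schwartz.
  rewrite -cintD; last 2 first.
  - by apply: cintegrableZ; exact: cintegrable_mul_schwartz.
  - exact: cintegrable_mul_schwartz.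
  by apply: eq_cint => x; rewrite mulrDr mulrCA.
exists 0%N, (2 * \int[mu]_x cnorm (f x)) => phi sp.
have [C <- h] := schwartz_bound 0 sp.
have fpi := cintegrable_mul_schwartz fi sp.
rewrite -EFinM lee_fin /Tf cintegralE (le_trans (le_cnorm_cint fpi))//.
rewrite -mulrA ler_wpM2l// -RintegralZr//; last exact: cintegrable_norm.
apply: le_Rintegral => //.
- exact: cintegrable_norm.
- have := integrableZr measurableT C (cintegrable_norm fi); exact: eq_integrable.
- move=> x _; rewrite cnormM ler_wpM2l ?cnorm_ge0//.
  by have := h x; rewrite expr0 mul1r.
Qed.

Lemma cmeasurable_fourier f : cintegrable mu f -> cmeasurable (fourier f).
Proof.
move=> fi; rewrite (_ : fourier f = fun xi => (@fconst R d)%:C * ft (-1) f xi).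
  by apply: cmeasurableM; [exact: cmeasurable_cst|exact: cmeasurable_ft].
by apply/funext => xi; exact: fourierE.
Qed.

Lemma cmeasurable_inv_fourier f : cintegrable mu f ->
  cmeasurable (inv_fourier f).
Proof.
move=> fi; rewrite (_ : inv_fourier f = fun xi => (@fconst R d)%:C * ft 1 f xi).
  by apply: cmeasurableM; [exact: cmeasurable_cst|exact: cmeasurable_ft].
by apply/funext => xi; exact: inv_fourierE.
Qed.

Definition fbound (f : V -> R[i]) : R :=
  @fconst R d * (2 * \int[mu]_x cnorm (f x)).

Lemma fourier_bound f xi : cintegrable mu f -> cnorm (fourier f xi) <= fbound f.
Proof.
move=> fi; rewrite fourierE cnormM cnorm_real gtr0_norm ?fconst_gt0//.
by rewrite ler_wpM2l ?(ltW fconst_gt0)// ft_bound.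
Qed.

Lemma inv_fourier_bound f xi : cintegrable mu f ->
  cnorm (inv_fourier f xi) <= fbound f.
Proof.
move=> fi; rewrite inv_fourierE cnormM cnorm_real gtr0_norm ?fconst_gt0//.
by rewrite ler_wpM2l ?(ltW fconst_gt0)// ft_bound.
Qed.

Lemma cint_fourier f g : cintegrable mu f -> cintegrable mu g ->
  cint mu (fun x => f x * fourier g x) = cint mu (fun x => fourier f x * g x).
Proof.
move=> fi gi; transitivity ((@fconst R d)%:C * cint mu (fun x => f x * ft (-1) g x)).
  rewrite -cintZ; last first.
    apply: (@cintegrable_bounded _ _ _ mu (2 * \int[mu]_x cnorm (g x))) => //.
      exact: cmeasurable_ft.
    by move=> x; exact: ft_bound.
  by apply: eq_cint => x; rewrite fourierE mulrCA.
rewrite cint_ft// -cintZ; last first.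
  under eq_fun do rewrite mulrC.
  apply: (@cintegrable_bounded _ _ _ mu (2 * \int[mu]_x cnorm (f x))) => //.
    exact: cmeasurable_ft.
  by move=> x; exact: ft_bound.
by apply: eq_cint => x; rewrite fourierE mulrA.
Qed.

Lemma cint_inv_fourier f g : cintegrable mu f -> cintegrable mu g ->
  cint mu (fun x => f x * inv_fourier g x) =
  cint mu (fun x => inv_fourier f x * g x).
Proof.
move=> fi gi; transitivity ((@fconst R d)%:C * cint mu (fun x => f x * ft 1 g x)).
  rewrite -cintZ; last first.
    apply: (@cintegrable_bounded _ _ _ mu (2 * \int[mu]_x cnorm (g x))) => //.
      exact: cmeasurable_ft.
    by move=> x; exact: ft_bound.
  by apply: eq_cint => x; rewrite inv_fourierE mulrCA.
rewrite cint_ft// -cintZ; last first.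
  under eq_fun do rewrite mulrC.
  apply: (@cintegrable_bounded _ _ _ mu (2 * \int[mu]_x cnorm (f x))) => //.
    exact: cmeasurable_ft.
  by move=> x; exact: ft_bound.
by apply: eq_cint => x; rewrite inv_fourierE mulrA.
Qed.

(** The function that represents the multiplier with symbol [psi] applied to the
    distribution [Tf f]; it is bounded, being the transform of an integrable
    function. *)
Definition mult psi f : V -> R[i] :=
  inv_fourier (fun xi => psi xi * fourier f xi).

Lemma cintegrable_symbol psi f : cintegrable mu psi -> cintegrable mu f ->
  cintegrable mu (fun xi => psi xi * fourier f xi).
Proof.
move=> pi fi; apply: (@cintegrable_bounded _ _ _ mu (fbound f)) => //.
  exact: cmeasurable_fourier.
by move=> x; exact: fourier_bound.
Qed.

Lemma represents_mult psi f : cintegrable mu psi -> cintegrable mu f ->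
  represents (mult psi f) (fourier_multiplier psi (Tf f)).
Proof.
move=> psii fi; have [mr mi] := cmeasurable_inv_fourier (cintegrable_symbol psii fi).
split => // phi sphi; have phii := schwartz_cintegrable sphi.
rewrite /fourier_multiplier /dist_inv_fourier /dist_mul /dist_fourier /Tf.
rewrite !cintegralE.
have mi' : cintegrable mu (fun x => psi x * inv_fourier phi x).
  apply: (@cintegrable_bounded _ _ _ mu (fbound phi)) => //.
    exact: cmeasurable_inv_fourier.
  by move=> x; exact: inv_fourier_bound.
transitivity (cint mu (fun x => fourier f x * (psi x * inv_fourier phi x))).
  exact: (cint_fourier fi mi').
transitivity (cint mu (fun x => (psi x * fourier f x) * inv_fourier phi x)).
  by apply: eq_cint => x; rewrite mulrCA mulrA.
exact: (cint_inv_fourier (cintegrable_symbol psii fi) phii).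
Qed.

(** The infimum that defines the norm of a distribution runs over one class of
    functions only, by [represents_unique]. *)
Lemma dist_Lpnorm_mult p psi f : (1 <= p)%E ->
  cintegrable mu psi -> cintegrable mu f ->
  dist_Lpnorm p (fourier_multiplier psi (Tf f)) = Lpnorm p (mult psi f).
Proof.
move=> p1 psii fi; have rh := represents_mult psii fi.
apply/eqP; rewrite eq_le; apply/andP; split.
  by apply: ereal_inf_lbound; exists (mult psi f).
apply: le_ereal_inf_tmp => _ [g rg <-].
have [goo|] := ltP (Lpnorm p g) (+oo)%E; last by rewrite leye_eq => /eqP ->; rewrite leey.
rewrite (represents_unique p1 rg rh goo (M := fbound (fun xi => psi xi * fourier f xi)))//.
by move=> x; apply: inv_fourier_bound; exact: cintegrable_symbol.
Qed.

End uniqueness.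

(** * Estimates for the frequency pieces of the test functions *)

Lemma le_of_eq (disp : Order.disp_t) (T : porderType disp) (x y : T) :
  x = y -> (x <= y)%O.
Proof. by move=> ->. Qed.

Section pieces.
Context {R : realType} {d : nat}.
Local Notation V := 'rV[R]_d.
Local Notation mu := (leb R d).
Implicit Types (psi m : V -> R[i]) (c : V).

Definition cube c (r : R) : set V := [set x | forall i, `|x 0 i - c 0 i| <= r].

(** Adding 1 makes the constant positive. *)
Definition mass : R := (cmass + 1) ^+ d.

Lemma mass_gt0 : 0 < mass.
Proof. by rewrite exprn_gt0// ltr_wpDl// cmass_ge0. Qed.

Lemma maj_mass (r : R) (x : V) : 0 < r ->
  (\int[mu]_y (maj r (y + x))%:E <= mass%:E)%E.
Proof.
move=> r0; rewrite (maj_intE x r0).2 lee_fin lerXn2r// ?nnegrE ?addr_ge0 ?cmass_ge0//.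
by rewrite lerDl.
Qed.

Lemma measurable_fun_rVD : measurable_fun setT (fun z : V * V => z.1 + z.2).
Proof.
apply: measurable_fun_rV => i; under eq_fun do rewrite mxE.
have mc := @measurable_coord R d i.
apply: measurable_funD.
  exact: (measurableT_comp mc measurable_fst).
exact: (measurableT_comp mc measurable_snd).
Qed.

Lemma measurable_fun_rVB : measurable_fun setT (fun z : V * V => z.1 - z.2).
Proof.
apply: measurable_fun_rV => i; under eq_fun do rewrite !mxE.
have mc := @measurable_coord R d i.
apply: measurable_funB.
  exact: (measurableT_comp mc measurable_fst).
exact: (measurableT_comp mc measurable_snd).
Qed.

(** Domination by a convolution with [maj r], whose height is [r ^+ d] and
    whose mass is bounded: the L^1 norm controls all the others. *)
Lemma young_majD (r : R) (g h : V -> R[i]) p : 0 < r ->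
  cintegrable mu g -> cmeasurable h ->
  (forall x, (cnorm (h x))%:E <= \int[mu]_y (cnorm (g y) * maj r (y + x))%:E)%E ->
  (1 <= p)%E ->
  (Lpnorm p h <= ((\int[mu]_y cnorm (g y)) *
    ((r ^+ d) `^ (1 - recip p) * mass `^ recip p))%:E)%E.
Proof.
move=> r0 gi mh hg p1; rewrite LpnormE.
apply: (young (N := fun z : V * V => maj r (z.1 + z.2))) => //.
- exact: mass_gt0.
- exact: exprn_gt0.
- exact: (measurableT_comp (measurable_maj r) measurable_fun_rVD).
- by move=> z; rewrite maj_ge0 ?maj_le// ltW.
- by move=> y; exact: maj_mass.
- move=> x; apply: (le_trans (hg x)); apply: le_of_eq; apply: eq_integral => y _.
  by congr EFin; congr (_ * maj _ _); exact: addrC.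
Qed.

Lemma young_majB (r : R) (g h : V -> R[i]) p : 0 < r ->
  cintegrable mu g -> cmeasurable h ->
  (forall x, (cnorm (h x))%:E <= \int[mu]_y (cnorm (g y) * maj r (y - x))%:E)%E ->
  (1 <= p)%E ->
  (Lpnorm p h <= ((\int[mu]_y cnorm (g y)) *
    ((r ^+ d) `^ (1 - recip p) * mass `^ recip p))%:E)%E.
Proof.
move=> r0 gi mh hg p1; rewrite LpnormE.
apply: (young (N := fun z : V * V => maj r (z.1 - z.2))) => //.
- exact: mass_gt0.
- exact: exprn_gt0.
- exact: (measurableT_comp (measurable_maj r) measurable_fun_rVB).
- by move=> z; rewrite maj_ge0 ?maj_le// ltW.
- by move=> y; exact: (maj_mass (- y) r0).
- move=> x; apply: (le_trans (hg x)); apply: le_of_eq; apply: eq_integral => y _.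
  exact: (congr1 (fun t => (cnorm (g y) * t)%:E) (majN r y x)).
Qed.

Definition testf (l : R) c (r : R) : V -> R[i] := fun x => l%:C * tf c r 0 x.

Lemma cintegrable_testf l c r : 0 < r -> cintegrable mu (testf l c r).
Proof. by move=> r0; apply: cintegrableZ; exact: cintegrable_tf. Qed.

Lemma dot0l (x : V) : dot 0 x = 0.
Proof. by rewrite /dot big1// => i _; rewrite mxE mul0r. Qed.

Lemma fourier_testf l c r xi : 0 < r ->
  fourier (testf l c r) xi = (l * (@fconst R d * tfh c r xi))%:C.
Proof.
move=> r0; rewrite fourierE /ft.
transitivity ((@fconst R d)%:C * (l%:C * ft (-1) (tf c r 0) xi)).
  congr (_ * _); rewrite /ft -cintZ; last exact/cintegrable_phase/cintegrable_tf.
  by apply: eq_cint => x; rewrite mulrA.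
by rewrite ft_tf// dot0l cexpi0 mul1r -!rmorphM/= mulrCA.
Qed.

Lemma cintegrable_Lp1 (h : V -> R[i]) : cmeasurable h ->
  (Lpnorm 1 h < +oo)%E -> cintegrable mu h.
Proof.
move=> mh; rewrite LpnormE Lnorm1 => hoo; split => //.
by under eq_integral do rewrite -(ger0_norm (cnorm_ge0 _)) -abse_EFin.
Qed.

Lemma Lpnorm1E (h : V -> R[i]) : cintegrable mu h ->
  Lpnorm 1 h = (\int[mu]_x cnorm (h x))%:E.
Proof.
move=> hi; rewrite LpnormE Lnorm1 /Rintegral fineK; last first.
  exact: integrable_fin_num (cintegrable_norm hi).
by apply: eq_integral => x _; rewrite abse_EFin ger0_norm ?cnorm_ge0.
Qed.

Definition convc : R := @fconst R d * (2 * 20 ^+ d).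

Lemma convc_gt0 : 0 < convc.
Proof. by rewrite mulr_gt0 ?fconst_gt0// mulr_gt0// exprn_gt0. Qed.

(** Translating the test function multiplies its transform by a phase, so that
    the multiplication formula presents the piece as a convolution. *)
Lemma mult_testfE l c r psi x : 0 < r -> cintegrable mu psi ->
  mult psi (testf l c r) x =
  (@fconst R d)%:C * (l%:C * cint mu (fun y => fourier psi y * tf c r x y)).
Proof.
move=> r0 psii; rewrite -cint_fourier//; last exact: cintegrable_tf.
rewrite /mult inv_fourierE /ft; congr (_ * _); rewrite -cintZ; last first.
  exact/cintegrable_symbol/cintegrable_tf.
apply: eq_cint => xi; rewrite fourier_testf// fourierE ft_tf//.
rewrite mul1r (dotC xi x) !rmorphM/=.
by ring.
Qed.

Lemma cmeasurable_mult psi f : cintegrable mu psi -> cintegrable mu f ->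
  cmeasurable (mult psi f).
Proof. by move=> pi fi; apply/cmeasurable_inv_fourier/cintegrable_symbol. Qed.

Lemma mult_testf_upper l c r psi p : 0 <= l -> 0 < r -> (1 <= p)%E ->
  cintegrable mu psi -> cintegrable mu (fourier psi) ->
  (Lpnorm p (mult psi (testf l c r)) <=
   (l * convc * (\int[mu]_y cnorm (fourier psi y)) *
    ((r ^+ d) `^ (1 - recip p) * mass `^ recip p))%:E)%E.
Proof.
move=> l0 r0 p1 psii psih.
have k0 : 0 <= l * convc by rewrite mulr_ge0// ltW// convc_gt0.
have gi : cintegrable mu (fun y => (l * convc)%:C * fourier psi y).
  exact: cintegrableZ.
have := @young_majD r _ (mult psi (testf l c r)) p r0 gi.
rewrite (_ : \int[mu]_y cnorm ((l * convc)%:C * fourier psi y) =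
    l * convc * \int[mu]_y cnorm (fourier psi y)); last first.
  rewrite -RintegralZl//; last exact: cintegrable_norm.
  by apply: eq_Rintegral => y _; rewrite cnormM cnorm_real ger0_norm.
apply => //; first by apply: cmeasurable_mult => //; exact: cintegrable_testf.
move=> x; rewrite mult_testfE//.
have gmi : cintegrable mu (fun y => fourier psi y * tf c r x y).
  apply: (@cintegrable_bounded _ _ _ mu (20 ^+ d * r ^+ d)) => //.
    exact: cmeasurable_tf.
  move=> y; apply: (le_trans (cnorm_tf c x y (ltW r0))).
  by rewrite ler_wpM2l ?exprn_ge0// maj_le// ltW.
rewrite !cnormM !cnorm_real (ger0_norm l0) (gtr0_norm fconst_gt0) EFinM.
apply: (@le_trans _ _ ((@fconst R d)%:E * (l%:E * (2%:E *
    \int[mu]_y (cnorm (fourier psi y * tf c r x y))%:E)))%E).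
  rewrite lee_wpmul2l ?lee_fin ?(ltW fconst_gt0)// EFinM.
  by rewrite lee_wpmul2l ?lee_fin// le_cnorm_cintE.
have mN : measurable_fun setT (fun y => (cnorm (fourier psi y * tf c r x y))%:E).
  by apply/measurable_EFinP; apply: cmeasurable_cnorm; case: gmi.
rewrite !muleA -!EFinM -ge0_integralZl//; last 2 first.
- by move=> y _; rewrite lee_fin cnorm_ge0.
- by rewrite lee_fin !mulr_ge0// ltW// fconst_gt0.
have mmaj : measurable_fun setT (fun y : V => maj r (y + x)).
  apply: (measurableT_comp (measurable_maj r)).
  exact: (measurableT_comp measurable_fun_rVD (pair2_measurable x)).
apply: ge0_le_integral => //.
- by move=> y _; rewrite -EFinM lee_fin !mulr_ge0 ?cnorm_ge0// ltW// fconst_gt0.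
- exact: emeasurable_funM.
- apply/measurable_EFinP; apply: measurable_funM => //.
  by apply: cmeasurable_cnorm; case: gi.
- move=> y _; rewrite -EFinM lee_fin.
  have := cnorm_tf c x y (ltW r0); move: (fourier psi y) (tf c r x y) => F G h.
  rewrite !cnormM cnorm_real ger0_norm// /convc.
  have f0 : 0 <= l * @fconst R d * 2 * cnorm F.
    by rewrite !mulr_ge0 ?cnorm_ge0// ltW// fconst_gt0.
  rewrite [leLHS](_ : _ = l * @fconst R d * 2 * cnorm F * cnorm G); last by ring.
  by apply: (le_trans (ler_wpM2l f0 h)); apply: le_of_eq; ring.
Qed.

(** A function whose frequencies lie in a cube is reproduced by convolution
    with the test function adapted to that cube. *)
Lemma bernstein c (rho : R) m x : 0 < rho -> cintegrable mu m ->
  (forall xi, m xi != 0 -> cube c rho xi) -> cintegrable mu (inv_fourier m) ->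
  (wmass ^+ d)%:C * inv_fourier m x =
  cint mu (fun y => inv_fourier m y * tf (- c) rho (- x) y).
Proof.
move=> r0 mi mc hi; rewrite -cint_inv_fourier//; last exact: cintegrable_tf.
rewrite inv_fourierE /ft mulrCA -!cintZ; last 2 first.
- exact/cintegrableZ/cintegrable_phase.
- exact: cintegrable_phase.
apply: eq_cint => xi; rewrite inv_fourierE ft1_tfN// mul1r.
have [->|m0] := eqVneq (m xi) 0; first by rewrite !mul0r !mulr0.
rewrite tfh1//; last exact: mc.
by rewrite (dotC xi x); ring.
Qed.

Definition bernc : R := (wmass ^+ d)^-1 * (2 * 20 ^+ d).

Lemma wmassd_gt0 : 0 < wmass ^+ d :> R.
Proof. by rewrite exprn_gt0// wmass_gt0. Qed.

Lemma bernc_gt0 : 0 < bernc.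
Proof. by rewrite mulr_gt0 ?invr_gt0 ?wmassd_gt0// mulr_gt0// exprn_gt0. Qed.

Lemma bernstein_le c (rho : R) m x : 0 < rho -> cintegrable mu m ->
  (forall xi, m xi != 0 -> cube c rho xi) -> cintegrable mu (inv_fourier m) ->
  ((cnorm (inv_fourier m x))%:E <=
    bernc%:E * \int[mu]_y (cnorm (inv_fourier m y) * maj rho (y - x))%:E)%E.
Proof.
move=> r0 mi mc hi; have := bernstein x r0 mi mc hi.
set I := cint _ _ => E.
have -> : cnorm (inv_fourier m x) = (wmass ^+ d)^-1 * cnorm I.
  rewrite -E cnormM cnorm_real gtr0_norm ?wmassd_gt0// mulrA mulVf ?mul1r//.
  by rewrite lt0r_neq0// wmassd_gt0.
have gmi : cintegrable mu (fun y => inv_fourier m y * tf (- c) rho (- x) y).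
  apply: (@cintegrable_bounded _ _ _ mu (20 ^+ d * rho ^+ d)) => //.
    exact: cmeasurable_tf.
  move=> y; apply: (le_trans (cnorm_tf _ _ y (ltW r0))).
  by rewrite ler_wpM2l ?exprn_ge0// maj_le// ltW.
have mmaj : measurable_fun setT (fun y : V => maj rho (y - x)).
  apply: (measurableT_comp (measurable_maj rho)).
  exact: (measurableT_comp measurable_fun_rVB (pair2_measurable x)).
have mh : measurable_fun setT (fun y => cnorm (inv_fourier m y)).
  by apply: cmeasurable_cnorm; case: hi.
rewrite EFinM /bernc EFinM -muleA.
rewrite lee_wpmul2l ?lee_fin ?invr_ge0 ?(ltW wmassd_gt0)//.
apply: (le_trans (le_cnorm_cintE gmi)).
rewrite EFinM -muleA lee_wpmul2l ?lee_fin//.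
rewrite -ge0_integralZl ?lee_fin ?exprn_ge0//; last 2 first.
- by apply/measurable_EFinP; exact: measurable_funM.
- by move=> y _; rewrite lee_fin mulr_ge0 ?cnorm_ge0 ?maj_ge0// ltW.
apply: ge0_le_integral => //.
- by move=> y _; rewrite lee_fin cnorm_ge0.
- by apply/measurable_EFinP; apply: cmeasurable_cnorm; case: gmi.
- by apply: emeasurable_funM => //; apply/measurable_EFinP; exact: measurable_funM.
- move=> y _; rewrite -EFinM lee_fin cnormM mulrCA ler_wpM2l ?cnorm_ge0//.
  exact: (cnorm_tf _ _ y (ltW r0)).
Qed.

Lemma bernstein_Lp c (rho : R) m p : 0 < rho -> cintegrable mu m ->
  (forall xi, m xi != 0 -> cube c rho xi) -> cintegrable mu (inv_fourier m) ->
  (1 <= p)%E ->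
  (Lpnorm p (inv_fourier m) <=
   (bernc * (\int[mu]_y cnorm (inv_fourier m y)) *
    ((rho ^+ d) `^ (1 - recip p) * mass `^ recip p))%:E)%E.
Proof.
move=> r0 mi mc hi p1.
have gi : cintegrable mu (fun y => bernc%:C * inv_fourier m y).
  exact: cintegrableZ.
have := @young_majB rho _ (inv_fourier m) p r0 gi.
rewrite (_ : \int[mu]_y cnorm (bernc%:C * inv_fourier m y) =
    bernc * \int[mu]_y cnorm (inv_fourier m y)); last first.
  rewrite -RintegralZl//; last exact: cintegrable_norm.
  by apply: eq_Rintegral => y _; rewrite cnormM cnorm_real gtr0_norm// bernc_gt0.
apply => //; first exact: cmeasurable_inv_fourier.
move=> x; apply: (le_trans (bernstein_le x r0 mi mc hi)).
have mmaj : measurable_fun setT (fun y : V => maj rho (y - x)).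
  apply: (measurableT_comp (measurable_maj rho)).
  exact: (measurableT_comp measurable_fun_rVB (pair2_measurable x)).
rewrite -ge0_integralZl ?lee_fin ?(ltW bernc_gt0)//; last 2 first.
- apply/measurable_EFinP; apply: measurable_funM => //.
  by apply: cmeasurable_cnorm; case: hi.
- by move=> y _; rewrite lee_fin mulr_ge0 ?cnorm_ge0 ?maj_ge0// ltW.
rewrite le_eqVlt; apply/orP; left; apply/eqP; apply: eq_integral => y _.
by rewrite -EFinM mulrA cnormM cnorm_real gtr0_norm// bernc_gt0.
Qed.

(** In the convolution of [bernstein], the kernel is measured in the exponent
    dual to [p]. *)
Lemma bernstein_sup c (rho : R) m p x : 0 < rho -> cintegrable mu m ->
  (forall xi, m xi != 0 -> cube c rho xi) -> cintegrable mu (inv_fourier m) ->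
  (1 <= p)%E ->
  ((cnorm (inv_fourier m x))%:E <= Lpnorm p (inv_fourier m) *
    (bernc * ((rho ^+ d) `^ recip p * mass `^ (1 - recip p)))%:E)%E.
Proof.
move=> r0 mi mc hi p1; apply: (le_trans (bernstein_le x r0 mi mc hi)).
rewrite [(bernc * _)%:E]EFinM muleCA lee_wpmul2l ?lee_fin ?(ltW bernc_gt0)//.
rewrite LpnormE.
apply: hoelder_bounded => //.
- exact: mass_gt0.
- exact: exprn_gt0.
- apply: (measurableT_comp (measurable_maj rho)).
  exact: (measurableT_comp measurable_fun_rVB (pair2_measurable x)).
- by move=> y; rewrite maj_ge0 ?maj_le// ltW.
- exact: maj_mass.
- exact: cmeasurable_inv_fourier.
Qed.

(** ** Lower bounds by duality *)

(** The test function of frequency [- c] is the conjugate of the one of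
    frequency [c], so this is the hermitian pairing with the latter. *)
Definition pair_ c r (h : V -> R[i]) : R[i] :=
  cint mu (fun x => h x * tf (- c) r 0 x).

Definition lowc : R := @fconst R d * @fconst R d * (wmass ^+ d * wmass ^+ d) * 2 ^+ d.

Lemma lowc_gt0 : 0 < lowc.
Proof.
by rewrite !mulr_gt0 ?fconst_gt0 ?wmassd_gt0// exprn_gt0.
Qed.

Lemma pair_mult l c r psi : 0 < r -> cintegrable mu psi ->
  pair_ c r (mult psi (testf l c r)) =
  cint mu (fun xi => psi xi * (l * (@fconst R d * tfh c r xi) ^+ 2)%:C).
Proof.
move=> r0 psii; rewrite /pair_ /mult -cint_inv_fourier//; last 2 first.
- exact/cintegrable_symbol/cintegrable_testf.
- exact: cintegrable_tf.
apply: eq_cint => xi; rewrite fourier_testf// inv_fourierE.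
rewrite -[X in tf _ _ X](oppr0) ft1_tfN// dot0l cexpi0 mul1r.
by rewrite expr2 !rmorphM/=; ring.
Qed.

(** Summed over a partition of unity, the pairings add up to the square norm
    of the test function, whatever the partition. *)
Lemma pair_sum (I : eqType) (S : seq I) (psi : I -> V -> R[i]) l c r :
  0 <= l -> 0 < r -> (forall i, i \in S -> cintegrable mu (psi i)) ->
  (forall xi, cube c (2 * r) xi -> \sum_(i <- S) psi i xi = 1) ->
  l * lowc * r ^+ d <=
  \sum_(i <- S) cnorm (pair_ c r (mult (psi i) (testf l c r))).
Proof.
move=> l0 r0 psii psi1.
pose G (xi : V) : R := l * (@fconst R d * tfh c r xi) ^+ 2.
have mG : measurable_fun setT G.
  apply: measurable_funM => //; apply: measurable_funX; apply: measurable_funM => //.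
  exact: measurable_tfh.
have G0 xi : 0 <= G xi by rewrite mulr_ge0// sqr_ge0.
have GM xi : cnorm (G xi)%:C <= l * (@fconst R d * wmass ^+ d) ^+ 2.
  rewrite cnorm_real ger0_norm// ler_wpM2l// lerXn2r// ?nnegrE.
  - by rewrite mulr_ge0 ?tfh_ge0// ltW// fconst_gt0.
  - by rewrite mulr_ge0 ?(ltW wmassd_gt0)// ltW// fconst_gt0.
  - by rewrite ler_wpM2l ?tfh_le// ltW// fconst_gt0.
have pGi i : i \in S -> cintegrable mu (fun xi => psi i xi * (G xi)%:C).
  move=> iS; apply: (@cintegrable_bounded _ _ _ mu
    (l * (@fconst R d * wmass ^+ d) ^+ 2)) => //.
  exact: psii.
have sumE : cintegrable mu (fun xi => (\sum_(i <- S) psi i xi) * (G xi)%:C) /\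
    cint mu (fun xi => (\sum_(i <- S) psi i xi) * (G xi)%:C) =
    \sum_(i <- S) cint mu (fun xi => psi i xi * (G xi)%:C).
  move: pGi; clear; elim: S => [|i S IH] pGi.
    rewrite big_nil (_ : (fun _ => _) = fun=> 0); last first.
      by apply/funext => xi; rewrite big_nil mul0r.
    split; last exact: cint0.
    split; first exact: cmeasurable_cst.
    under eq_integral do rewrite cnorm0.
    by rewrite integral0 ltry.
  have [|IH1 IH2] := IH; first by move=> j jS; apply: pGi; rewrite inE jS orbT.
  have pi := pGi i (mem_head _ _).
  rewrite (_ : (fun xi => _) = (fun xi => psi i xi * (G xi)%:C +
      (\sum_(i <- S) psi i xi) * (G xi)%:C)); last first.
    by apply/funext => xi; rewrite big_cons mulrDl.
  split; first exact: cintegrableD.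
  by rewrite cintD// big_cons IH2.
have eqG : (fun xi => (\sum_(i <- S) psi i xi) * (G xi)%:C) = (fun xi => (G xi)%:C).
  apply/funext => xi; have [cx|] := pselect (cube c (2 * r) xi).
    by rewrite psi1// mul1r.
  move=> /existsNP[i /negP]; rewrite -ltNge => hi.
  by rewrite /G tfh0//; [rewrite mulr0 expr0n mulr0 mulr0|exists i; exact: ltW].
rewrite eqG in sumE.
have -> : \sum_(i <- S) cnorm (pair_ c r (mult (psi i) (testf l c r))) =
    \sum_(i <- S) cnorm (cint mu (fun xi => psi i xi * (G xi)%:C)).
  by apply: eq_big_seq => i iS; rewrite pair_mult//; exact: psii.
apply: (@le_trans _ _ (cnorm (\sum_(i <- S) cint mu (fun xi => psi i xi * (G xi)%:C)))).
  rewrite -sumE.2 cint_real cnorm_real ger0_norm; last exact: Rintegral_ge0.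
  have iG : mu.-integrable setT (EFin \o G).
    by have := cintegrable_Re sumE.1.
  rewrite -lee_fin /Rintegral fineK; last exact: integrable_fin_num iG.
  have mC : measurable (cube c r).
    rewrite (_ : cube c r = [set x | forall i, `[c 0 i - r, c 0 i + r]%classic (x 0 i)]).
      by apply: (measurable_box (A := fun i => `[c 0 i - r, c 0 i + r]%classic)).
    by apply/seteqP; split => x h i; have := h i; rewrite /= in_itv/= ler_distl.
  apply: (@le_trans _ _ (\int[mu]_(xi in cube c r) (G xi)%:E)%E); last first.
    apply: ge0_subset_integral => //; first by apply/measurable_EFinP.
    by move=> xi _; rewrite lee_fin.
  apply: (@le_trans _ _ (\int[mu]_(xi in cube c r)
      (l * (@fconst R d * wmass ^+ d) ^+ 2)%:E)%E).
    rewrite integral_cst// [X in (_ * X)%E](_ : _ = ((2 * r) ^+ d)%:E); last first.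
      exact: (leb_cube c (ltW r0)).
    by rewrite -EFinM lee_fin /lowc !exprMn; apply: le_of_eq; ring.
  apply: ge0_le_integral => //.
  - by move=> xi _; rewrite lee_fin mulr_ge0// sqr_ge0.
  - by apply: measurable_funTS; exact/measurable_EFinP.
  - by move=> xi cx; rewrite lee_fin /G tfh1.
elim: S {psii psi1 pGi sumE eqG} => [|i S IH]; first by rewrite !big_nil cnorm0.
by rewrite !big_cons (le_trans (cnormD _ _))// lerD2l.
Qed.

Definition pairc : R := 2 * 20 ^+ d.

Lemma pairc_gt0 : 0 < pairc.
Proof. by rewrite mulr_gt0// exprn_gt0. Qed.

Lemma pair_le (h : V -> R[i]) c r p : 0 < r -> (1 <= p)%E -> cintegrable mu h ->
  ((cnorm (pair_ c r h))%:E <= Lpnorm p h *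
    (pairc * ((r ^+ d) `^ recip p * mass `^ (1 - recip p)))%:E)%E.
Proof.
move=> r0 p1 hi.
have gmi : cintegrable mu (fun y => h y * tf (- c) r 0 y).
  apply: (@cintegrable_bounded _ _ _ mu (20 ^+ d * r ^+ d)) => //.
    exact: cmeasurable_tf.
  move=> y; apply: (le_trans (cnorm_tf _ _ y (ltW r0))).
  by rewrite ler_wpM2l ?exprn_ge0// maj_le// ltW.
have mmaj := @measurable_maj R d r.
have mh : measurable_fun setT (fun y => cnorm (h y)).
  by apply: cmeasurable_cnorm; case: hi.
apply: (le_trans (le_cnorm_cintE gmi)).
rewrite /pairc -mulrA EFinM muleCA lee_wpmul2l ?lee_fin//.
rewrite EFinM muleCA.
apply: (@le_trans _ _ ((20 ^+ d)%:E * \int[mu]_y (cnorm (h y) * maj r y)%:E)%E).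
  rewrite -ge0_integralZl ?lee_fin ?exprn_ge0//; last 2 first.
  - by apply/measurable_EFinP; exact: measurable_funM.
  - by move=> y _; rewrite lee_fin mulr_ge0 ?cnorm_ge0 ?maj_ge0// ltW.
  apply: ge0_le_integral => //.
  - by move=> y _; rewrite lee_fin cnorm_ge0.
  - by apply/measurable_EFinP; apply: cmeasurable_cnorm; case: gmi.
  - by apply: emeasurable_funM => //; apply/measurable_EFinP; exact: measurable_funM.
  - move=> y _; rewrite -EFinM lee_fin cnormM mulrCA ler_wpM2l ?cnorm_ge0//.
    by have := cnorm_tf (- c) 0 y (ltW r0); rewrite addr0.
rewrite lee_wpmul2l ?lee_fin ?exprn_ge0// LpnormE.
apply: hoelder_bounded => //.
- exact: mass_gt0.
- exact: exprn_gt0.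
- by move=> y; rewrite maj_ge0 ?maj_le// ltW.
- by have := maj_mass 0 r0; under eq_integral do rewrite addr0.
- by case: hi.
Qed.

Lemma pair_le_sup (h : V -> R[i]) c r (M : R) : 0 < r -> cintegrable mu h ->
  (forall x, cnorm (h x) <= M) -> cnorm (pair_ c r h) <= pairc * mass * M.
Proof.
move=> r0 hi hM.
have p1 : (1 <= +oo :> \bar R)%E by rewrite leey.
have M0 : 0 <= M by apply: le_trans (hM 0); exact: cnorm_ge0.
have := pair_le c r0 p1 hi; rewrite recip_pinfty powRr0 mul1r subr0.
rewrite powRr1 ?(ltW mass_gt0)// => h1; rewrite -lee_fin; apply: (le_trans h1).
rewrite muleC [(_ * M)%:E]EFinM.
rewrite lee_wpmul2l ?lee_fin ?mulr_ge0 ?(ltW mass_gt0) ?(ltW pairc_gt0)//.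
rewrite LpnormE unlock; case: ifPn => _; last by rewrite lee_fin.
by apply/ess_supP/nearW => x /=; rewrite lee_fin ger0_norm ?cnorm_ge0.
Qed.

End pieces.

(** * Geometry of the coverings *)

Section geometry.
Context {R : realType} {d : nat}.
Hypothesis d_gt0 : (0 < d)%N.
Local Notation V := 'rV[R]_d.
Local Notation outer := (@lebesgue_outer R d).
Implicit Types (Q E : set V) (QQ : set (set V)) (c x y : V).

Lemma le_enorm x : enorm x <= \sum_(i < d) `|x 0 i|.
Proof.
have s0 : 0 <= \sum_(i < d) `|x 0 i| by exact: sumr_ge0.
rewrite /enorm -(@ler_pXn2r _ 2)// ?nnegrE ?sqrtr_ge0// sqr_sqrtr; last first.
  by apply: sumr_ge0 => i _; rewrite -expr2 sqr_ge0.
rewrite [leRHS]expr2 mulr_suml /dot ler_sum// => i _.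
rewrite -expr2 -real_normK ?num_real// expr2 ler_wpM2l//.
by rewrite (bigD1 i)//= lerDl sumr_ge0.
Qed.

Lemma coord_le_enorm x i : `|x 0 i| <= enorm x.
Proof.
rewrite /enorm -sqrtr_sqr ler_wsqrtr// /dot (bigD1 i)//= expr2 lerDl.
by apply: sumr_ge0 => j _; rewrite -expr2 sqr_ge0.
Qed.

Lemma cube_cball c (r : R) : cube c (r / d%:R) `<=` cball c r.
Proof.
move=> x h; rewrite /cball/= (le_trans (le_enorm _))//.
apply: (@le_trans _ _ (\sum_(i < d) r / d%:R)).
  by apply: ler_sum => i _; have := h i; rewrite !mxE.
rewrite sumr_const card_ord -[_ *+ d]mulr_natr mulfVK//.
by rewrite pnatr_eq0 -lt0n.
Qed.

Lemma cball_cube c (r : R) : cball c r `<=` cube c r.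
Proof.
move=> x h i; have := coord_le_enorm (x - c) i.
by rewrite !mxE => /le_trans; apply.
Qed.

Lemma outer_cube c (r : R) : 0 <= r -> outer (cube c r) = ((2 * r) ^+ d)%:E.
Proof.
move=> r0; rewrite lebesgue_outerE; first exact: leb_cube.
rewrite (_ : cube c r = [set x | forall i, `[c 0 i - r, c 0 i + r]%classic (x 0 i)]).
  by apply: (measurable_box (A := fun i => `[c 0 i - r, c 0 i + r]%classic)).
by apply/seteqP; split => x h i; have := h i; rewrite /= in_itv/= ler_distl.
Qed.

Lemma le_outer Q E : Q `<=` E -> (outer Q <= outer E)%E.
Proof. exact: le_mu_ext. Qed.

Lemma size_card_le (T : choiceType) (A : set T) (n : nat) (S : seq T) :
  (A #<= `I_n)%card -> uniq S -> (forall t, t \in S -> A t) -> (size S <= n)%N.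
Proof.
move=> An uS SA; have fA : finite_set A by apply/finite_set_leP; exists n.
apply: leq_trans (geq_card_fset_set An).
apply: uniq_leq_size => // t tS.
have : t \in fset_set A by rewrite in_fset_set// inE; exact: SA.
by [].
Qed.

(** Members of a family with bounded overlap that lie in a common set are
    counted by measure: removing one member together with those that meet it
    takes away at most [n0] of them and, since the member is Caratheodory
    measurable, its full measure. *)
Lemma count_overlap QQ (n0 : nat) (m0 : R) E (S : seq (set V)) :
  (forall Q, QQ Q -> outer.-caratheodory Q) -> (forall Q, QQ Q -> Q !=set0) ->
  (forall Q, QQ Q -> ([set Q' | QQ Q' /\ Q `&` Q' !=set0] #<= `I_n0)%card) ->
  0 <= m0 -> uniq S ->
  (forall Q, Q \in S -> [/\ QQ Q, Q `<=` E & (m0%:E <= outer Q)%E]) ->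
  (((size S)%:R * m0)%:E <= n0%:R%:E * outer E)%E.
Proof.
move=> cQ nQ ov m00; move: {2}(size S) (leqnn (size S)) => n.
elim: n S E => [|n IH] S E sn uS hS.
  move: sn; rewrite leqn0 size_eq0 => /eqP ->.
  by rewrite mul0r mule_ge0//; exact: mu_ext_ge0.
case: S sn uS hS => [|Q S] sn uS hS.
  by rewrite mul0r mule_ge0//; exact: mu_ext_ge0.
have [QQQ QE Qm] := hS Q (mem_head _ _).
pose meets (Q' : set V) := `[< Q `&` Q' !=set0 >].
pose S2 := [seq Q' <- S | ~~ meets Q'].
have s1 : (size [seq Q' <- Q :: S | meets Q'] <= n0)%N.
  apply: (size_card_le (ov Q QQQ)); first exact: filter_uniq.
  move=> Q'; rewrite mem_filter => /andP[/asboolP mQ' Q'S].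
  by split => //; case: (hS Q' Q'S).
have mQQ : meets Q by apply/asboolP; rewrite setIid; exact: nQ.
have sS : (size (Q :: S) <= n0 + size S2)%N.
  rewrite -(count_predC meets (Q :: S)) leq_add//; first by rewrite -size_filter.
  by rewrite /= mQQ add0n -size_filter.
have sz2 : (size S2 <= n)%N by rewrite size_filter (leq_trans (count_size _ _)).
have uS2 : uniq S2 by apply: filter_uniq; case/andP: uS.
have H2 : (((size S2)%:R * m0)%:E <= n0%:R%:E * outer (E `&` ~` Q))%E.
  apply: IH => // Q'; rewrite mem_filter => /andP[/asboolPn mQ' Q'S].
  have Q'S' : Q' \in Q :: S by rewrite inE Q'S orbT.
  have [QQQ' Q'E Q'm] := hS Q' Q'S'; split => // x Q'x; split; first exact: Q'E.
  by move=> Qx; apply: mQ'; exists x.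
rewrite (cQ Q QQQ E) muleDr ?ge0_adde_def ?inE ?mu_ext_ge0//.
apply: (@le_trans _ _ (n0%:R%:E * m0%:E + ((size S2)%:R * m0)%:E)%E).
  by rewrite -EFinM -EFinD lee_fin -mulrDl ler_wpM2r// -natrD ler_nat.
apply: leeD => //; rewrite lee_wpmul2l//; apply: (le_trans Qm).
by apply: le_outer => x Qx; split => //; exact: QE.
Qed.

Lemma jbracket_gt0 x : 0 < jbracket x.
Proof. exact: lt_le_trans ltr01 (jbracket_ge1 x). Qed.

Lemma coord_le_jbracket x i : `|x 0 i| <= jbracket x.
Proof.
rewrite -(@ler_pXn2r _ 2)// ?nnegrE ?jbracket_ge0// jbracket_sqr.
rewrite real_normK ?num_real// (bigD1 i)//= addrCA lerDl addr_ge0//.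
by apply: sumr_ge0 => j _; exact: sqr_ge0.
Qed.

Lemma jbracket_near (delta : R) x y : (forall i, `|x 0 i - y 0 i| <= delta) ->
  jbracket x <= (1 + d%:R) * jbracket y + d%:R * delta.
Proof.
move=> h; apply: (le_trans (jbracket_le_sum _)).
apply: (@le_trans _ _ (1 + \sum_(i < d) (jbracket y + delta))).
  rewrite lerD2l ler_sum// => i _.
  rewrite -[x 0 i](subrK (y 0 i)) addrC (le_trans (ler_normD _ _))//.
  by rewrite lerD// coord_le_jbracket.
rewrite sumr_const card_ord -[_ *+ d]mulr_natr -subr_ge0.
rewrite (_ : _ - _ = jbracket y - 1); last by ring.
by rewrite subr_ge0 jbracket_ge1.
Qed.

Lemma jbracket_powM (a : R) x :
  jbracket x `^ (a * d%:R) = (jbracket x `^ a) ^+ d.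
Proof. by rewrite powRrM powR_mulrn// powR_ge0. Qed.

Lemma inner_ge (r : R) c Q : cball c r `<=` Q -> (r%:E <= inner_radius Q)%E.
Proof.
by move=> h; apply: ereal_sup_ubound => /=; exists r => //; exists c.
Qed.

(** What the definition of an alpha-covering gives: up to one constant, every
    member is a cube whose side is the power alpha of the bracket. The measure
    bounds the inner radius from above and the outer radius from below, and the
    ratio of the radii gives the two other bounds; as [alpha <= 1], the side is
    at most the bracket, which therefore varies by a bounded factor. *)
Lemma covering_geometry (alpha : R) QQ : 0 <= alpha -> alpha <= 1 ->
  alpha_covering alpha QQ -> (forall Q, QQ Q -> Q !=set0) ->
  exists2 A : R, 1 <= A & forall Q, QQ Q ->
  [/\ forall x, Q x -> exists c (r : R), [/\ cube c r `<=` Q,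
        A^-1 * jbracket x `^ alpha <= r & r <= A * jbracket x `^ alpha],
      forall x, Q x -> exists c, Q `<=` cube c (A * jbracket x `^ alpha),
      forall x, Q x -> (((A^-1 * jbracket x `^ alpha) ^+ d)%:E <= outer Q)%E &
      forall x y, Q x -> Q y -> jbracket x <= A * jbracket y].
Proof.
move=> a0 a1 [_ _ [C C0 hC] [K K1 hK]] nQ.
pose C1 := 1 + C + C^-1; have C11 : 1 <= C1.
  by rewrite /C1 -addrA lerDl addr_ge0// ?invr_ge0 ltW.
have C10 : 0 < C1 by apply: lt_le_trans C11.
have d0 : 0 < d%:R :> R by rewrite ltr0n.
have d1 : 1 <= d%:R :> R by rewrite ler1n.
have K0 : 0 < K by apply: lt_le_trans K1.
have Cup : C <= C1 ^+ d.
  apply: (@le_trans _ _ C1); last by rewrite ler_eXnr.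
  by rewrite /C1 addrAC lerDr addr_ge0// invr_ge0 ltW.
have Clow : (C1^-1) ^+ d <= C^-1.
  apply: (@le_trans _ _ (C1^-1)).
    by rewrite -[leRHS]expr1 ler_wiXn2l ?invr_ge0 ?(ltW C10)// invf_le1.
  rewrite lef_pV2 ?posrE//.
  by rewrite /C1 addrAC lerDr addr_ge0// invr_ge0 ltW.
have mlow Q x : QQ Q -> Q x -> (((C1^-1 * jbracket x `^ alpha) ^+ d)%:E <= outer Q)%E.
  move=> QQQ Qx; have [h _] := hC Q x QQQ Qx; apply: le_trans h.
  by rewrite jbracket_powM exprMn lee_fin ler_wpM2r// exprn_ge0// powR_ge0.
have mup Q x : QQ Q -> Q x -> (outer Q <= ((C1 * jbracket x `^ alpha) ^+ d)%:E)%E.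
  move=> QQQ Qx; have [_ h] := hC Q x QQQ Qx; apply: (le_trans h).
  by rewrite jbracket_powM exprMn lee_fin ler_wpM2r// exprn_ge0// powR_ge0.
have jp x : 0 < jbracket x `^ alpha by rewrite powR_gt0// jbracket_gt0.
have rup Q x c (r : R) : QQ Q -> Q x -> cball c r `<=` Q ->
    r <= d%:R * C1 * jbracket x `^ alpha.
  move=> QQQ Qx cQ; have [r0|r0] := leP 0 r; last first.
    by rewrite (le_trans (ltW r0))// !mulr_ge0 ?(ltW C10)// ltW.
  have rd0 : 0 <= r / d%:R by rewrite divr_ge0.
  have : (((2 * (r / d%:R)) ^+ d)%:E <= ((C1 * jbracket x `^ alpha) ^+ d)%:E)%E.
    rewrite -(outer_cube c rd0); apply: le_trans (mup Q x QQQ Qx).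
    by apply: le_outer; apply: subset_trans cQ; exact: cube_cball.
  rewrite lee_fin ler_pXn2r ?nnegrE ?mulr_ge0 ?(ltW C10) ?(ltW (jp x))// => h.
  rewrite -mulrA mulrC -ler_pdivrMr//; apply: le_trans h.
  by rewrite ler_peMl// ler1n.
have Rlow Q x c (r : R) : QQ Q -> Q x -> Q `<=` cball c r ->
    C1^-1 * jbracket x `^ alpha <= 2 * r.
  move=> QQQ Qx cQ; have r0 : 0 <= r.
    by apply: le_trans (cQ x Qx); exact: sqrtr_ge0.
  have : (((C1^-1 * jbracket x `^ alpha) ^+ d)%:E <= ((2 * r) ^+ d)%:E)%E.
    rewrite -(outer_cube c r0); apply: (le_trans (mlow Q x QQQ Qx)).
    by apply: le_outer; apply: subset_trans cQ _; exact: cball_cube.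
  by rewrite lee_fin ler_pXn2r ?nnegrE ?mulr_ge0 ?invr_ge0 ?(ltW C10) ?(ltW (jp x)).
pose A0 := 8 * C1 * K * d%:R.
have A0C1 : C1 <= A0.
  rewrite /A0 -!mulrA mulrCA ler_peMr ?(ltW C10)//.
  have : 1 <= K * d%:R by rewrite mulr_ege1.
  lra.
have A01 : 1 <= A0 by exact: le_trans C11 A0C1.
have A00 : 0 < A0 by apply: lt_le_trans A01.
have key Q x : QQ Q -> Q x -> exists c (r : R) c', [/\ cube c r `<=` Q,
    A0^-1 * jbracket x `^ alpha <= r, r <= C1 * jbracket x `^ alpha &
    Q `<=` cube c' (A0 * r)].
  move=> QQQ Qx; set io := inner_radius Q; set oo := outer_radius Q.
  have io0 : (0 <= io)%E.
    apply: (@inner_ge 0 x) => y; rewrite /cball/= => h.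
    suff -> : y = x by [].
    apply/eqP; rewrite -subr_eq0; apply/eqP/rowP => i; rewrite [RHS]mxE.
    by apply/eqP; rewrite -normr_le0 (le_trans (coord_le_enorm _ _)).
  have ioU : (io <= (d%:R * C1 * jbracket x `^ alpha)%:E)%E.
    apply: ge_ereal_sup => _ [r [c cQ] <-]; rewrite lee_fin; exact: rup cQ.
  have ooL : ((2^-1 * (C1^-1 * jbracket x `^ alpha))%:E <= oo)%E.
    apply: le_ereal_inf_tmp => _ [r [c cQ] <-]; rewrite lee_fin ler_pdivrMl//.
    exact: Rlow cQ.
  have L0 : 0 < 2^-1 * (C1^-1 * jbracket x `^ alpha).
    by rewrite !mulr_gt0 ?invr_gt0.
  have oo0 : (0 < oo)%E by apply: lt_le_trans ooL; rewrite lte_fin.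
  have := hK Q QQQ; rewrite -/io -/oo.
  have iofin : io \is a fin_num.
    by rewrite ge0_fin_numE// (le_lt_trans ioU)// ltry.
  have ioE : io = (fine io)%:E by rewrite fineK.
  have [i0|i0] := eqVneq (fine io) 0.
    rewrite ioE i0 inver eqxx.
    by rewrite gt0_muley// leye_eq.
  have i00 : 0 < fine io by rewrite lt_neqAle eq_sym i0/= fine_ge0.
  rewrite ioE inver (negbTE i0) lee_pdivrMr// -EFinM => ooK.
  have oofin : oo \is a fin_num.
    by rewrite ge0_fin_numE ?(ltW oo0)// (le_lt_trans ooK)// ltry.
  have ooE : oo = (fine oo)%:E by rewrite fineK.
  have f0 : 0 < fine oo by rewrite fine_gt0// oo0/= (le_lt_trans ooK)// ltry.
  have [|_ [r [c cQ] <-]] := @ub_ereal_sup_adherent _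
    [set r%:E | r in [set r : R | exists c, cball c r `<=` Q]] (fine io / 2) _ iofin.
    by rewrite divr_gt0.
  rewrite -[ereal_sup _]/io ioE -EFinD lte_fin => ri.
  have [|_ [r' [c' cQ'] <-]] := @lb_ereal_inf_adherent _
    [set r%:E | r in [set r : R | exists c, Q `<=` cball c r]] (fine oo) _ oofin.
    by [].
  rewrite -[ereal_inf _]/oo ooE -EFinD lte_fin => ro.
  rewrite ooE lee_fin in ooK.
  have rr : fine io <= 2 * r by lra.
  have r'r : r' <= 4 * K * r by nra.
  exists c, (r / d%:R), c'; split.
  - exact: subset_trans (@cube_cball c r) cQ.
  - have h1 := Rlow Q x c' r' QQQ Qx cQ'.
    have h2 : jbracket x `^ alpha <= C1 * (8 * K * r).
      by rewrite -ler_pdivrMl//; apply: (le_trans h1); nra.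
    rewrite ler_pdivrMl// /A0; apply: (le_trans h2); apply: le_of_eq; field.
    exact: lt0r_neq0.
  - have := rup Q x c r QQQ Qx cQ; rewrite -mulrA mulrC -ler_pdivrMr//.
  - apply: (subset_trans cQ'); apply: (subset_trans (@cball_cube c' r')) => y hy i.
    apply: (le_trans (hy i)); apply: (le_trans r'r).
    rewrite /A0 (_ : 8 * C1 * K * d%:R * (r / d%:R) = C1 * 2 * (4 * K * r)); last first.
      by field; exact: lt0r_neq0.
    by rewrite ler_peMl ?mulr_ge0 ?(ltW K0)//; lra.
pose A1 := A0 * A0.
have A1A0 : A0 <= A1 by rewrite ler_peMl// ltW.
pose A := A1 * (1 + d%:R + d%:R * 2).
have AA1 : A1 <= A.
  by rewrite ler_peMr ?(le_trans (ltW A00))//; lra.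
have AA0 : A0 <= A by exact: le_trans AA1.
have A1' : 1 <= A by exact: le_trans AA0.
have Apos : 0 < A by apply: lt_le_trans A1'.
have iA : A^-1 <= A0^-1 by rewrite lef_pV2.
have cubeS c (r r' : R) : r <= r' -> cube c r `<=` cube c r'.
  by move=> rr' x hx i; exact: le_trans (hx i) rr'.
exists A => // Q QQQ; split.
- move=> x Qx; have [c [r [c' [h1 h2 h3 h4]]]] := key Q x QQQ Qx.
  exists c, r; split => //.
    by apply: le_trans h2; rewrite ler_wpM2r// ltW.
  by apply: (le_trans h3); rewrite ler_wpM2r ?(ltW (jp x))// (le_trans A0C1).
- move=> x Qx; have [c [r [c' [h1 h2 h3 h4]]]] := key Q x QQQ Qx.
  exists c'; apply: (subset_trans h4); apply: cubeS.
  apply: (@le_trans _ _ (A1 * jbracket x `^ alpha)); last first.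
    by rewrite ler_wpM2r ?(ltW (jp x)).
  rewrite /A1 -mulrA ler_wpM2l ?(ltW A00)//; apply: (le_trans h3).
  by rewrite ler_wpM2r ?(ltW (jp x)).
- move=> x Qx; apply: le_trans (mlow Q x QQQ Qx).
  rewrite lee_fin ler_pXn2r ?nnegrE ?mulr_ge0 ?invr_ge0 ?(ltW Apos) ?(ltW C10) ?(ltW (jp x))//.
  by rewrite ler_wpM2r ?(ltW (jp x))// lef_pV2 ?posrE// (le_trans A0C1).
- move=> x y Qx Qy; have [c [r [c' [h1 h2 h3 h4]]]] := key Q y QQQ Qy.
  have jy : jbracket y `^ alpha <= jbracket y.
    rewrite -[leRHS]powRr1 ?jbracket_ge0//; apply: ler_powR => //.
    exact: jbracket_ge1.
  have rA : A0 * r <= A1 * jbracket y.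
    rewrite /A1 -mulrA ler_wpM2l ?(ltW A00)//; apply: (le_trans h3).
    apply: ler_pM; [exact: ltW|exact: powR_ge0|exact: A0C1|exact: jy].
  have := @jbracket_near (2 * (A1 * jbracket y)) x y.
  have dxy i : `|x 0 i - y 0 i| <= 2 * (A1 * jbracket y).
    have := h4 x Qx i; have := h4 y Qy i => hy hx.
    rewrite -[x 0 i](subrK (c' 0 i)) -addrA (le_trans (ler_normD _ _))//.
    by rewrite [X in _ + X]distrC mulrDl mul1r lerD//; [exact: le_trans hx rA|
      exact: le_trans hy rA].
  move=> /(_ dxy) /le_trans; apply; rewrite /A.
  have A11 : 1 <= A1 by exact: le_trans A1A0.
  have jy1 := jbracket_ge0 y.
  have : (1 + d%:R) * jbracket y <= A1 * (1 + d%:R) * jbracket y.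
    by rewrite ler_wpM2r// ler_peMl// addr_ge0.
  lra.
Qed.

End geometry.

(** * Upper and lower bounds for modulation norms *)

Section powers.
Context {R : realType}.

Lemma powR_gt0_id (x y : R) : 0 < x -> x `^ y * x `^ (- y) = 1.
Proof.
by move=> x0; rewrite -powRD ?subrr ?powRr0// lt0r_neq0// implybT.
Qed.

(** Comparable numbers have comparable powers, whatever the sign of the
    exponent. *)
Lemma powR_comparable (B a b s : R) : 1 <= B -> 0 < a -> 0 < b ->
  a <= B * b -> b <= B * a -> a `^ s <= B `^ `|s| * b `^ s.
Proof.
move=> B1 a0 b0 ab ba; have B0 : 0 < B by apply: lt_le_trans B1.
have [s0|s0] := leP 0 s.
  rewrite ger0_norm// -powRM ?(ltW B0) ?(ltW b0)//.
  by rewrite ge0_ler_powR ?nnegrE ?mulr_ge0 ?(ltW a0) ?(ltW B0) ?(ltW b0).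
rewrite ltr0_norm//.
have -> : a `^ s = (a `^ (- s))^-1 by rewrite powRN invrK.
have -> : b `^ s = (b `^ (- s))^-1 by rewrite powRN invrK.
have ap : 0 < a `^ (- s) by rewrite powR_gt0.
have bp : 0 < b `^ (- s) by rewrite powR_gt0.
rewrite ler_pdivlMr// mulrC ler_pdivrMr//.
rewrite -powRM ?(ltW B0) ?(ltW a0)//.
rewrite ge0_ler_powR ?nnegrE ?mulr_ge0 ?(ltW a0) ?(ltW B0) ?(ltW b0)//.
by rewrite oppr_ge0 ltW.
Qed.

(** A discrete Hoelder inequality: each term is at most [tau], or is dominated
    by its power. *)
Lemma sum_le_power (T : eqType) (S : seq T) (b : T -> R) (r n NN : R) :
  1 <= r -> 1 <= n -> 0 < NN -> (size S)%:R <= n ->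
  (forall t, t \in S -> 0 <= b t) ->
  \sum_(t <- S) b t `^ r <= NN `^ r ->
  \sum_(t <- S) b t <= 2 * n `^ (1 - r^-1) * NN.
Proof.
move=> r1 n1 N0 Sn b0 hb; have r0 : 0 < r by apply: lt_le_trans r1.
have n0 : 0 < n by apply: lt_le_trans n1.
(* the threshold at which the two kinds of terms contribute equally *)
pose tau := NN * n `^ (- r^-1); have t0 : 0 < tau by rewrite mulr_gt0 ?powR_gt0.
have key t : t \in S -> b t <= b t `^ r * tau `^ (1 - r) + tau.
  move=> tS; have bt := b0 t tS; have [bl|bl] := leP (b t) tau.
    by rewrite (le_trans bl)// lerDr mulr_ge0 ?powR_ge0.
  have bt0 : 0 < b t by apply: lt_trans bl.
  rewrite (@le_trans _ _ (b t `^ r * tau `^ (1 - r)))// ?lerDl ?(ltW t0)//.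
  rewrite -(@mulr_powRB1 _ (b t) r) ?(ltW bt0)// -mulrA ler_peMr ?(ltW bt0)//.
  rewrite -[leLHS](@powR_gt0_id tau (r - 1))// opprB ler_wpM2r ?powR_ge0//.
  by rewrite ge0_ler_powR ?subr_ge0 ?nnegrE ?(ltW t0) ?(ltW bt0)// ltW.
have h1 : \sum_(t <- S) b t <= \sum_(t <- S) (b t `^ r * tau `^ (1 - r) + tau).
  by rewrite big_seq [leRHS]big_seq; apply: ler_sum.
apply: (le_trans h1); rewrite big_split/= -mulr_suml big_const_seq count_predT.
rewrite iter_addr addr0 -[tau *+ _]mulr_natr.
have h2 : (\sum_(t <- S) b t `^ r) * tau `^ (1 - r) <= NN `^ r * tau `^ (1 - r).
  by rewrite ler_wpM2r ?powR_ge0.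
have h3 : tau * (size S)%:R <= tau * n by rewrite ler_wpM2l// ltW.
apply: (le_trans (lerD h2 h3)).
have -> : NN `^ r * tau `^ (1 - r) = NN * n `^ (1 - r^-1).
  rewrite /tau powRM ?powR_ge0 ?(ltW N0)// mulrA -powRD; last first.
    by rewrite lt0r_neq0// implybT.
  rewrite addrCA subrr addr0 powRr1 ?(ltW N0)// -powRrM; congr (_ * _ `^ _).
  by rewrite mulrBr mulr1 mulNr mulVf ?lt0r_neq0// opprK addrC.
have -> : tau * n = NN * n `^ (1 - r^-1).
  rewrite /tau -mulrA; congr (_ * _).
  rewrite -[X in _ * X]powRr1 ?(ltW n0)// -powRD 1?addrC//.
  by rewrite lt0r_neq0// implybT.
apply: le_of_eq; ring.
Qed.

End powers.

Section modnorm.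
Context {R : realType} {d : nat}.
Local Notation V := 'rV[R]_d.
Local Notation mu := (leb R d).
Context (alpha : R) (D : @modulation_data R d alpha) (p q : \bar R) (s : R).
Hypotheses (p1 : (1 <= p)%E) (q1 : (1 <= q)%E).
Local Notation QQ := (md_cover D).
Local Notation psi := (md_bapu D).
Implicit Types (f : V -> R[i]).

Definition piece (T : (V -> R[i]) -> R[i]) (Q : set V) : \bar R :=
  dist_Lpnorm p (fourier_multiplier (psi Q) T).

Lemma piece_ge0 T Q : (0 <= piece T Q)%E.
Proof.
by apply: le_ereal_inf_tmp => _ [g _ <-]; rewrite LpnormE Lnorm_ge0.
Qed.

Lemma mod_norm_upper T (M W n : R) : 0 <= M -> 0 <= W -> 1 <= n ->
  (forall Q, QQ Q -> piece T Q <= M%:E)%E ->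
  (forall Q, QQ Q -> piece T Q != 0%E -> jbracket (md_point D Q) `^ s <= W) ->
  (forall S, uniq S -> (forall Q, Q \in S -> QQ Q /\ piece T Q != 0%E) ->
    (size S)%:R <= n) ->
  (modulation_norm D p q s T <= (W * M * n `^ recip q)%:E)%E.
Proof.
move=> M0 W0 n1 TM TW Tn; have n0 : 0 < n by apply: lt_le_trans n1.
have step Q : QQ Q -> ((jbracket (md_point D Q) `^ s)%:E * piece T Q <= (W * M)%:E)%E.
  move=> QQQ; have [->|Q0] := eqVneq (piece T Q) 0%E.
    by rewrite mule0 lee_fin mulr_ge0.
  rewrite EFinM lee_pmul ?lee_fin ?powR_ge0 ?piece_ge0//; first exact: TW.
  exact: TM.
rewrite /modulation_norm; case: q q1 => [r| |//]; last first.
  move=> _; rewrite recip_pinfty powRr0 mulr1.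
  by apply: ge_ereal_sup => _ [Q QQQ <-]; exact: step.
rewrite lee_fin => r1; have r0 : 0 < r by apply: lt_le_trans r1.
rewrite recip_fin ?lt0r_neq0//.
set E := (\esum_(_ in _) _)%E.
have EE : (E <= (n * (W * M) `^ r)%:E)%E.
  apply: ge_ereal_sup => _ [A [fA AQQ] <-].
  rewrite fsbig_finite//=.
  pose nz (Q : set V) := piece T Q != 0%E.
  rewrite (bigID nz)/= [X in (_ + X)%E]big1 ?adde0; last first.
    move=> Q; rewrite /nz negbK => /eqP h.
    by rewrite -[dist_Lpnorm _ _]/(piece T Q) h poweR0r ?mule0// lt0r_neq0.
  rewrite -big_filter; set S := [seq Q <- _ | _].
  have uS : uniq S by apply: filter_uniq; exact: finmap.fset_uniq.
  have SP Q : Q \in S -> QQ Q /\ nz Q.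
    rewrite mem_filter => /andP[nQ]; rewrite in_fset_set// inE => AQ.
    by split => //; exact: AQQ.
  apply: (@le_trans _ _ (\sum_(Q <- S) ((W * M) `^ r)%:E)%E).
    rewrite big_seq [leRHS]big_seq; apply: lee_sum => Q QS.
    have [QQQ _] := SP Q QS.
    rewrite -[dist_Lpnorm _ _]/(piece T Q).
    rewrite (_ : jbracket _ `^ (r * s) = (jbracket (md_point D Q) `^ s) `^ r).
      rewrite -!poweR_EFin -poweRM ?lee_fin ?powR_ge0 ?piece_ge0//.
      apply: gt0_ler_poweR; rewrite ?(ltW r0)// ?step// in_itv/= leey andbT.
        by rewrite mule_ge0 ?lee_fin ?powR_ge0 ?piece_ge0.
      by rewrite lee_fin mulr_ge0.
    by rewrite -powRrM mulrC.
  rewrite sumEFin lee_fin big_const_seq count_predT iter_addr addr0.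
  by rewrite -mulr_natl ler_wpM2r ?powR_ge0// Tn.
have E0 : (0 <= E)%E.
  by apply: esum_ge0 => Q _; rewrite mule_ge0 ?lee_fin ?powR_ge0// poweR_ge0.
apply: (@le_trans _ _ ((n * (W * M) `^ r)%:E `^ r^-1)%E).
  apply: gt0_ler_poweR; rewrite ?invr_ge0 ?(ltW r0)// in_itv/= leey andbT//.
  by rewrite lee_fin mulr_ge0 ?powR_ge0// ltW.
rewrite poweR_EFin lee_fin powRM ?powR_ge0 ?(ltW n0)// -powRrM mulfV ?lt0r_neq0//.
by rewrite powRr1 ?mulr_ge0// mulrC.
Qed.

Lemma mod_norm_lower T (S : seq (set V)) (b : set V -> R) (w n NN : R) :
  0 <= w -> 1 <= n -> 0 < NN -> uniq S -> (size S)%:R <= n ->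
  (forall Q, Q \in S -> [/\ QQ Q, w <= jbracket (md_point D Q) `^ s &
    piece T Q = (b Q)%:E]) ->
  (modulation_norm D p q s T <= NN%:E)%E ->
  w * \sum_(Q <- S) b Q <= 2 * n `^ (1 - recip q) * NN.
Proof.
move=> w0 n1 N0 uS Sn hS; have n0 : 0 < n by apply: lt_le_trans n1.
have b0 Q : Q \in S -> 0 <= b Q.
  by move=> QS; have [_ _ E] := hS Q QS; rewrite -lee_fin -E piece_ge0.
rewrite /modulation_norm mulr_sumr; case: q q1 => [r| |//]; last first.
  move=> _ hN; rewrite recip_pinfty subr0 powRr1 ?(ltW n0)//.
  apply: (@le_trans _ _ (\sum_(Q <- S) NN)).
    rewrite big_seq [leRHS]big_seq; apply: ler_sum => Q QS.
    have [QQQ wQ E] := hS Q QS.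
    rewrite -lee_fin; apply: le_trans hN; apply: (@le_trans _ _
      ((jbracket (md_point D Q) `^ s)%:E * piece T Q)%E).
      by rewrite E -EFinM lee_fin ler_wpM2r// b0.
    by apply: ereal_sup_ubound; exists Q.
  rewrite big_const_seq count_predT iter_addr addr0 -[NN *+ _]mulr_natl.
  rewrite ler_wpM2r ?(ltW N0)// (le_trans Sn)// ler_peMl ?(ltW n0)//.
  by rewrite ler1n.
rewrite lee_fin => r1; have r0 : 0 < r by apply: lt_le_trans r1.
set E := (\esum_(_ in _) _)%E => hN.
rewrite recip_fin ?lt0r_neq0//.
apply: sum_le_power => //; first by move=> Q QS; rewrite mulr_ge0 ?b0.
have E0 : (0 <= E)%E.
  by apply: esum_ge0 => Q _; rewrite mule_ge0 ?lee_fin ?powR_ge0// poweR_ge0.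
have EN : (E <= (NN `^ r)%:E)%E.
  have -> : E = ((E `^ r^-1) `^ r)%E by rewrite -poweRrM mulVf ?lt0r_neq0// poweRe1.
  rewrite -poweR_EFin; apply: gt0_ler_poweR; rewrite ?(ltW r0)// in_itv/= leey andbT.
    exact: poweR_ge0.
  by rewrite lee_fin ltW.
rewrite -lee_fin; apply: le_trans EN.
apply: (@le_trans _ _ (\sum_(Q <- S) ((jbracket (md_point D Q) `^ (r * s))%:E *
   piece T Q `^ r))%E).
  rewrite -sumEFin big_seq [leRHS]big_seq; apply: lee_sum => Q QS.
  have [QQQ wQ bE] := hS Q QS.
  rewrite bE poweR_EFin -EFinM lee_fin powRM ?b0// ler_wpM2r ?powR_ge0//.
  rewrite mulrC powRrM ge0_ler_powR ?nnegrE ?(ltW r0)//.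
  exact: powR_ge0.
apply: ereal_sup_ubound => /=; exists [set` S].
  split; first by exact: finite_seq.
  by move=> Q /= QS; case: (hS Q QS).
by rewrite -fsbig_seq.
Qed.

End modnorm.

(** * Constants attached to a covering *)

Section control.
Context {R : realType} {d : nat}.
Hypothesis d_gt0 : (0 < d)%N.
Local Notation V := 'rV[R]_d.
Local Notation mu := (leb R d).
Local Notation outer := (@lebesgue_outer R d).
Context (alpha : R) (D : @modulation_data R d alpha).
Hypotheses (alpha_ge0 : 0 <= alpha) (alpha_le1 : alpha <= 1).
Local Notation QQ := (md_cover D).
Local Notation psi := (md_bapu D).

(** All the uniformity there is in a covering with its partition of unity,
    expressed with a single constant. *)
Record controlled (A : R) : Prop := Controlled {
  ctl_ge1 : 1 <= A ;
  ctl_inner : forall Q x, QQ Q -> Q x -> exists c (r : R), [/\ cube c r `<=` Q,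
    A^-1 * jbracket x `^ alpha <= r & r <= A * jbracket x `^ alpha] ;
  ctl_outer : forall Q x, QQ Q -> Q x ->
    exists c, Q `<=` cube c (A * jbracket x `^ alpha) ;
  ctl_measure : forall Q x, QQ Q -> Q x ->
    (((A^-1 * jbracket x `^ alpha) ^+ d)%:E <= outer Q)%E ;
  ctl_bracket : forall Q x y, QQ Q -> Q x -> Q y ->
    jbracket x <= A * jbracket y ;
  ctl_symbol : forall Q, QQ Q -> cintegrable mu (psi Q) ;
  ctl_kernel : forall Q, QQ Q -> cintegrable mu (fourier (psi Q)) ;
  ctl_kernel_le : forall Q, QQ Q -> \int[mu]_x cnorm (fourier (psi Q) x) <= A ;
  ctl_overlap : forall Q S, QQ Q -> uniq S ->
    (forall Q', Q' \in S -> QQ Q' /\ Q `&` Q' !=set0) -> (size S)%:R <= A ;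
  ctl_finite : forall Q, QQ Q ->
    finite_set [set Q' | QQ Q' /\ Q `&` Q' !=set0] ;
  ctl_count : forall (m0 : R) E S, 0 <= m0 -> uniq S ->
    (forall Q, Q \in S -> [/\ QQ Q, Q `<=` E & (m0%:E <= outer Q)%E]) ->
    (((size S)%:R * m0)%:E <= A%:E * outer E)%E }.

Lemma psi_off Q x : QQ Q -> psi Q x != 0 -> Q x.
Proof.
move=> QQQ nz; have [_ sQ _ _] := md_bapuP D.
by apply: (sQ Q QQQ); exact: subset_closure.
Qed.

Lemma psi_sum (S : seq (set V)) x : uniq S -> (forall Q, Q \in S -> QQ Q) ->
  (forall Q, QQ Q -> Q x -> Q \in S) -> \sum_(Q <- S) psi Q x = 1.
Proof.
move=> uS SQ xS; have [_ _ hs _] := md_bapuP D.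
rewrite -(hs x) (@fsbig_seq _ _ _ _ S)//; apply: fsbig_widen.
  by move=> Q /= QS; exact: SQ.
move=> Q [QQQ /= nS]; apply/eqP; apply: contra_notT nS => nz.
by apply: xS => //; exact: psi_off.
Qed.

Lemma exists_controlled : exists A, controlled A.
Proof.
have nQ Q : QQ Q -> Q !=set0 by move=> h; exists (md_point D Q); exact: md_pointP.
have [[cQQ _ [n0 hn0]] car _ _] := md_coverP D.
have [A0 A01 h0] := covering_geometry d_gt0 alpha_ge0 alpha_le1 (md_coverP D) nQ.
have [Cc sQ _ hK] := md_bapuP D.
have symb Q : QQ Q -> cintegrable mu (psi Q).
  by move=> h; apply: Ccinfty_cintegrable; exact: Cc.
have kern_fin Q : QQ Q -> (Lpnorm 1 (fourier (psi Q)) < +oo)%E.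
  move=> h; apply: le_lt_trans hK; apply: ereal_sup_ubound; by exists Q.
have ker Q : QQ Q -> cintegrable mu (fourier (psi Q)).
  move=> h; apply: cintegrable_Lp1 (kern_fin Q h).
  by apply: cmeasurable_fourier; exact: symb.
set KK := ereal_sup _ in hK.
pose K := fine KK.
have kle Q : QQ Q -> \int[mu]_x cnorm (fourier (psi Q) x) <= K.
  move=> h; rewrite -lee_fin -Lpnorm1E; last exact: ker.
  have hle : (Lpnorm 1 (fourier (psi Q)) <= KK)%E.
    by apply: ereal_sup_ubound; exists Q.
  rewrite fineK// ge0_fin_numE//; apply: le_trans hle.
  by rewrite LpnormE Lnorm_ge0.
pose A := A0 + `|K| + n0%:R.
have A00 : 0 < A0 by apply: lt_le_trans A01.
have AA : A0 <= A by rewrite /A -addrA lerDl addr_ge0.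
have KA : K <= A.
  by rewrite /A addrAC (le_trans (ler_norm _))// lerDr addr_ge0// ltW.
have nA : n0%:R <= A by rewrite /A lerDr addr_ge0// ltW.
have A1 := le_trans A01 AA; have A_0 : 0 < A by apply: lt_le_trans A1.
have jp x : 0 <= jbracket x `^ alpha by exact: powR_ge0.
have AAi : A^-1 <= A0^-1 by rewrite lef_pV2.
exists A; split => //.
- move=> Q x QQQ Qx; have [h _ _ _] := h0 Q QQQ.
  have [c [r [cQ rl ru]]] := h x Qx; exists c, r; split => //.
    by apply: le_trans rl; rewrite ler_wpM2r.
  by apply: (le_trans ru); rewrite ler_wpM2r.
- move=> Q x QQQ Qx; have [_ h _ _] := h0 Q QQQ.
  have [c cQ] := h x Qx; exists c; apply: (subset_trans cQ) => y hy i.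
  by apply: (le_trans (hy i)); rewrite ler_wpM2r.
- move=> Q x QQQ Qx; have [_ _ h _] := h0 Q QQQ.
  apply: le_trans (h x Qx); rewrite lee_fin.
  rewrite lerXn2r ?nnegrE ?mulr_ge0 ?invr_ge0 ?(ltW A_0) ?(ltW A00)//.
  by rewrite ler_wpM2r.
- move=> Q x y QQQ Qx Qy; have [_ _ _ h] := h0 Q QQQ.
  by apply: (le_trans (h x y Qx Qy)); rewrite ler_wpM2r ?jbracket_ge0.
- by move=> Q QQQ; apply: (le_trans (kle Q QQQ)).
- move=> Q S QQQ uS SQ; apply: le_trans nA; rewrite ler_nat.
  exact: (size_card_le (hn0 Q QQQ) uS SQ).
- by move=> Q QQQ; apply/finite_set_leP; exists n0; exact: hn0.
- move=> m0 E S m00 uS hS.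
  apply: (le_trans (count_overlap car nQ hn0 m00 uS hS)).
  by rewrite lee_wpmul2r ?lee_fin//; exact: mu_ext_ge0.
Qed.

End control.

(** * Modulation norms of the test functions *)

Section local.
Context {R : realType} {d : nat}.
Local Notation V := 'rV[R]_d.
Local Notation mu := (leb R d).
Context (alpha : R) (D : @modulation_data R d alpha) (p q : \bar R) (s : R).
Hypotheses (p1 : (1 <= p)%E) (q1 : (1 <= q)%E).
Local Notation QQ := (md_cover D).
Local Notation psi := (md_bapu D).
Context (A : R) (ctl : controlled D A).
Context (c : V) (r B n : R).
Hypotheses (r0 : 0 < r) (B1 : 1 <= B) (n1 : 1 <= n).
Local Notation meets Q := (Q `&` cube c (2 * r) !=set0).
Hypothesis near : forall y, cube c (2 * r) y ->
  jbracket y <= B * jbracket c /\ jbracket c <= B * jbracket y.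
Hypothesis count : forall S, uniq S ->
  (forall Q, Q \in S -> QQ Q /\ meets Q) -> (size S)%:R <= n.
Implicit Types (l : R) (Q : set V).

Lemma piece_testf l Q : QQ Q ->
  piece D p (Tf (testf l c r)) Q = Lpnorm p (mult (psi Q) (testf l c r)).
Proof.
move=> QQQ; rewrite /piece dist_Lpnorm_mult//; last exact: cintegrable_testf.
exact: (ctl_symbol ctl QQQ).
Qed.

Lemma symbol_support l Q xi : QQ Q ->
  psi Q xi * fourier (testf l c r) xi != 0 -> Q xi /\ cube c (2 * r) xi.
Proof.
move=> QQQ nz; split.
  apply: (psi_off QQQ); apply: contraNneq nz => ->; by rewrite mul0r.
move=> i; rewrite leNgt; apply/negP => hi; move/eqP: nz; apply.
rewrite fourier_testf// tfh0 ?mulr0//; by exists i; exact: ltW.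
Qed.

Lemma piece_off l Q : QQ Q -> ~ meets Q -> piece D p (Tf (testf l c r)) Q = 0%E.
Proof.
move=> QQQ nm; rewrite piece_testf//.
have E : mult (psi Q) (testf l c r) = fun=> 0.
  apply/funext => x; rewrite /mult.
  rewrite (_ : (fun xi => _) = (fun=> 0)); last first.
    apply/funext => xi; apply: contra_notP nm => /eqP nz.
    by exists xi; exact: (symbol_support QQQ nz).
  rewrite /inv_fourier.
  rewrite (_ : cintegral _ = 0) ?mulr0//.
  rewrite -[LHS](@eq_cint _ _ _ mu (fun=> 0)) ?cint0// => y.
  by rewrite mul0r.
rewrite E LpnormE.
rewrite (_ : (fun x => _) = cst 0%E); last by apply/funext => x; rewrite cnorm0.
by rewrite Lnorm0// gt_eqF// (lt_le_trans _ p1).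
Qed.

Lemma cintegrable_mult_testf l Q : 0 <= l -> QQ Q ->
  cintegrable mu (mult (psi Q) (testf l c r)).
Proof.
move=> l0 QQQ; have iS := ctl_symbol ctl QQQ.
apply: cintegrable_Lp1.
  by apply: cmeasurable_mult => //; exact: cintegrable_testf.
apply: (le_lt_trans (mult_testf_upper c l0 r0 _ iS _)); rewrite ?ltry//.
exact: (ctl_kernel ctl QQQ).
Qed.

Lemma piece_upper l Q : 0 <= l -> QQ Q ->
  (piece D p (Tf (testf l c r)) Q <= (l * (@convc R d * A *
    ((r ^+ d) `^ (1 - recip p) * @mass R d `^ recip p)))%:E)%E.
Proof.
move=> l0 QQQ; rewrite piece_testf//.
have iS := ctl_symbol ctl QQQ; have iK := ctl_kernel ctl QQQ.
apply: (le_trans (mult_testf_upper c l0 r0 p1 iS iK)).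
have h := ctl_kernel_le ctl QQQ.
have C0 := @convc_gt0 R d; move: (@convc R d) C0 => C C0.
rewrite lee_fin -!mulrA ler_wpM2l// ler_wpM2l ?(ltW C0)//.
by rewrite ler_wpM2r ?mulr_ge0 ?powR_ge0.
Qed.

Lemma near_bracket Q x : QQ Q -> Q x -> meets Q ->
  jbracket x <= A * B * jbracket c /\ jbracket c <= A * B * jbracket x.
Proof.
move=> QQQ Qx [y [Qy cy]]; have [yc cy'] := near cy.
have A0 : 0 <= A by rewrite (le_trans ler01)// (ctl_ge1 ctl).
have B0 : 0 <= B by rewrite (le_trans ler01).
split.
  apply: (le_trans (ctl_bracket ctl QQQ Qx Qy)).
  by rewrite -mulrA ler_wpM2l.
apply: (le_trans cy'); rewrite (mulrC A) -mulrA ler_wpM2l//.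
exact: (ctl_bracket ctl QQQ Qy Qx).
Qed.

Let AB1 : 1 <= A * B.
Proof. by rewrite mulr_ege1// (ctl_ge1 ctl). Qed.

(** The pieces away from the cube vanish, and near the cube all the weights are
    comparable: what matters is the number and the size of the other pieces. *)
Lemma norm_upper l M : 0 <= l -> 0 <= M ->
  (forall Q, QQ Q -> meets Q -> piece D p (Tf (testf l c r)) Q <= (l * M)%:E)%E ->
  (modulation_norm D p q s (Tf (testf l c r)) <=
   (l * ((A * B) `^ `|s| * jbracket c `^ s * M * n `^ recip q))%:E)%E.
Proof.
move=> l0 M0 hM.
have nz Q : QQ Q -> piece D p (Tf (testf l c r)) Q != 0%E -> meets Q.
  by move=> QQQ; apply: contra_neqP => nm; exact: piece_off.
have -> : l * ((A * B) `^ `|s| * jbracket c `^ s * M * n `^ recip q) =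
  (A * B) `^ `|s| * jbracket c `^ s * (l * M) * n `^ recip q by ring.
apply: mod_norm_upper => //; rewrite ?mulr_ge0 ?powR_ge0//.
- move=> Q QQQ; have [m|m] := pselect (meets Q); first exact: hM.
  by rewrite piece_off// lee_fin mulr_ge0.
- move=> Q QQQ /(nz Q QQQ) m.
  have [h1 h2] := near_bracket QQQ (md_pointP QQQ) m.
  by apply: powR_comparable => //; exact: jbracket_gt0.
- by move=> S uS hS; apply: count => // Q QS; have [QQQ h] := hS Q QS; split => //; exact: nz.
Qed.

(** By duality: the pairings of all the pieces add up to the square norm of the
    test function, and a sum of [n] terms is controlled by their [q]-norm. *)
Lemma norm_lower l G NN : 0 <= l -> 0 <= G -> 0 < NN ->
  (forall Q, QQ Q ->
     ((cnorm (pair_ c r (mult (psi Q) (testf l c r))))%:E <=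
      piece D p (Tf (testf l c r)) Q * G%:E)%E) ->
  finite_set [set Q | QQ Q /\ meets Q] ->
  (modulation_norm D p q s (Tf (testf l c r)) <= NN%:E)%E ->
  l * (jbracket c `^ s * (@lowc R d * r ^+ d)) <=
  (A * B) `^ `|s| * (G * (2 * n `^ (1 - recip q))) * NN.
Proof.
move=> l0 G0 N0 hG fin hN.
pose S : seq (set V) := fset_set [set Q | QQ Q /\ meets Q].
have SP Q : Q \in S -> QQ Q /\ meets Q.
  by rewrite in_fset_set// inE.
have PS Q : QQ Q -> meets Q -> Q \in S.
  by move=> h1 h2; rewrite in_fset_set// inE.
have uS : uniq S by exact: finmap.fset_uniq.
pose W := (A * B) `^ `|s|.
have AB0 : 0 < A * B by apply: lt_le_trans AB1.
have W0 : 0 < W by rewrite powR_gt0.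
pose b Q := fine (piece D p (Tf (testf l c r)) Q).
have bE Q : QQ Q -> piece D p (Tf (testf l c r)) Q = (b Q)%:E.
  move=> QQQ; rewrite fineK// ge0_fin_numE ?piece_ge0//.
  by apply: (le_lt_trans (piece_upper l0 QQQ)); rewrite ltry.
have low : W^-1 * jbracket c `^ s * \sum_(Q <- S) b Q <=
    2 * n `^ (1 - recip q) * NN.
  apply: mod_norm_lower hN => //.
  - by rewrite mulr_ge0 ?powR_ge0// invr_ge0 ltW.
  - exact: count.
  - move=> Q /SP[QQQ m]; split; rewrite ?bE//.
    have [h1 h2] := near_bracket QQQ (md_pointP QQQ) m.
    rewrite ler_pdivrMl//.
    by apply: powR_comparable => //; exact: jbracket_gt0.
have ps : l * @lowc R d * r ^+ d <= (\sum_(Q <- S) b Q) * G.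
  apply: (le_trans (@pair_sum R d _ S psi l c r l0 r0 _ _)).
  - by move=> Q /SP[QQQ _]; exact: (ctl_symbol ctl QQQ).
  - move=> xi cxi; apply: psi_sum => // [Q /SP[]//|Q QQQ Qxi].
    by apply: PS => //; exists xi.
  rewrite mulr_suml big_seq [leRHS]big_seq; apply: ler_sum => Q /SP[QQQ _].
  by rewrite -lee_fin EFinM -bE//; exact: hG.
have jc0 : 0 <= jbracket c `^ s by exact: powR_ge0.
have -> : l * (jbracket c `^ s * (@lowc R d * r ^+ d)) =
  jbracket c `^ s * (l * @lowc R d * r ^+ d) by ring.
apply: (le_trans (ler_wpM2l jc0 ps)).
have -> : jbracket c `^ s * ((\sum_(Q <- S) b Q) * G) =
  W * (G * (W^-1 * jbracket c `^ s * \sum_(Q <- S) b Q)).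
  by field; exact: lt0r_neq0.
have -> : W * (G * (2 * n `^ (1 - recip q))) * NN =
  W * (G * (2 * n `^ (1 - recip q) * NN)) by ring.
by rewrite ler_wpM2l ?(ltW W0)// ler_wpM2l.
Qed.

End local.

Lemma ratio_le (R : realFieldType) (A b M x y : R) : 0 < A -> 0 < M -> 0 <= y ->
  x <= b * y -> A * b <= M -> M^-1 * x <= A^-1 * y.
Proof.
move=> A0 M0 y0 xy AM; rewrite ler_pdivrMl// mulrCA ler_pdivlMl// mulrC.
apply: (le_trans (ler_wpM2r (ltW A0) xy)).
by rewrite mulrAC ler_wpM2r// mulrC.
Qed.

Section uniform_bounds.
Context {R : realType} {d : nat}.
Local Notation V := 'rV[R]_d.
Local Notation mu := (leb R d).
Local Notation outer := (@lebesgue_outer R d).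
Context (alpha : R) (D : @modulation_data R d alpha) (p q : \bar R) (s : R).
Hypotheses (p1 : (1 <= p)%E) (q1 : (1 <= q)%E).
Local Notation QQ := (md_cover D).
Local Notation psi := (md_bapu D).
Context (A : R) (ctl : controlled D A).
Implicit Types (l r : R) (c : V) (Q : set V).

Let A1 : 1 <= A. Proof. exact: ctl_ge1 ctl. Qed.
Let A0 : 0 < A. Proof. exact: lt_le_trans ltr01 A1. Qed.

Definition bracket_near (B : R) c r := forall y, cube c (2 * r) y ->
  jbracket y <= B * jbracket c /\ jbracket c <= B * jbracket y.

Lemma cube_center c r : 0 <= r -> cube c r c.
Proof. by move=> r0 i; rewrite subrr normr0. Qed.

Lemma bracket_near_member c r Q : 0 < r -> QQ Q -> cube c (2 * r) `<=` Q ->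
  bracket_near A c r.
Proof.
move=> r0 QQQ cQ y cy; have Qy := cQ y cy.
have Qc : Q c by apply: cQ; apply: cube_center; rewrite mulr_ge0// ltW.
by split; exact: (ctl_bracket ctl QQQ).
Qed.

Lemma count_member c r Q S : QQ Q -> cube c (2 * r) `<=` Q -> uniq S ->
  (forall Q', Q' \in S -> QQ Q' /\ Q' `&` cube c (2 * r) !=set0) ->
  (size S)%:R <= A.
Proof.
move=> QQQ cQ uS hS; apply: (ctl_overlap ctl QQQ uS) => Q' /hS[h [x [Q'x cx]]].
by split => //; exists x; split => //; exact: cQ.
Qed.

(** A test function whose frequencies lie in one member has boundedly many
    pieces, each of them no larger than the whole. *)
Lemma member_upper : exists2 C : R, 0 < C & forall c r Q l, 0 < r -> QQ Q ->
  cube c (2 * r) `<=` Q -> 0 <= l ->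
  (modulation_norm D p q s (Tf (testf l c r)) <=
   (l * (C * (jbracket c `^ s * (r ^+ d) `^ (1 - recip p))))%:E)%E.
Proof.
exists ((A * A) `^ `|s| * (@convc R d * A * (@mass R d) `^ recip p) * A `^ recip q).
  move: (@convc R d) (@convc_gt0 R d) (@mass R d) (@mass_gt0 R d) => C C0 m m0.
  by rewrite !mulr_gt0 ?powR_gt0 ?mulr_gt0.
move=> c r Q l r0 QQQ cQ l0.
have nr := bracket_near_member r0 QQQ cQ.
have ct := fun S => @count_member c r Q S QQQ cQ.
apply: (le_trans (norm_upper s p1 q1 ctl r0 A1 A1 nr ct l0 _
  (fun Q' h _ => piece_upper p1 ctl c r0 l0 h))).
  have C0 := ltW (@convc_gt0 R d); move: (@convc R d) C0 => C C0.
  by rewrite !mulr_ge0 ?powR_ge0 ?(ltW A0).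
move: (@convc R d) => C; rewrite lee_fin; apply: le_of_eq; ring.
Qed.

Lemma member_lower : exists2 C : R, 0 < C & forall c r Q l NN, 0 < r -> QQ Q ->
  cube c (2 * r) `<=` Q -> 0 <= l -> 0 < NN ->
  (modulation_norm D p q s (Tf (testf l c r)) <= NN%:E)%E ->
  l * (jbracket c `^ s * (r ^+ d) `^ (1 - recip p)) <= C * NN.
Proof.
pose G0 := @pairc R d * (@mass R d) `^ (1 - recip p).
have G00 : 0 < G0.
  rewrite /G0; move: (@pairc R d) (@pairc_gt0 R d) (@mass R d) (@mass_gt0 R d).
  by move=> C C0 m m0; rewrite mulr_gt0 ?powR_gt0.
exists ((@lowc R d)^-1 * ((A * A) `^ `|s| * (G0 * (2 * A `^ (1 - recip q))))).
  move: (@lowc R d) (@lowc_gt0 R d) (G0) G00 => L L0 G G_0.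
  by rewrite !mulr_gt0 ?invr_gt0 ?powR_gt0 ?mulr_gt0.
move=> c r Q l NN r0 QQQ cQ l0 N0 hN.
have nr := bracket_near_member r0 QQQ cQ.
have ct := fun S => @count_member c r Q S QQQ cQ.
have rd0 : 0 < r ^+ d by rewrite exprn_gt0.
pose P := (r ^+ d) `^ recip p; have P0 : 0 < P by rewrite powR_gt0.
have Ge : 0 <= G0 * P by rewrite mulr_ge0 ?(ltW G00) ?(ltW P0).
have hG Q' : QQ Q' -> ((cnorm (pair_ c r (mult (psi Q') (testf l c r))))%:E <=
      piece D p (Tf (testf l c r)) Q' * (G0 * P)%:E)%E.
  move=> h; rewrite (piece_testf p1 ctl c r0 l h).
  rewrite (_ : G0 * P = @pairc R d * ((r ^+ d) `^ recip p * @mass R d `^ (1 - recip p))).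
    exact: (pair_le c r0 p1 (cintegrable_mult_testf ctl c r0 l0 h)).
  by rewrite /G0 -mulrA; congr (_ * _); rewrite mulrC.
have fin : finite_set [set Q' | QQ Q' /\ Q' `&` cube c (2 * r) !=set0].
  apply: sub_finite_set (ctl_finite ctl QQQ) => Q' [h [x [Q'x cx]]].
  by split => //; exists x; split => //; exact: cQ.
have := norm_lower p1 q1 ctl r0 A1 A1 nr ct l0 Ge N0 hG fin hN.
set X := (r ^+ d) `^ (1 - recip p).
have -> : r ^+ d = P * X.
  rewrite /P /X -powRD; last by rewrite lt0r_neq0// implybT.
  by rewrite addrC subrK powRr1// ltW.
set L := lowc.
have L0 : 0 < L by exact: lowc_gt0.
have -> : l * (jbracket c `^ s * (L * (P * X))) =
  (l * (jbracket c `^ s * X)) * (L * P) by ring.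
have -> : (A * A) `^ `|s| * (G0 * P * (2 * A `^ (1 - recip q))) * NN =
  (L^-1 * ((A * A) `^ `|s| * (G0 * (2 * A `^ (1 - recip q)))) * NN) * (L * P).
  by field; exact: lt0r_neq0.
by rewrite ler_pM2r// mulr_gt0.
Qed.

Hypotheses (alpha_ge0 : 0 <= alpha) (beta : R) (alpha_le : alpha <= beta).
Context (B H : R) (B1 : 1 <= B) (H0 : 0 <= H).

(* [AB] bounds the side of a member meeting the cube in terms of the centre of
   the cube *)
Context (AB : R) (AB_ge : A * B `^ `|alpha| <= AB).

Let AB_gt0 : 0 < AB.
Proof.
by apply: lt_le_trans AB_ge; rewrite mulr_gt0 ?powR_gt0// (lt_le_trans ltr01 B1).
Qed.

Lemma bracket_near_powR (c : V) r y (a : R) : bracket_near B c r ->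
  cube c (2 * r) y ->
  jbracket y `^ a <= B `^ `|a| * jbracket c `^ a /\
  jbracket c `^ a <= B `^ `|a| * jbracket y `^ a.
Proof.
move=> nr cy; have [h1 h2] := nr y cy.
by split; apply: powR_comparable => //; exact: jbracket_gt0.
Qed.

Lemma member_cube (c : V) r Q : bracket_near B c r -> QQ Q ->
  Q `&` cube c (2 * r) !=set0 ->
  exists c', Q `<=` cube c' (AB * jbracket c `^ alpha).
Proof.
move=> nr QQQ [y [Qy cy]]; have [c' hc'] := ctl_outer ctl QQQ Qy.
exists c' => x Qx i; apply: (le_trans (hc' x Qx i)).
apply: (@le_trans _ _ (A * B `^ `|alpha| * jbracket c `^ alpha)); last first.
  by rewrite ler_wpM2r ?powR_ge0.
have [h _] := bracket_near_powR alpha nr cy.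
by rewrite -mulrA ler_wpM2l ?(ltW A0).
Qed.

(** The members meeting the cube are essentially disjoint parts of a larger
    cube, so their number is at most a ratio of volumes. *)
Lemma count_cube : exists2 K : R, 1 <= K & forall c r S, 0 < r ->
  bracket_near B c r -> r <= H * jbracket c `^ beta -> uniq S ->
  (forall Q, Q \in S -> QQ Q /\ Q `&` cube c (2 * r) !=set0) ->
  (size S)%:R <= K * (jbracket c `^ (beta - alpha)) ^+ d.
Proof.
pose G := 2 * AB + 2 * H.
have G0 : 0 < G by rewrite /G ltr_pwDl ?mulr_ge0// mulr_gt0.
pose K := A * (2 * G * AB) ^+ d.
have K0 : 0 < K by rewrite /K mulr_gt0// exprn_gt0// !mulr_gt0.
exists (1 + K); first by rewrite lerDl ltW.
move=> c r S r0 nr rH uS hS.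
pose ja := jbracket c `^ alpha; pose jd := jbracket c `^ (beta - alpha).
have ja0 : 0 < ja by rewrite powR_gt0// jbracket_gt0.
have jd1 : 1 <= jd.
  by rewrite -(powRr0 (jbracket c)) ler_powR ?jbracket_ge1// subr_ge0.
have jd0 : 0 < jd by apply: lt_le_trans jd1.
have jb : jbracket c `^ beta = ja * jd.
  rewrite /ja /jd -powRD ?(lt0r_neq0 (jbracket_gt0 c)) ?implybT//.
  by rewrite addrCA subrr addr0.
have ABi0 : 0 < AB^-1 * ja by rewrite mulr_gt0 ?invr_gt0.
have E Q : Q \in S -> [/\ QQ Q, Q `<=` cube c (G * (ja * jd)) &
    (((AB^-1 * ja) ^+ d)%:E <= outer Q)%E].
  move=> /hS[QQQ m]; split => //.
    have [c' hc'] := member_cube nr QQQ m.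
    case: m => y [Qy cy] x Qx i.
    have h1 := hc' x Qx i; have h2 := hc' y Qy i; have h3 := cy i.
    have -> : x 0 i - c 0 i =
      (x 0 i - c' 0 i) + (c' 0 i - y 0 i) + (y 0 i - c 0 i) by ring.
    apply: (le_trans (ler_normD _ _)).
    apply: (le_trans (lerD (ler_normD _ _) (lexx _))).
    rewrite (distrC (c' 0 i)).
    apply: (le_trans (lerD (lerD h1 h2) h3)).
    rewrite -/ja.
    have -> : G * (ja * jd) = 2 * AB * (ja * jd) + 2 * H * (ja * jd).
      by rewrite /G; ring.
    apply: lerD.
      have -> : AB * ja + AB * ja = 2 * AB * ja by ring.
      have AB2 : 0 <= 2 * AB by rewrite mulr_ge0// ltW.
      by rewrite ler_wpM2l// ler_peMr// ltW.
    by rewrite -mulrA ler_wpM2l// -jb.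
  case: m => y [Qy cy]; apply: le_trans (ctl_measure ctl QQQ Qy).
  have jy0 : 0 <= jbracket y `^ alpha by exact: powR_ge0.
  have [_ h] := bracket_near_powR alpha nr cy.
  have low := ratio_le A0 AB_gt0 jy0 h AB_ge.
  rewrite lee_fin; move: (AB^-1 * ja) (A^-1 * _) ABi0 low => u v u0 uv.
  have v0 := lt_le_trans u0 uv.
  by rewrite lerXn2r// nnegrE ltW.
have m0 : 0 <= (AB^-1 * ja) ^+ d by apply: exprn_ge0; exact: (ltW ABi0).
have h0 := ctl_count ctl m0 uS E.
have Gj : 0 <= G * (ja * jd) by rewrite ltW// !mulr_gt0.
have h1 := outer_cube c Gj.
move: h0; rewrite h1.
rewrite -EFinM lee_fin => h.
apply: (@le_trans _ _ (K * jd ^+ d)); last first.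
  by rewrite ler_wpM2r ?exprn_ge0 ?(ltW jd0)// lerDr.
rewrite -(@ler_pM2r _ ((AB^-1 * ja) ^+ d)) ?exprn_gt0//.
apply: (le_trans h); apply: le_of_eq.
have -> : 2 * (G * (ja * jd)) = 2 * G * AB * (jd * (AB^-1 * ja)).
  by field; exact: lt0r_neq0.
by rewrite exprMn (exprMn d jd) /K !mulrA.
Qed.

Lemma finite_meeting (n : R) (E : set V) :
  (forall S, uniq S -> (forall Q, Q \in S -> QQ Q /\ Q `&` E !=set0) ->
    (size S)%:R <= n) ->
  finite_set [set Q | QQ Q /\ Q `&` E !=set0].
Proof.
move=> h; apply: contrapT => inf.
have [F FA sF] := infinite_set_fset (Num.bound n) inf.
have : (size F)%:R <= n.
  apply: h; first exact: finmap.fset_uniq.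
  by move=> Q QF; exact: FA.
apply/negP; rewrite -ltNge.
apply: (@lt_le_trans _ _ (Num.bound n)%:R); last by rewrite ler_nat.
by apply: archi_boundP; exact: (h [::]).
Qed.

Let rho c := AB * jbracket c `^ alpha.

Let rho_gt0 c : 0 < rho c.
Proof. by rewrite /rho mulr_gt0 ?powR_gt0 ?jbracket_gt0. Qed.

Let rhoE c (e : R) : (rho c ^+ d) `^ e =
  (AB ^+ d) `^ e * ((jbracket c `^ alpha) ^+ d) `^ e.
Proof. by rewrite /rho exprMn powRM ?exprn_ge0 ?powR_ge0 ?(ltW AB_gt0). Qed.

Lemma symbol_in_cube c r l Q : 0 < r -> bracket_near B c r -> QQ Q ->
  Q `&` cube c (2 * r) !=set0 -> exists c', forall xi,
    psi Q xi * fourier (testf l c r) xi != 0 -> cube c' (rho c) xi.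
Proof.
move=> r0 nr QQQ m; have [c' h] := member_cube nr QQQ m; exists c' => xi nz.
by have [Qxi _] := symbol_support r0 QQQ nz; exact: h.
Qed.

(** A cube that is large for this covering is cut in many pieces, each of
    which the Bernstein inequality controls by its mass. *)
Lemma split_upper : exists2 C : R, 0 < C & forall c r l, 0 < r ->
  bracket_near B c r -> r <= H * jbracket c `^ beta -> 0 <= l ->
  (modulation_norm D p q s (Tf (testf l c r)) <=
   (l * (C * (jbracket c `^ s *
     ((jbracket c `^ alpha) ^+ d) `^ (1 - recip p) *
     ((jbracket c `^ (beta - alpha)) ^+ d) `^ recip q)))%:E)%E.
Proof.
have [K K1 hK] := count_cube; have K0 := lt_le_trans ltr01 K1.
have B0 := lt_le_trans ltr01 B1.
have ABd : 0 < AB ^+ d by rewrite exprn_gt0.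
have [C0 C00 C0E] : exists2 C0, 0 < C0 & C0 = @convc R d * A * @mass R d.
  eexists; last by [].
  move: (@convc R d) (@convc_gt0 R d) (@mass R d) (@mass_gt0 R d).
  by move=> C C_0 m m0; rewrite !mulr_gt0.
have [C1 C10 C1E] : exists2 C1, 0 < C1 &
    C1 = @bernc R d * C0 * ((AB ^+ d) `^ (1 - recip p) * @mass R d `^ recip p).
  eexists; last by [].
  move: (@bernc R d) (@bernc_gt0 R d) (@mass R d) (@mass_gt0 R d).
  by move=> C C_0 m m0; rewrite !mulr_gt0 ?powR_gt0.
exists ((A * B) `^ `|s| * C1 * K `^ recip q).
  by rewrite !mulr_gt0 ?powR_gt0// mulr_gt0.
move=> c r l r0 nr rH l0.
pose J := ((jbracket c `^ alpha) ^+ d) `^ (1 - recip p).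
have J0 : 0 <= J by exact: powR_ge0.
pose jd := jbracket c `^ (beta - alpha).
have jd1 : 1 <= jd ^+ d.
  by rewrite exprn_ege1// -(powRr0 (jbracket c)) ler_powR ?jbracket_ge1// subr_ge0.
have n1 : 1 <= K * jd ^+ d by rewrite mulr_ege1.
have ct S := hK c r S r0 nr rH.
have pc Q : QQ Q -> Q `&` cube c (2 * r) !=set0 ->
    (piece D p (Tf (testf l c r)) Q <= (l * (C1 * J))%:E)%E.
  move=> QQQ m; have [c' hc'] := symbol_in_cube l r0 nr QQQ m.
  rewrite (piece_testf p1 ctl c r0 l QQQ).
  have iS := ctl_symbol ctl QQQ; have iK := ctl_kernel ctl QQQ.
  have im := cintegrable_mult_testf ctl c r0 l0 QQQ.
  have isy := cintegrable_symbol iS (cintegrable_testf l c r0).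
  apply: (le_trans (bernstein_Lp (rho_gt0 c) isy hc' im p1)).
  have L1 : \int[mu]_y cnorm (mult (psi Q) (testf l c r) y) <= l * C0.
    rewrite -lee_fin -Lpnorm1E//.
    rewrite -(piece_testf (lexx 1%E) ctl c r0 l QQQ).
    apply: (le_trans (piece_upper (lexx 1%E) ctl c r0 l0 QQQ)).
    rewrite recip_fin ?oner_neq0// invr1 subrr powRr0 mul1r powRr1 ?C0E//.
    exact: ltW (@mass_gt0 R d).
  rewrite lee_fin rhoE -/J.
  rewrite (_ : l * (C1 * J) = @bernc R d * (l * C0) *
    ((AB ^+ d) `^ (1 - recip p) * J * @mass R d `^ recip p)); last first.
    by rewrite C1E; move: (@bernc R d) => b; ring.
  have b0 := ltW (@bernc_gt0 R d); move: (@bernc R d) b0 => b b0.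
  by rewrite ler_wpM2r ?mulr_ge0 ?powR_ge0// ler_wpM2l.
apply: (le_trans (norm_upper s p1 q1 ctl r0 B1 n1 nr ct l0 _ pc)).
  by rewrite mulr_ge0// ltW.
rewrite lee_fin (powRM _ (ltW K0) (le_trans ler01 jd1)) -/J -/jd.
by apply: le_of_eq; ring.
Qed.

(** Dually, each piece pairs with the test function at most as its supremum,
    which the Bernstein inequality compares with its [p]-norm. *)
Lemma split_lower : exists2 C : R, 0 < C & forall c r l NN, 0 < r ->
  bracket_near B c r -> r <= H * jbracket c `^ beta -> 0 <= l -> 0 < NN ->
  (modulation_norm D p q s (Tf (testf l c r)) <= NN%:E)%E ->
  l * (jbracket c `^ s * r ^+ d) <=
  C * (((jbracket c `^ alpha) ^+ d) `^ recip p *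
       ((jbracket c `^ (beta - alpha)) ^+ d) `^ (1 - recip q)) * NN.
Proof.
have [K K1 hK] := count_cube; have K0 := lt_le_trans ltr01 K1.
have B0 := lt_le_trans ltr01 B1.
have ABd : 0 < AB ^+ d by rewrite exprn_gt0.
have [C0 C00 C0E] : exists2 C0, 0 < C0 &
    C0 = @bernc R d * ((AB ^+ d) `^ recip p * @mass R d `^ (1 - recip p)).
  eexists; last by [].
  move: (@bernc R d) (@bernc_gt0 R d) (@mass R d) (@mass_gt0 R d).
  by move=> C C_0 m m0; rewrite !mulr_gt0 ?powR_gt0.
have [C1 C10 C1E] : exists2 C1, 0 < C1 & C1 = @pairc R d * @mass R d * C0.
  eexists; last by [].
  move: (@pairc R d) (@pairc_gt0 R d) (@mass R d) (@mass_gt0 R d).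
  by move=> C C_0 m m0; rewrite !mulr_gt0.
have L0 := @lowc_gt0 R d.
exists ((@lowc R d)^-1 * ((A * B) `^ `|s| * (C1 * (2 * K `^ (1 - recip q))))).
  move: (@lowc R d) L0 => L L0.
  by rewrite !mulr_gt0 ?invr_gt0 ?powR_gt0// mulr_gt0.
move=> c r l NN r0 nr rH l0 N0 hN.
pose J := ((jbracket c `^ alpha) ^+ d) `^ recip p.
have J0 : 0 <= J by exact: powR_ge0.
pose jd := jbracket c `^ (beta - alpha).
have jd1 : 1 <= jd ^+ d.
  by rewrite exprn_ege1// -(powRr0 (jbracket c)) ler_powR ?jbracket_ge1// subr_ge0.
have n1 : 1 <= K * jd ^+ d by rewrite mulr_ege1.
have ct S := hK c r S r0 nr rH.
have hG Q : QQ Q -> ((cnorm (pair_ c r (mult (psi Q) (testf l c r))))%:E <=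
      piece D p (Tf (testf l c r)) Q * (C1 * J)%:E)%E.
  move=> QQQ; rewrite (piece_testf p1 ctl c r0 l QQQ).
  have iS := ctl_symbol ctl QQQ; have iK := ctl_kernel ctl QQQ.
  have im := cintegrable_mult_testf ctl c r0 l0 QQQ.
  have isy := cintegrable_symbol iS (cintegrable_testf l c r0).
  have fin : (Lpnorm p (mult (psi Q) (testf l c r))) \is a fin_num.
    rewrite ge0_fin_numE; last by rewrite LpnormE Lnorm_ge0.
    rewrite -(piece_testf p1 ctl c r0 l QQQ).
    by apply: (le_lt_trans (piece_upper p1 ctl c r0 l0 QQQ)); rewrite ltry.
  have sup : exists c', forall xi,
      psi Q xi * fourier (testf l c r) xi != 0 -> cube c' (rho c) xi.
    have [m|m] := pselect (Q `&` cube c (2 * r) !=set0).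
      exact: symbol_in_cube.
    exists c => xi nz; exfalso; apply: m; exists xi.
    exact: (symbol_support r0 QQQ nz).
  have [c' hc'] := sup.
  have bs x := bernstein_sup x (rho_gt0 c) isy hc' im p1.
  set F := mult _ _ in fin im *; move: fin bs; rewrite -/F.
  rewrite -[inv_fourier _]/F.
  case: (Lpnorm p F) => // N _ bs.
  rewrite -EFinM lee_fin.
  rewrite (_ : N * (C1 * J) = @pairc R d * @mass R d * (N * (C0 * J))); last first.
    by rewrite C1E; move: (@pairc R d) => b; ring.
  apply: pair_le_sup => // x; rewrite -lee_fin EFinM.
  rewrite (_ : C0 * J = @bernc R d * ((rho c ^+ d) `^ recip p * @mass R d `^ (1 - recip p))).
    exact: bs.
  by rewrite rhoE C0E -/J; move: (@bernc R d) => b; ring.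
have C1J : 0 <= C1 * J by rewrite mulr_ge0// ltW.
have fin := finite_meeting ct.
have := norm_lower p1 q1 ctl r0 B1 n1 nr ct l0 C1J N0 hG fin hN.
rewrite (powRM _ (ltW K0) (le_trans ler01 jd1)).
rewrite -/J -/jd; move: (@lowc R d) L0 => L L0.
have -> : l * (jbracket c `^ s * (L * r ^+ d)) =
  L * (l * (jbracket c `^ s * r ^+ d)) by ring.
rewrite -ler_pdivlMl// => /le_trans; apply; apply: le_of_eq; ring.
Qed.

End uniform_bounds.

(** * Consequences of an embedding *)

Section growth.
Context {R : realType}.

Lemma growth_exponent (a C : R) :
  (forall N : R, exists2 x, N <= x & x `^ a <= C) -> a <= 0.
Proof.
move=> h; rewrite leNgt; apply/negP => a0.
pose C1 := 1 + `|C|; have C10 : 0 < C1 by rewrite /C1 ltr_pwDl.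
have [x Nx] := h (C1 `^ a^-1).
apply/negP; rewrite -ltNge; apply: (@lt_le_trans _ _ C1).
  by apply: (le_lt_trans (ler_norm C)); rewrite /C1; lra.
rewrite -[leLHS](@powRr1 _ C1) ?(ltW C10)// -(mulVf (lt0r_neq0 a0)) powRrM.
have x0 := le_trans (powR_ge0 _ _) Nx.
by rewrite ge0_ler_powR ?nnegrE ?(ltW a0) ?powR_ge0.
Qed.

Lemma powRX_pow (x a e : R) (n : nat) :
  ((x `^ a) ^+ n) `^ e = x `^ (a * n%:R * e).
Proof. by rewrite -powR_mulrn ?powR_ge0// -!powRrM mulrA. Qed.

Lemma side_power (H x b e r : R) (n : nat) : 0 < H -> 0 <= e -> 0 <= r ->
  H^-1 * x `^ b <= r ->
  (H^-1 ^+ n) `^ e * x `^ (n%:R * b * e) <= (r ^+ n) `^ e.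
Proof.
move=> H0 e0 r0 h; rewrite (mulrC n%:R) -powRX_pow.
have Hx : 0 <= H^-1 * x `^ b by rewrite mulr_ge0 ?powR_ge0 ?invr_ge0 ?(ltW H0).
rewrite -powRM ?exprn_ge0 ?powR_ge0 ?invr_ge0 ?(ltW H0)// -exprMn.
rewrite ge0_ler_powR ?nnegrE ?exprn_ge0//.
by rewrite lerXn2r ?nnegrE.
Qed.

End growth.

Section embedding.
Context {R : realType} {d : nat}.
Local Notation V := 'rV[R]_d.
Local Notation mu := (leb R d).
Hypothesis d_gt0 : (0 < d)%N.
Implicit Types (p q : \bar R) (c x : V).

Lemma tempered0 : @tempered R d (fun=> 0).
Proof.
split; first by move=> *; rewrite mulr0 addr0.
by exists 0%N, 0 => phi _; rewrite cnorm0 mul0e.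
Qed.

Lemma mod_norm0 (alpha : R) (D : @modulation_data R d alpha) p q s :
  (1 <= p)%E -> (1 <= q)%E ->
  (modulation_norm D p q s (fun=> 0%R) <= 0)%E.
Proof.
move=> p1 q1.
have E Q : piece D p (fun=> 0) Q = 0%E.
  apply/eqP; rewrite eq_le piece_ge0 andbT.
  apply: ereal_inf_lbound; exists (fun=> 0).
    split; [exact: measurable_cst|exact: measurable_cst|] => phi _ /=.
    rewrite -[RHS](@eq_cint _ _ _ mu (fun=> 0)) ?cint0// => y.
    by rewrite mul0r.
  rewrite LpnormE.
  rewrite (_ : (fun x => _) = cst 0%E); last by apply/funext => x; rewrite cnorm0.
  by rewrite Lnorm0// gt_eqF// (lt_le_trans _ p1).
have := @mod_norm_upper _ _ _ D p q s q1 (fun=> 0) 0 0 1.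
rewrite !mul0r; apply => //.
- by move=> Q _; rewrite E.
- by move=> Q _; rewrite E eqxx.
- by case=> [|Q S] _ hS; [rewrite ler01|have [] := hS Q (mem_head _ _); rewrite E eqxx].
Qed.

(** Continuity at zero, rescaled, compares the sizes of a test function in the
    two norms. *)
Lemma embedding_compare (alpha beta : R) (D : @modulation_data R d alpha)
    (E : @modulation_data R d beta) p q s t : (1 <= p)%E -> (1 <= q)%E ->
  modulation_embedding D E p q s t ->
  exists2 K : R, 0 < K & forall c r U L C, 0 < r -> 0 < U ->
    (forall l, 0 <= l ->
      (modulation_norm D p q s (Tf (testf l c r)) <= (l * U)%:E)%E) ->
    (forall l NN, 0 <= l -> 0 < NN ->
      (modulation_norm E p q t (Tf (testf l c r)) <= NN%:E)%E ->
      l * L <= C * NN) ->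
    L <= K * C * U.
Proof.
move=> p1 q1 [_ emb].
have X0 : modulation_space D p q s (fun=> 0).
  split; first exact: tempered0.
  by apply: (le_lt_trans (mod_norm0 D s p1 q1)); rewrite ltry.
have [rho rho0 h] := emb _ X0 1 ltr01.
exists (2 / rho); first by rewrite divr_gt0.
move=> c r U L C r0 U0 hU hL.
pose l := rho / (2 * U).
have l0 : 0 < l by rewrite divr_gt0// mulr_gt0.
have lU : l * U = rho / 2 by rewrite /l; field; exact: lt0r_neq0.
have nD := hU l (ltW l0); rewrite lU in nD.
have fE : (fun phi => Tf (testf l c r) phi - 0) = Tf (testf l c r).
  by apply/funext => phi; rewrite subr0.
have := h (Tf (testf l c r)); rewrite fE => h'.
have nE : (modulation_norm E p q t (Tf (testf l c r)) < 1%:E)%E.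
  apply: h'; last first.
    by apply: (le_lt_trans nD); rewrite lte_fin ltr_pdivrMr// ltr_pMr// ltr1n.
  split; first by apply: tempered_Tf; exact: cintegrable_testf.
  by apply: (le_lt_trans nD); rewrite ltry.
have := hL l 1 (ltW l0) ltr01 (ltW nE).
rewrite mulr1 mulrC -ler_pdivlMr// => /le_trans; apply; apply: le_of_eq.
by rewrite /l; field; rewrite !lt0r_neq0.
Qed.

Lemma far_point (N : R) : exists x : V, N <= jbracket x.
Proof.
exists (const_mx N); have := coord_le_jbracket (const_mx N) (Ordinal d_gt0).
by rewrite mxE; apply: le_trans; exact: ler_norm.
Qed.

(** Some member is a neighbourhood of any given point, because the partition
    of unity is continuous and does not vanish there. *)
Lemma small_cube (alpha : R) (D : @modulation_data R d alpha) x :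
  exists2 Q, md_cover D Q & exists2 r0 : R, 0 < r0 &
    forall r, r <= r0 -> cube x (2 * r) `<=` Q.
Proof.
have [Cc _ hs _] := md_bapuP D.
have [Q QQQ nz] : exists2 Q, md_cover D Q & md_bapu D Q x != 0.
  apply: contrapT => no; have := hs x; rewrite fsbig1.
    by move=> /esym/eqP; rewrite oner_eq0.
  by move=> Q QQQ; apply/eqP; apply: contra_notT no => nz; exists Q.
exists Q => //; have [[sRe sIm] _] := Cc Q QQQ.
have : nbhs x [set y | md_bapu D Q y != 0].
  have nzC (g : V -> R) : continuous g -> g x != 0 -> nbhs x [set y | g y != 0].
    move=> cg gx; apply: (cg x [set z | z != 0]); by apply: open_nbhs_nbhs; split.
  have [re|re] := eqVneq (complex.Re (md_bapu D Q x)) 0.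
    have im : complex.Im (md_bapu D Q x) != 0.
      by apply: contraNneq nz => im; apply/eqP; exact: complex_eq.
    apply: filterS (nzC _ (sIm [::]).1 im) => y /=.
    by apply: contraNneq => ->.
  apply: filterS (nzC _ (sRe [::]).1 re) => y /=.
  by apply: contraNneq => ->.
rewrite -nbhs_ballE => -[e /= e0 he]; exists (e / 4); first by rewrite divr_gt0.
move=> r re y hy; apply: (psi_off QQQ); apply: he; split => // i j.
rewrite (ord1 i) /ball/= distrC (le_lt_trans (hy j))//.
by lra.
Qed.

Lemma large_cube (alpha : R) (D : @modulation_data R d alpha) A :
  controlled D A -> exists2 H : R, 1 <= H & forall N : R, exists c r Q,
    [/\ md_cover D Q, 0 < r, cube c (2 * r) `<=` Q & N <= jbracket c] /\
    H^-1 * jbracket c `^ alpha <= r /\ r <= H * jbracket c `^ alpha.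
Proof.
move=> ctl; have A1 := ctl_ge1 ctl; have A0 := lt_le_trans ltr01 A1.
pose P := A `^ `|alpha|.
have P1 : 1 <= P by rewrite -(powRr0 A) ler_powR.
have P0 := lt_le_trans ltr01 P1.
exists (2 * (A * P)).
  have := mulr_ege1 A1 P1; lra.
move=> N; have [x Nx] := far_point (A * `|N|).
have [[_ cov _] _ _ _] := md_coverP D.
have [Q QQQ Qx] : (\bigcup_(Q in md_cover D) Q) x by rewrite cov.
have [c [r [cQ rl ru]]] := ctl_inner ctl QQQ Qx.
have jx0 : 0 < jbracket x `^ alpha by rewrite powR_gt0// jbracket_gt0.
have r0 : 0 < r by apply: lt_le_trans rl; rewrite mulr_gt0// invr_gt0.
have Qc : Q c by apply: cQ; apply: cube_center; exact: ltW.
have xc := ctl_bracket ctl QQQ Qx Qc; have cx := ctl_bracket ctl QQQ Qc Qx.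
have h1 := powR_comparable alpha A1 (jbracket_gt0 x) (jbracket_gt0 c) xc cx.
have h2 := powR_comparable alpha A1 (jbracket_gt0 c) (jbracket_gt0 x) cx xc.
exists c, (r / 2), Q; split.
  split => //; first by rewrite divr_gt0.
    by rewrite mulrC divfK ?pnatr_eq0.
  rewrite -(ler_pM2l A0); apply: le_trans xc; apply: le_trans Nx.
  by rewrite ler_wpM2l ?(ltW A0)// ler_norm.
move: (jbracket c `^ alpha) (jbracket x `^ alpha) jx0 h1 h2 rl ru.
rewrite -/P => u v v0 vu uv rl ru; split.
  rewrite invfM -mulrA mulrC ler_wpM2r ?invr_ge0//; apply: le_trans rl.
  exact: (ratio_le A0 (mulr_gt0 A0 P0) (ltW v0) uv (lexx _)).
rewrite ler_pdivrMr// (le_trans ru)//.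
have h3 : A * v <= A * P * u by rewrite -mulrA ler_wpM2l// ltW.
have h4 : 0 <= A * P * u by apply: le_trans h3; rewrite mulr_ge0 ?(ltW A0) ?(ltW v0).
apply: (le_trans h3); lra.
Qed.

End embedding.

Section exponents.
Context {R : realType} {d : nat}.
Hypothesis d_gt0 : (0 < d)%N.
Context (p q : \bar R).
Hypotheses (p1 : (1 <= p)%E) (q1 : (1 <= q)%E).

(** A test function below the scale of both coverings sees the weights only. *)
Lemma embedding_weight (alpha beta : R) (D : @modulation_data R d alpha)
    (E : @modulation_data R d beta) (s t : R) :
  0 <= alpha -> alpha <= 1 -> 0 <= beta -> beta <= 1 ->
  modulation_embedding D E p q s t -> t <= s.
Proof.
move=> a0 a1 b0 b1 emb.
have [A ctl] := exists_controlled d_gt0 D a0 a1.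
have [A' ctl'] := exists_controlled d_gt0 E b0 b1.
have [K K0 hK] := embedding_compare p1 q1 emb.
have [CU CU0 hU] := member_upper s p1 q1 ctl.
have [CL CL0 hL] := member_lower t p1 q1 ctl'.
rewrite -subr_le0; apply: (@growth_exponent _ _ (K * CL * CU)) => N.
have [x Nx] := far_point d_gt0 N; exists (jbracket x) => //.
have [Q1 QQ1 [r1 r10 h1]] := small_cube D x.
have [Q2 QQ2 [r2 r20 h2]] := small_cube E x.
pose r := Num.min r1 r2.
have r0 : 0 < r by rewrite lt_min r10.
have c1 : cube x (2 * r) `<=` Q1 by apply: h1; rewrite ge_min lexx.
have c2 : cube x (2 * r) `<=` Q2 by apply: h2; rewrite ge_min lexx orbT.
pose X := (r ^+ d) `^ (1 - recip p).
have X0 : 0 < X by rewrite powR_gt0// exprn_gt0.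
have j0 := jbracket_gt0 x.
have U0 : 0 < CU * (jbracket x `^ s * X).
  by apply: mulr_gt0 => //; apply: mulr_gt0 => //; exact: powR_gt0.
have := hK x r _ (jbracket x `^ t * X) CL r0 U0
  (fun l => hU x r Q1 l r0 QQ1 c1) (fun l NN => hL x r Q2 l NN r0 QQ2 c2).
have -> : K * CL * (CU * (jbracket x `^ s * X)) =
  K * CL * CU * jbracket x `^ s * X by ring.
rewrite ler_pM2r// => h.
rewrite powRB ?(lt0r_neq0 j0) ?implybT//.
by rewrite ler_pdivrMr ?powR_gt0.
Qed.

Section two_scales.
Context (alpha beta : R) (D : @modulation_data R d alpha)
  (E : @modulation_data R d beta) (s t : R).
Hypotheses (alpha0 : 0 <= alpha) (alpha_beta : alpha <= beta) (beta1 : beta <= 1).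

(** A member of the coarser covering is one piece for the coarser norm, and
    about [jbracket c `^ (d * (beta - alpha))] pieces for the finer one. *)
Lemma embedding_fine_coarse : modulation_embedding D E p q s t ->
  t <= s + d%:R * (beta - alpha) * (recip q - (1 - recip p)).
Proof.
move=> emb.
have [A ctl] := exists_controlled d_gt0 D alpha0 (le_trans alpha_beta beta1).
have [A' ctl'] := exists_controlled d_gt0 E (le_trans alpha0 alpha_beta) beta1.
have [K K0 hK] := embedding_compare p1 q1 emb.
have [H H1 hH] := large_cube d_gt0 ctl'.
have H0 := lt_le_trans ltr01 H1.
have [CU CU0 hU] := split_upper s p1 q1 ctl alpha_beta (ctl_ge1 ctl') (ltW H0)
  (lexx _).
have [CL CL0 hL] := member_lower t p1 q1 ctl'.
pose e := 1 - recip p.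
pose a := t + d%:R * beta * e - (s + d%:R * alpha * e +
  d%:R * (beta - alpha) * recip q).
suff : a <= 0 by rewrite /a /e; lra.
pose h := (H^-1 ^+ d) `^ e.
have h0 : 0 < h by rewrite powR_gt0// exprn_gt0// invr_gt0.
apply: (@growth_exponent _ _ (K * CL * CU / h)) => N.
have [c [r [Q [[QQQ r0 cQ Nc] [rl ru]]]]] := hH N; exists (jbracket c) => //.
have nr := bracket_near_member ctl' r0 QQQ cQ.
have j0 := jbracket_gt0 c.
have jn := lt0r_neq0 j0.
have U0 : 0 < CU * (jbracket c `^ s * ((jbracket c `^ alpha) ^+ d) `^ e *
     ((jbracket c `^ (beta - alpha)) ^+ d) `^ recip q).
  by rewrite !mulr_gt0 ?powR_gt0 ?exprn_gt0 ?powR_gt0.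
have := hK c r _ _ CL r0 U0
  (fun l => hU c r l r0 nr ru) (fun l NN => hL c r Q l NN r0 QQQ cQ).
have lowr : h * jbracket c `^ (d%:R * beta * e) <= (r ^+ d) `^ e.
  apply: side_power => //; last exact: ltW.
  by rewrite ?subr_ge0; have /andP[] := recip_itv p1.
rewrite !powRX_pow.
rewrite (_ : alpha * d%:R * e = d%:R * alpha * e); last by rewrite (mulrC alpha).
rewrite (_ : (beta - alpha) * d%:R * recip q = d%:R * (beta - alpha) * recip q);
  last by rewrite (mulrC (beta - alpha)).
move=> hh.
have ht : jbracket c `^ t * (h * jbracket c `^ (d%:R * beta * e)) <=
    K * CL * (CU * (jbracket c `^ s * jbracket c `^ (d%:R * alpha * e) *
      jbracket c `^ (d%:R * (beta - alpha) * recip q))).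
  by apply: le_trans hh; rewrite ler_wpM2l ?powR_ge0.
rewrite /a powRB ?jn ?implybT// ler_pdivrMr ?powR_gt0//.
rewrite !powRD ?jn ?implybT//.
rewrite -(ler_pM2r h0).
rewrite (_ : _ * h = jbracket c `^ t * (h * jbracket c `^ (d%:R * beta * e))).
  apply: (le_trans ht); apply: le_of_eq; field; exact: lt0r_neq0.
ring.
Qed.

(** The same comparison in the other direction: here the finer norm has to be
    bounded from below, by duality. *)
Lemma embedding_coarse_fine : modulation_embedding E D p q t s ->
  s + d%:R * (beta - alpha) * (recip q - (1 - recip p)) <= t.
Proof.
move=> emb.
have [A ctl] := exists_controlled d_gt0 D alpha0 (le_trans alpha_beta beta1).
have [A' ctl'] := exists_controlled d_gt0 E (le_trans alpha0 alpha_beta) beta1.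
have [K K0 hK] := embedding_compare p1 q1 emb.
have [H H1 hH] := large_cube d_gt0 ctl'.
have H0 := lt_le_trans ltr01 H1.
have [CL CL0 hL] := split_lower s p1 q1 ctl alpha_beta (ctl_ge1 ctl') (ltW H0)
  (lexx _).
have [CU CU0 hU] := member_upper t p1 q1 ctl'.
pose e := recip p.
pose a := s + d%:R * beta * e - (t + d%:R * alpha * e +
  d%:R * (beta - alpha) * (1 - recip q)).
suff : a <= 0 by rewrite /a /e; lra.
pose h := (H^-1 ^+ d) `^ e.
have h0 : 0 < h by rewrite powR_gt0// exprn_gt0// invr_gt0.
apply: (@growth_exponent _ _ (K * CL * CU / h)) => N.
have [c [r [Q [[QQQ r0 cQ Nc] [rl ru]]]]] := hH N; exists (jbracket c) => //.
have nr := bracket_near_member ctl' r0 QQQ cQ.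
have j0 := jbracket_gt0 c.
have jn := lt0r_neq0 j0.
pose X := (r ^+ d) `^ (1 - recip p).
have X0 : 0 < X by rewrite powR_gt0// exprn_gt0.
have U0 : 0 < CU * (jbracket c `^ t * X).
  by apply: mulr_gt0 => //; apply: mulr_gt0 => //; exact: powR_gt0.
have hL' l NN : 0 <= l -> 0 < NN ->
  (modulation_norm D p q s (Tf (testf l c r)) <= NN%:E)%E ->
  l * (jbracket c `^ s * r ^+ d) <=
  CL * (jbracket c `^ (d%:R * alpha * e) *
    jbracket c `^ (d%:R * (beta - alpha) * (1 - recip q))) * NN.
  move=> l0 N0 /(hL c r l NN r0 nr ru l0 N0); rewrite !powRX_pow.
  rewrite (_ : alpha * d%:R * recip p = d%:R * alpha * e); last first.
    by rewrite (mulrC alpha).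
  by rewrite (mulrC (beta - alpha)).
have := hK c r _ _ _ r0 U0 (fun l => hU c r Q l r0 QQQ cQ) hL'.
have -> : r ^+ d = (r ^+ d) `^ e * X.
  have rd0 : 0 < r ^+ d by rewrite exprn_gt0.
  rewrite /X -powRD; last by rewrite lt0r_neq0// implybT.
  by rewrite addrC subrK powRr1// ltW.
have lowr : h * jbracket c `^ (d%:R * beta * e) <= (r ^+ d) `^ e.
  apply: side_power => //; last exact: ltW.
  by rewrite ?subr_ge0; have /andP[] := recip_itv p1.
move: ((r ^+ d) `^ e) lowr => Y lowr hh.
have ht : jbracket c `^ s * (h * jbracket c `^ (d%:R * beta * e)) * X <=
    K * CL * CU * (jbracket c `^ t * jbracket c `^ (d%:R * alpha * e) *
      jbracket c `^ (d%:R * (beta - alpha) * (1 - recip q))) * X.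
  apply: (@le_trans _ _ (jbracket c `^ s * (Y * X))).
    rewrite [leRHS]mulrA; move: X X0 {U0 hh} => X X0.
    by rewrite ler_wpM2r ?(ltW X0)// ler_wpM2l ?powR_ge0.
  by apply: (le_trans hh); apply: le_of_eq; ring.
rewrite ler_pM2r// in ht.
rewrite /a powRB ?jn ?implybT// ler_pdivrMr ?powR_gt0//.
rewrite !powRD ?jn ?implybT//.
rewrite -(ler_pM2r h0).
rewrite (_ : _ * h = jbracket c `^ s * (h * jbracket c `^ (d%:R * beta * e))).
  apply: (le_trans ht); apply: le_of_eq; field; exact: lt0r_neq0.
ring.
Qed.

End two_scales.

End exponents.

Theorem corollary4p6 (R : realType) (d : nat) (d_gt0 : (0 < d)%N)
    (p q : \bar R) (p_ge1 : (1 <= p)%E) (q_ge1 : (1 <= q)%E)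
    (s t alpha1 alpha2 : R) (alpha1_ge0 : 0 <= alpha1)
    (alpha12 : alpha1 <= alpha2) (alpha2_le1 : alpha2 <= 1)
    (D1 : @modulation_data R d alpha1) (D2 : @modulation_data R d alpha2) :
  (recip p <= Num.max (1 / 2) (recip q) ->
    modulation_embedding D1 D2 p q s t ->
    t <= s + d%:R * (alpha2 - alpha1) * theta2 p q) /\
  (recip p >= Num.min (1 / 2) (recip q) ->
    modulation_embedding D2 D1 p q t s ->
    t >= s + d%:R * (alpha2 - alpha1) * theta1 p q).
Proof.
have alpha1_le1 := le_trans alpha12 alpha2_le1.
have alpha2_ge0 := le_trans alpha1_ge0 alpha12.
have conj : recip (hoelder_conjugate p) = 1 - recip p.
  by rewrite -(recip_conjugate p_ge1) addrC addKr.
split=> [hpq emb|hpq emb].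
- have ts := embedding_weight d_gt0 p_ge1 q_ge1 alpha1_ge0 alpha1_le1
    alpha2_ge0 alpha2_le1 emb.
  have tb := embedding_fine_coarse d_gt0 p_ge1 q_ge1 alpha1_ge0 alpha12 alpha2_le1 emb.
  rewrite /theta2 conj; have [h|h] := leP (recip p) (1 / 2).
    rewrite (max_idPr _); last by lra.
    by rewrite /Num.min; case: ifP => // _; rewrite mulr0 addr0.
  have hq : recip p <= recip q.
    by move: hpq; rewrite le_max => /orP[hp|//]; lra.
  rewrite (max_idPl _); last by lra.
  by rewrite (min_idPl _) ?mulr0 ?addr0// subr_ge0.
- have st := embedding_weight d_gt0 p_ge1 q_ge1 alpha2_ge0 alpha2_le1
    alpha1_ge0 alpha1_le1 emb.
  have tb := embedding_coarse_fine d_gt0 p_ge1 q_ge1 alpha1_ge0 alpha12 alpha2_le1 emb.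
  rewrite /theta1 conj; have [h|h] := leP (1 / 2) (recip p).
    rewrite (min_idPr _); last by lra.
    by rewrite /Num.max; case: ifP => // _; rewrite mulr0 addr0.
  have hq : recip q <= recip p.
    by move: hpq; rewrite ge_min => /orP[hp|//]; lra.
  rewrite (min_idPl _); last by lra.
  by rewrite (max_idPl _) ?mulr0 ?addr0// subr_le0.
Qed.
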